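(* Consider $N$ fully actuated agents communicating on a connected, fixed, undirected graph $\mathbb{G}$ and evolving on a Lie group $G\in\mathcal{G}_u$ according to $\tfrac{d}{dt}g_k=L_{g_k*}\xi^l_k$, $k=1,\dots,N$, with the controller $$\xi^l_k=\eta^l_k+q_k,\qquad q_k=\Big\langle \eta^l_k,\ \sum_{j\rightsquigarrow k}\big(\eta^l_k-\mathrm{Ad}_{g_k^{-1}g_j}\,\eta^l_j\big)\Big\rangle,\qquad \tfrac{d}{dt}\eta^l_k=\sum_{j\rightsquigarrow k}(\eta^l_j-\eta^l_k),\qquad k=1,\dots,N.$$ Then: (i) For any initial conditions $\eta^l_k(0)$, the $\eta^l_k(t)$ exponentially converge to $\overline{\eta^l}:=\frac1N\sum_k\eta^l_k(0)$. (ii) Define $\overline{V_{tl}}(g_1,\dots,g_N):=\tfrac12\sum_k\sum_{j\rightsquigarrow k}\big\|\mathrm{Ad}_{g_k}\overline{\eta^l}-\mathrm{Ad}_{g_j}\overline{\eta^l}\big\|^2$. All solutions converge to the critical set of $\overline{V_{tl}}$. In particular, right-invariant coordination is asymptotically achieved. (iii) Total coordination is (at least locally) asymptotically stable.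
   Context: $\mathfrak{g}$ is the Lie algebra of $G$, identified with $\mathbb{R}^n$; $\cdot$ and $\|\cdot\|$ are the canonical scalar product and the Euclidean norm on $\mathfrak{g}\cong\mathbb{R}^n$, and $[\cdot,\cdot]$ is the Lie bracket. $L_{h*},R_{h*}$ are the tangent maps of left and right multiplication, and $\mathrm{Ad}_g=R_{g^{-1}*}L_{g*}$. $\mathcal{G}_u$ is the class of compact Lie groups with unitary adjoint representation, i.e. $\|\mathrm{Ad}_g\,\xi\|=\|\xi\|$ for all $g\in G$, $\xi\in\mathfrak{g}$. Fully actuated means that any $\xi^l_k\in\mathfrak{g}$ can be assigned as control. The bilinear map $\langle\cdot,\cdot\rangle:\mathfrak{g}\times\mathfrak{g}\to\mathfrak{g}$ is defined by $\xi_1\cdot\langle\xi_2,\xi_3\rangle+[\xi_1,\xi_2]\cdot\xi_3=0$ for all $\xi_1,\xi_2,\xi_3\in\mathfrak{g}$. The communication graph $\mathbb{G}$ has the agents as vertices; $j\rightsquigarrow k$ means that $j$ sends information to $k$, and $\mathbb{G}$ undirected means $j\rightsquigarrow k\Leftrightarrow k\rightsquigarrow j$. The $\eta^l_k\in\mathfrak{g}$ are auxiliary variables of the agents (part of the closed-loop state). The right-invariant velocity of agent $k$ is $\xi^r_k=R_{g_k^{-1}*}\tfrac{d}{dt}g_k=\mathrm{Ad}_{g_k}\xi^l_k$. Right-invariant coordination means that $g_jg_k^{-1}$ is constant for all $j,k$, equivalently $\xi^l_j=\xi^l_k$ for all $j,k$; asymptotic achievement means $\xi^l_j-\xi^l_k\to0$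 for all $j,k$. Left-invariant coordination means that $g_k^{-1}g_j$ is constant for all $j,k$, equivalently $\xi^r_j=\xi^r_k$ for all $j,k$. Total coordination means both simultaneously; for this closed-loop system it is the situation in which all $\eta^l_k$ equal $\overline{\eta^l}$ and $\overline{V_{tl}}=0$. *)

(* Defs.v *)
From HB Require Import structures.
From mathcomp Require Import all_boot all_order all_algebra.
From mathcomp Require Import all_classical all_reals all_analysis.

Set Implicit Arguments.
Unset Strict Implicit.
Unset Printing Implicit Defensive.

Import Order.TTheory GRing.Theory Num.Theory.
Import numFieldNormedType.Exports.

Local Open Scope classical_set_scope.
Local Open Scope ring_scope.

(* C^k and C^oo on an open set U, by iterated directional derivatives; the
   normed spaces are meant to be finite-dimensional. *)
Fixpoint Ck_on (R : realType) (V W : normedModType R) (k : nat) (U : set V)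
    (f : V -> W) : Prop :=
  match k with
  | 0 => forall x, U x -> {for x, continuous f}
  | k'.+1 => (forall x, U x -> differentiable f x) /\
             (forall v, Ck_on k' U (fun x => 'D_v f x))
  end.

Definition smooth_on (R : realType) (V W : normedModType R) (U : set V)
    (f : V -> W) : Prop := forall k, Ck_on k U f.

(* A homeomorphism between an open subset of T and an open subset of R^n; both
   maps are total functions with irrelevant values outside these sets. *)
Record chart (R : realType) (n : nat) (T : topologicalType) := Chart {
  chart_dom : set T;
  chart_cod : set 'rV[R]_n;
  chart_fun :> T -> 'rV[R]_n;
  chart_inv : 'rV[R]_n -> T;
  chart_dom_open : open chart_dom;
  chart_cod_open : open chart_cod;
  chart_funS : forall p, chart_dom p -> chart_cod (chart_fun p);
  chart_invS : forall x, chart_cod x -> chart_dom (chart_inv x);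
  chart_funK : forall p, chart_dom p -> chart_inv (chart_fun p) = p;
  chart_invK : forall x, chart_cod x -> chart_fun (chart_inv x) = x;
  chart_fun_cont : forall p, chart_dom p -> {for p, continuous chart_fun};
  chart_inv_cont : forall x, chart_cod x -> {for x, continuous chart_inv}
}.

(* An n-dimensional real Lie group. The smooth structure is given by an atlas
   indexed by the points of G, chart_at p being a chart around p. *)
HB.mixin Record isLieGroup (R : realType) (n : nat) G
    of Topological G & Group G := {
  lie_hausdorff : hausdorff_space G;
  lie_second_countable : @second_countable G;
  chart_at : G -> chart R n G;
  chart_at_dom : forall p, chart_dom (chart_at p) p;
  chart_transition_smooth : forall p q,
    smooth_on [set x | chart_cod (chart_at p) x /\
                       chart_dom (chart_at q) (chart_inv (chart_at p) x)]
      (fun x => chart_at q (chart_inv (chart_at p) x));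
  lie_mul_cont : continuous (fun z : G * G => (z.1 * z.2)%g);
  lie_inv_cont : continuous (fun x : G => (x^-1)%g);
  lie_mul_smooth : forall p q r,
    smooth_on [set z : 'rV[R]_n * 'rV[R]_n |
        [/\ chart_cod (chart_at p) z.1, chart_cod (chart_at q) z.2 &
            chart_dom (chart_at r)
              (chart_inv (chart_at p) z.1 * chart_inv (chart_at q) z.2)%g]]
      (fun z => chart_at r
              (chart_inv (chart_at p) z.1 * chart_inv (chart_at q) z.2)%g);
  lie_inv_smooth : forall p q,
    smooth_on [set x | chart_cod (chart_at p) x /\
                       chart_dom (chart_at q) (chart_inv (chart_at p) x)^-1%g]
      (fun x => chart_at q (chart_inv (chart_at p) x)^-1%g)
}.

#[short(type="lieGroupType")]
HB.structure Definition LieGroup (R : realType) (n : nat) :=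
  { G of isLieGroup R n G & Topological G & Group G }.

Section Euclidean.
Context {R : realType} {n : nat}.
Implicit Types u v : 'rV[R]_n.

Definition dotv u v : R := \sum_i u 0 i * v 0 i.

(* The library norm of 'rV[R]_n is the sup norm. *)
Definition enorm u : R := Num.sqrt (dotv u u).

End Euclidean.

(* The tangent space at p is represented by 'rV[R]_n through chart_at p. In
   particular the Lie algebra T_1 G is identified with R^n through chart_at 1,
   and any linear identification arises from a suitable choice of this chart. *)
Section LieTheory.
Context {R : realType} {n : nat} {G : lieGroupType R n}.
Implicit Types (p g : G) (xi zeta : 'rV[R]_n).

Definition atl p : chart R n G := @chart_at R n G p.

(* T_p f : T_p G -> T_(f p) G *)
Definition tangent_map (f : G -> G) p : 'rV[R]_n -> 'rV[R]_n :=
  'd (fun x => atl (f p) (f (chart_inv (atl p) x))) (atl p p).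

Definition Lstar g p := tangent_map (fun y => (g * y)%g) p.
Definition Rstar g p := tangent_map (fun y => (y * g)%g) p.

Definition Ad g xi : 'rV[R]_n := Rstar g^-1%g g (Lstar g 1%g xi).

(* d/dt c = v at time t, with v in T_(c t) G *)
Definition has_velocity (c : R -> G) (t : R) (v : 'rV[R]_n) : Prop :=
  {for t, continuous c} /\ is_derive t 1 (fun s => atl (c t) (c s)) v.

(* The left-invariant vector field h |-> L_h* xi, in the coordinates of the
   chart around 1. *)
Definition left_field xi (x : 'rV[R]_n) : 'rV[R]_n :=
  let h := chart_inv (atl 1%g) x in
  'd (fun y => atl 1%g (h * chart_inv (atl 1%g) y)%g) (atl 1%g 1%g) xi.

(* Lie bracket of left-invariant vector fields at the identity, from the
   coordinate formula [X, Y] = DY.X - DX.Y and left_field xi (at 1) = xi. *)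
Definition bracket xi zeta : 'rV[R]_n :=
  'd (left_field zeta) (atl 1%g 1%g) xi - 'd (left_field xi) (atl 1%g 1%g) zeta.

End LieTheory.

(* x(t) tends to the set A as t -> +oo: eventually in every open neighbourhood
   of A (equivalent to dist(x(t), A) -> 0 when A is compact). *)
Definition converges_to_set (R : realType) (X : topologicalType) (x : R -> X)
    (A : set X) : Prop :=
  forall U : set X, open U -> A `<=` U -> \forall t \near +oo, U (x t).

(* Local asymptotic stability of the set A for the solutions in sol, in the
   presence of conserved quantities with level set M containing A: Lyapunov
   stability under arbitrary small perturbations, and local attractivity for
   perturbations inside M (a solution starting off M stays off M, so that it
   need not tend to A). *)
Definition asymptotically_stable (R : realType) (X : topologicalType)
    (sol : set (R -> X)) (M A : set X) : Prop :=
  (forall U : set X, open U -> A `<=` U ->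
     exists W : set X, [/\ open W, A `<=` W &
       forall x, sol x -> W (x 0) -> forall t, 0 <= t -> U (x t)]) /\
  (exists W : set X, [/\ open W, A `<=` W &
     forall x, sol x -> M (x 0) -> W (x 0) -> converges_to_set x A]).

Section Coordination.
Context {R : realType} {n : nat} {G : lieGroupType R n} {N : nat}.

(* (g_k)_k and (eta_k)_k, with the product topology *)
Definition state : topologicalType :=
  ({ptws 'I_N -> G} * {ptws 'I_N -> 'rV[R]_n})%type.

(* e j k : agent j sends information to agent k *)
Variable e : rel 'I_N.
Variable angle : 'rV[R]_n -> 'rV[R]_n -> 'rV[R]_n.

Definition qctrl (s : state) (k : 'I_N) : 'rV[R]_n :=
  angle (s.2 k)
    (\sum_(j | e j k) (s.2 k - Ad ((s.1 k)^-1 * s.1 j)%g (s.2 j))).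

(* The left-invariant velocity xi^l_k. *)
Definition xil (s : state) (k : 'I_N) : 'rV[R]_n := s.2 k + qctrl s k.

(* Solutions on [0, +oo); values at negative times are irrelevant. *)
Definition closed_loop : set (R -> state) := [set x : R -> state |
  [/\ {within `[(0 : R), +oo[, continuous x},
      forall (t : R) (k : 'I_N), 0 < t ->
        has_velocity (fun s => (x s).1 k) t (Lstar ((x t).1 k) 1%g (xil (x t) k)) &
      forall (t : R) (k : 'I_N), 0 < t ->
        is_derive t 1 (fun s => (x s).2 k)
          (\sum_(j | e j k) ((x t).2 j - (x t).2 k))]].

Definition mean_eta (s : state) : 'rV[R]_n := N%:R^-1 *: \sum_k s.2 k.

Definition Vtl (etabar : 'rV[R]_n) (g : {ptws 'I_N -> G}) : R :=
  2^-1 * \sum_k \sum_(j | e j k)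
           enorm (Ad (g k) etabar - Ad (g j) etabar) ^+ 2.

(* The points of G^N where the differential of f vanishes; row k of the matrix
   of product coordinates around g is in the chart at g k. *)
Definition critical_set (f : {ptws 'I_N -> G} -> R) : set {ptws 'I_N -> G} :=
  [set g | let F := fun x : 'M[R]_(N, n) =>
                      f (fun k => chart_inv (atl (g k)) (row k x)) in
           let x0 := \matrix_(k < N) atl (g k) (g k) in
           differentiable F x0 /\ forall v, 'd F x0 v = 0].

Definition total_coordination (etabar : 'rV[R]_n) : set state :=
  [set s | (forall k, s.2 k = etabar) /\ Vtl etabar s.1 = 0].

End Coordination.
Arguments state {R n} G N.

(* Main.v *)
(** Write b for the conserved mean of the eta_k and a_k = Ad_{g_k} b. Unitarity
    makes every ad_x skew, so <x, y> = [y, x] and the controller acts on b by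
    brackets. Up to a perturbation that is linear in eta_k - b, the potential V
    decreases along solutions at the rate Q = sum_k |[sum_j (a_k - a_j), a_k]|^2.
    The perturbation is absorbed by a multiple of E = sum_k |eta_k - b|^2, which
    decays exponentially on a connected graph; hence V + kappa E is nonincreasing,
    and Barbalat's lemma gives Q -> 0. The zeros of Q are critical points of V, and
    on them xi_k = b.

    Local asymptotic stability needs total coordination to be isolated among the
    zeros of Q. If Q = 0 and all a_k are close to each other, write
    Ad_{g_k^-1 g_{k0}} b - b = [z, b] + r with |r| quadratically small: the part
    [z, b] does not contribute to V = sum_k (sum_j (a_k - a_j)).(a_k - a_{k0}), so
    V^2 <= C V^3 and V = 0. *)
Require Import Defs.
From HB Require Import structures.
From mathcomp Require Import all_boot all_order all_algebra.
From mathcomp Require Import all_classical all_reals all_analysis.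
From mathcomp Require Import ring lra.

Import Order.TTheory GRing.Theory Num.Theory.
Import numFieldNormedType.Exports.

Local Open Scope classical_set_scope.
Local Open Scope ring_scope.

Set Implicit Arguments.
Unset Strict Implicit.
Unset Printing Implicit Defensive.

(** Three obstacles shape the proof. The charts at different points of [G] are unrelated, so [Ad] is
    not visibly smooth in the group variable. Its derivative is extracted from second derivatives of
    the multiplication at the identity, and invariance of the scalar product, equivariance of the
    bracket and the Jacobi identity come from differentiating identities satisfied by [Ad]; no
    exponential map and no orbit manifold is built. Solutions are merely given curves, with no flow.
    Barbalat's lemma fits this, since it needs a Lipschitz bound instead of invariance of limit
    sets, and isometry of [Ad] with boundedness of the eta_k provides one. Brackets do not see the
    centre of the Lie algebra, and a disconnected [G] may move central elements. The quadratic bound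
    on r therefore also needs Ad_h b and b to have the same central part. Compactness gives this
    when Ad_h b is close to b: then h is close to the stabiliser of b. Once [Ad] is differentiated,
    the analysis keeps of [G] only a compact space with a family of isometries that respect the
    bracket. *)

Section DotProduct.
Context {R : realType} {n : nat}.
Implicit Types u v w : 'rV[R]_n.

Definition sqn u : R := dotv u u.

Lemma dotv_mulmx u v : dotv u v = (u *m v^T) 0 0.
Proof. by rewrite mxE; apply: eq_bigr => i _; rewrite mxE. Qed.

Lemma dotvC u v : dotv u v = dotv v u.
Proof. by apply: eq_bigr => i _; rewrite mulrC. Qed.

Lemma dotvDl u v w : dotv (u + v) w = dotv u w + dotv v w.
Proof. by rewrite !dotv_mulmx mulmxDl mxE. Qed.

Lemma dotvDr u v w : dotv u (v + w) = dotv u v + dotv u w.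
Proof. by rewrite dotvC dotvDl !(dotvC u). Qed.

Lemma dotvZl a u v : dotv (a *: u) v = a * dotv u v.
Proof. by rewrite !dotv_mulmx -scalemxAl mxE. Qed.

Lemma dotvZr a u v : dotv u (a *: v) = a * dotv u v.
Proof. by rewrite dotvC dotvZl dotvC. Qed.

Lemma dotvNl u v : dotv (- u) v = - dotv u v.
Proof. by rewrite -scaleN1r dotvZl mulN1r. Qed.

Lemma dotvNr u v : dotv u (- v) = - dotv u v.
Proof. by rewrite dotvC dotvNl dotvC. Qed.

Lemma dotvBl u v w : dotv (u - v) w = dotv u w - dotv v w.
Proof. by rewrite dotvDl dotvNl. Qed.

Lemma dotvBr u v w : dotv u (v - w) = dotv u v - dotv u w.
Proof. by rewrite dotvDr dotvNr. Qed.

Lemma dotv0l u : dotv 0 u = 0.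
Proof. by rewrite -(scale0r 0) dotvZl mul0r. Qed.

Lemma dotv0r u : dotv u 0 = 0.
Proof. by rewrite dotvC dotv0l. Qed.

Lemma dotv_suml (I : finType) (P : pred I) (F : I -> 'rV[R]_n) v :
  dotv (\sum_(i | P i) F i) v = \sum_(i | P i) dotv (F i) v.
Proof.
by apply: (big_morph (dotv^~ v)) => [x y|]; rewrite ?dotvDl ?dotv0l.
Qed.

Lemma dotv_sumr (I : finType) (P : pred I) (F : I -> 'rV[R]_n) v :
  dotv v (\sum_(i | P i) F i) = \sum_(i | P i) dotv v (F i).
Proof. by rewrite dotvC dotv_suml; apply: eq_bigr => i _; rewrite dotvC. Qed.

Lemma sqn_ge0 u : 0 <= sqn u.
Proof. by apply: sumr_ge0 => i _; rewrite -expr2 sqr_ge0. Qed.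

Lemma sqn0 : sqn 0 = 0.
Proof. exact: dotv0l. Qed.

Lemma sqr_coord_le u i : u 0 i ^+ 2 <= sqn u.
Proof.
rewrite /sqn /dotv (bigD1 i) //= -expr2 lerDl.
by apply: sumr_ge0 => j _; rewrite -expr2 sqr_ge0.
Qed.

Lemma sqn_eq0 u : (sqn u == 0) = (u == 0).
Proof.
apply/eqP/eqP => [u0|->]; last exact: sqn0.
apply/rowP => i; rewrite mxE; apply/eqP; rewrite -sqrf_eq0 eq_le sqr_ge0 andbT.
by rewrite -u0 sqr_coord_le.
Qed.

Lemma dotv_eq0 u : (forall v, dotv v u = 0) -> u = 0.
Proof. by move=> /(_ u) u0; apply/eqP; rewrite -sqn_eq0; apply/eqP. Qed.

Lemma enorm_sqr u : enorm u ^+ 2 = sqn u.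
Proof. by rewrite sqr_sqrtr // sqn_ge0. Qed.

Lemma sqnZ a u : sqn (a *: u) = a ^+ 2 * sqn u.
Proof. by rewrite /sqn dotvZl dotvZr mulrA -expr2. Qed.

Lemma sqnN u : sqn (- u) = sqn u.
Proof. by rewrite /sqn dotvNl dotvNr opprK. Qed.

Lemma sqnBC u v : sqn (u - v) = sqn (v - u).
Proof. by rewrite -sqnN opprB. Qed.

Lemma sqnD u v : sqn (u + v) = sqn u + 2 * dotv u v + sqn v.
Proof. rewrite /sqn dotvDl !dotvDr (dotvC v u); ring. Qed.

Lemma sqnB u v : sqn (u - v) = sqn u - 2 * dotv u v + sqn v.
Proof. by rewrite sqnD sqnN dotvNr mulrN. Qed.

Lemma dotv_le u v : 2 * dotv u v <= sqn u + sqn v.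
Proof. have := sqn_ge0 (u - v); rewrite sqnB; lra. Qed.

Lemma sqnD_le u v : sqn (u + v) <= 2 * sqn u + 2 * sqn v.
Proof. rewrite sqnD; have := dotv_le u v; lra. Qed.

Lemma sqnB_le u v : sqn (u - v) <= 2 * sqn u + 2 * sqn v.
Proof. by rewrite -(sqnN v) sqnD_le. Qed.

Lemma dotv_CS u v : dotv u v ^+ 2 <= sqn u * sqn v.
Proof.
have [/eqP|v0] := eqVneq (sqn v) 0.
  by rewrite sqn_eq0 => /eqP ->; rewrite dotv0r sqn0 expr0n mulr0.
have vp : 0 < sqn v by rewrite lt_def v0 sqn_ge0.
have := sqn_ge0 (sqn v *: u - dotv u v *: v).
rewrite sqnB !sqnZ dotvZl dotvZr => h.
rewrite -subr_ge0 -(pmulr_rge0 _ vp).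
by apply: le_trans h _; rewrite le_eqVlt; apply/orP; left; apply/eqP; ring.
Qed.

Lemma dotv_le_weighted c u v : 0 < c -> 2 * dotv u v <= c * sqn u + c^-1 * sqn v.
Proof.
move=> c0; have := dotv_le (c *: u) v.
rewrite dotvZl sqnZ => h.
rewrite -(ler_pM2l c0) mulrDr !mulrA divff ?gt_eqF // mul1r -expr2; nra.
Qed.

(** Young's inequality with weight [#|I|] pairs each term with the full sum S. The remainders add up
    to at most |S|^2, which is half of the left-hand side 2 |S|^2 and is absorbed there. *)
Lemma sqn_sum_le (I : finType) (P : pred I) (F : I -> 'rV[R]_n) :
  sqn (\sum_(i | P i) F i) <= #|I|%:R * \sum_(i | P i) sqn (F i).
Proof.
pose S := \sum_(i | P i) F i.
rewrite -/S /sqn -{1}/S {1}/S dotv_suml.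
have -> : #|I|%:R * \sum_(i | P i) dotv (F i) (F i) =
          \sum_(i | P i) #|I|%:R * sqn (F i) by rewrite mulr_sumr.
have [I0|Ip] := posnP #|I|.
  by rewrite !big1 // => i _; have := card0_eq I0 i; rewrite inE.
have c0 : 0 < (#|I|%:R : R) by rewrite ltr0n.
have h : \sum_(i | P i) 2 * dotv (F i) S <=
         \sum_(i | P i) (#|I|%:R * sqn (F i) + #|I|%:R^-1 * sqn S).
  by apply: ler_sum => i _; exact: dotv_le_weighted.
move: h; rewrite big_split /= -mulr_sumr -dotv_suml -/S -/(sqn S) => h.
have h2 : \sum_(i | P i) #|I|%:R^-1 * sqn S <= sqn S.
  rewrite sumr_const -[leLHS]mulr_natl mulrA -[leRHS]mul1r ler_wpM2r ?sqn_ge0 //.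
  by rewrite ler_pdivrMr // mul1r ler_nat max_card.
by move: h h2; rewrite -/(sqn S); lra.
Qed.

End DotProduct.

(** * Frobenius inner product and quantitative linear algebra *)

Section Frobenius.
Context {R : realType}.

(** Flattening to vectors makes Cauchy-Schwarz and [split_kermx] available for matrices without a
    second proof. *)
Definition fip m n (A B : 'M[R]_(m, n)) : R := dotv (mxvec A) (mxvec B).
Definition fsq m n (A : 'M[R]_(m, n)) : R := fip A A.

Lemma fip_sum m n (A B : 'M[R]_(m, n)) :
  fip A B = \sum_i \sum_j A i j * B i j.
Proof.
rewrite /fip /dotv (reindex _ (curry_mxvec_bij _ _)) /= pair_bigA /=.
by apply: eq_bigr => -[i j] _ /=; rewrite !mxvecE.
Qed.

Lemma fip_trace m n (A B : 'M[R]_(m, n)) : fip A B = \tr (A *m B^T).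
Proof.
rewrite fip_sum; apply: eq_bigr => i _; rewrite mxE.
by apply: eq_bigr => j _; rewrite mxE.
Qed.

Lemma fsq_ge0 m n (A : 'M[R]_(m, n)) : 0 <= fsq A.
Proof. exact: sqn_ge0. Qed.

Lemma fsq_trmx m n (A : 'M[R]_(m, n)) : fsq A^T = fsq A.
Proof. by rewrite /fsq !fip_trace mxtrace_mulC trmxK. Qed.

Lemma fip_CS m n (A B : 'M[R]_(m, n)) : fip A B ^+ 2 <= fsq A * fsq B.
Proof. exact: dotv_CS. Qed.

Lemma fsq_rows m n (A : 'M[R]_(m, n)) : fsq A = \sum_i sqn (row i A).
Proof.
rewrite /fsq fip_sum; apply: eq_bigr => i _.
by apply: eq_bigr => j _; rewrite !mxE.
Qed.

Lemma sqn_mulmx m n (u : 'rV[R]_m) (A : 'M[R]_(m, n)) :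
  sqn (u *m A) <= sqn u * fsq A.
Proof.
rewrite -fsq_trmx fsq_rows mulr_sumr; apply: ler_sum => j _.
rewrite -expr2; apply: le_trans (dotv_CS _ _).
rewrite le_eqVlt; apply/orP; left; apply/eqP; congr (_ ^+ 2).
by rewrite mxE; apply: eq_bigr => i _; rewrite !mxE.
Qed.

Lemma fsqM m n p (A : 'M[R]_(m, n)) (B : 'M[R]_(n, p)) :
  fsq (A *m B) <= fsq A * fsq B.
Proof.
rewrite fsq_rows (fsq_rows A) mulr_suml; apply: ler_sum => i _.
by rewrite row_mul sqn_mulmx.
Qed.

Lemma fsq_orthogonal m n (U : 'M[R]_m) (A : 'M[R]_(m, n)) :
  U^T *m U = 1%:M -> fsq (U *m A) = fsq A.
Proof.
move=> UU; rewrite /fsq !fip_trace trmx_mul mxtrace_mulC mulmxA.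
by rewrite -(mulmxA A^T) UU mulmx1 mxtrace_mulC.
Qed.

Lemma linear_sqn_bounded m n (f : {linear 'rV[R]_m -> 'rV[R]_n}) :
  exists2 K : R, 0 <= K & forall u, sqn (f u) <= K * sqn u.
Proof.
exists (fsq (lin1_mx f)); first exact: fsq_ge0.
by move=> u; rewrite mulrC -mul_rV_lin1 sqn_mulmx.
Qed.

(** Modulo the kernel of [M] a vector is controlled by its image. The generalised inverse provides
    both the controlled part, the image mapped back, and the constant. *)
Lemma split_kermx m n (M : 'M[R]_(m, n)) :
  exists2 K : R, 0 <= K & forall u, exists u0 u1 : 'rV_m,
    [/\ u = u0 + u1, u0 *m M = 0 & sqn u1 <= K * sqn (u *m M)].
Proof.
exists (fsq (pinvmx M)); first exact: fsq_ge0.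
move=> u; exists (u - u *m M *m pinvmx M), (u *m M *m pinvmx M); split.
- by rewrite subrK.
- by rewrite mulmxBl mulmxKpV ?subrr // submxMl.
- by rewrite mulrC sqn_mulmx.
Qed.

(** For skew [A] one has |uA|^2 = - u . uA^2, so A and A^2 have the same kernel, hence the same rank
    and row space. Thus wA = DA^2 for some D, and w - DA lies in the kernel. *)
Lemma split_skew n (A : 'M[R]_n) (w : 'rV[R]_n) : A^T = - A ->
  exists c v : 'rV_n, w = c + v *m A /\ c *m A = 0.
Proof.
move=> skA.
have skE u v : dotv (u *m A) v = - dotv u (v *m A).
  by rewrite !dotv_mulmx -mulmxA trmx_mul skA mulNmx mulmxN [X in _ = - X]mxE opprK.
have kerS : (kermx (A *m A) <= kermx A)%MS.
  apply/row_subP => i; apply/sub_kermxP.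
  have : row i (kermx (A *m A)) *m (A *m A) = 0.
    by rewrite -row_mul mulmx_ker row0.
  set u := row i _; rewrite mulmxA => h.
  by apply/eqP; rewrite -sqn_eq0 /sqn skE h dotv0r oppr0.
have rk : (A <= A *m A)%MS.
  rewrite -(geq_leqif (mxrank_leqif_sup (submxMl A A))).
  by have := mxrankS kerS; rewrite !mxrank_ker leq_sub2lE ?rank_leq_row.
have /submxP[D hD] : (w *m A <= A *m A)%MS.
  exact: submx_trans (submxMl _ _) rk.
exists (w - D *m A), D; split; first by rewrite subrK.
by rewrite mulmxBl hD mulmxA subrr.
Qed.

(* Writing U = U0 + U1 with U0 commuting with X and U1 controlled by the
   commutator XU - UX = UE, the first-order term tr(C U0^T (X U1 - U1 X))
   vanishes. *)
Lemma commuting_conjugation_bound n (X : 'M[R]_n) : X^T = - X ->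
  exists2 K : R, 0 <= K & forall U C E : 'M[R]_n,
    U^T *m U = 1%:M -> C *m X = X *m C -> E = U^T *m X *m U - X ->
    \tr (C *m E) ^+ 2 <= K * fsq C * fsq E ^+ 2.
Proof.
move=> skX.
pose f (U : 'M[R]_n) := X *m U - U *m X.
have f_lin : linear f.
  by move=> a U W; rewrite /f mulmxDr mulmxDl -scalemxAr -scalemxAl scalerBr opprD addrACA.
pose fL := GRing.isLinear.Build R 'M[R]_n 'M[R]_n _ f f_lin.
pose F : {linear 'M[R]_n -> 'M[R]_n} := HB.pack f fL.
have [K K0 hK] := split_kermx (lin_mx F).
exists K => // U C E UU CX hE.
have fU : U *m E = f U.
  by rewrite hE mulmxBr !mulmxA (mulmx1C UU) mul1mx.
have [u0 [u1 [hu hu0 hu1]]] := hK (mxvec U).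
pose U0 := vec_mx u0 : 'M[R]_n; pose U1 := vec_mx u1 : 'M[R]_n.
have UE : U = U0 + U1 by rewrite -[U]mxvecK hu linearD.
have fU0 : f U0 = 0.
  by apply: (can_inj mxvecK); have := mul_vec_lin F U0; rewrite vec_mxK hu0 linear0.
have fU1 : f U1 = U *m E.
  by rewrite fU UE /f mulmxDl mulmxDr -[LHS]add0r -fU0 /f opprD addrACA.
have bU1 : fsq U1 <= K * fsq E.
  rewrite -(fsq_orthogonal E UU) fU.
  by move: hu1; rewrite mul_vec_lin /fsq /fip vec_mxK.
have t0 : \tr (C *m U0^T *m f U1) = 0.
  have hT : U0^T *m X = X *m U0^T.
    have := congr1 trmx fU0; rewrite /f linearB /= !trmx_mul skX linear0.
    by rewrite mulmxN mulNmx opprK addrC => /subr0_eq ->.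
  rewrite /f mulmxBr linearB /= mulmxA -(mulmxA C) hT !mulmxA CX.
  by rewrite [X in _ - X]mxtrace_mulC !mulmxA subrr.
(* With the [U0] term gone, the trace pairs [U1] with [U *m E]; both have size |E|, which is where
   the quadratic bound comes from. *)
have -> : \tr (C *m E) = fip (C *m U1^T) (U *m E)^T.
  rewrite fip_trace trmxK -[RHS]add0r -t0 fU1 -mxtraceD -mulmxDl -mulmxDr.
  by rewrite -linearD -UE mulmxA -(mulmxA C) UU mulmx1.
apply: le_trans (fip_CS _ _) _.
rewrite fsq_trmx (fsq_orthogonal _ UU) expr2 mulrA.
apply: ler_wpM2r; first exact: fsq_ge0.
apply: le_trans (fsqM _ _) _; rewrite fsq_trmx -mulrA mulrCA.
by apply: ler_wpM2l => //; exact: fsq_ge0.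
Qed.

End Frobenius.

(** * Curves in a real variable: derivatives, Barbalat's lemma, exponential decay *)

Section Curves.
Context {R : realType}.

Lemma is_derive_comp_diff (V W : normedModType R) (f : V -> W) (c : R -> V)
    (t : R) (v : V) :
  differentiable f (c t) -> is_derive t 1 c v ->
  is_derive t 1 (f \o c) ('d f (c t) v).
Proof.
move=> df [dc <-].
have dc' : differentiable c t by apply/derivable1_diffP.
apply: DeriveDef; first by apply/derivable1_diffP/differentiable_comp.
rewrite deriveE; last exact: differentiable_comp.
by rewrite diff_comp //= deriveE.
Qed.

Lemma is_derive_addf (V W : normedModType R) (f g : V -> W) (x v : V) (df dg : W) :
  is_derive x v f df -> is_derive x v g dg ->
  is_derive x v (fun y => f y + g y) (df + dg).
Proof. by move=> hf hg; exact: (is_deriveD (f := f) (g := g)). Qed.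

Lemma is_derive_subf (V W : normedModType R) (f g : V -> W) (x v : V) (df dg : W) :
  is_derive x v f df -> is_derive x v g dg ->
  is_derive x v (fun y => f y - g y) (df - dg).
Proof. by move=> hf hg; exact: (is_deriveB (f := f) (g := g)). Qed.

Lemma is_derive_scalef (V W : normedModType R) (f : V -> W) (x v : V) (df : W) k :
  is_derive x v f df -> is_derive x v (fun y => k *: f y) (k *: df).
Proof. by move=> hf; exact: (is_deriveZ (f := f)). Qed.

Lemma is_derive_mulf (V : normedModType R) (f g : V -> R) (x v : V) (df dg : R) :
  is_derive x v f df -> is_derive x v g dg ->
  is_derive x v (fun y => f y * g y) (df * g x + f x * dg).
Proof.
move=> hf hg; have h := is_deriveM (f := f) (g := g) (df := df) (dg := dg) hf hg.
by apply: is_derive_eq; rewrite addrC /GRing.scale /= (mulrC (g x)).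
Qed.

Lemma is_derive_scalel (V : normedModType R) (u : V) (t : R) :
  is_derive t (1 : R) (fun s : R => s *: u) u.
Proof.
have [df dE] := is_diff_scalel t u.
apply: DeriveDef; first exact: diff_derivable.
by rewrite deriveE // dE scale1r.
Qed.

Lemma is_derive_line (V W : normedModType R) (f : V -> W) (z u : V) (t : R) :
  differentiable f (z + t *: u) ->
  is_derive t 1 (fun s : R => f (z + s *: u)) ('D_u f (z + t *: u)).
Proof.
move=> df; have hc : is_derive t (1 : R) (fun s : R => z + s *: u) u.
  have h := is_derive_addf (is_derive_cst z t (1 : R)) (is_derive_scalel u t).
  by rewrite add0r in h.
by rewrite deriveE //; have := is_derive_comp_diff (c := fun s => z + s *: u) df hc.
Qed.

Lemma is_derive_coord (V : normedModType R) n (c : V -> 'rV[R]_n) (t v : V)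
    (w : 'rV[R]_n) i :
  is_derive t v c w -> is_derive t v (fun s => c s 0 i) (w 0 i).
Proof.
move=> [dc <-]; apply: DeriveDef; first exact: (derivable_mxP _ _ _).1.
by rewrite derive_mx // mxE.
Qed.

Lemma is_derive_row (V : normedModType R) n (c : V -> 'rV[R]_n) (t v : V)
    (w : 'rV[R]_n) :
  (forall i, is_derive t v (fun s => c s 0 i) (w 0 i)) -> is_derive t v c w.
Proof.
move=> h; have dc : derivable c t v by apply/derivable_mxP => i j; rewrite ord1.
apply: DeriveDef => //; rewrite derive_mx //; apply/rowP => i; rewrite mxE.
exact: derive_val.
Qed.

Lemma is_derive_dotv n (a b : R -> 'rV[R]_n) (t : R) (a' b' : 'rV[R]_n) :
  is_derive t 1 a a' -> is_derive t 1 b b' ->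
  is_derive t 1 (fun s => dotv (a s) (b s)) (dotv a' (b t) + dotv (a t) b').
Proof.
move=> da db; rewrite /dotv.
have h (i : 'I_n) : is_derive t (1 : R) (fun s : R => a s 0 i * b s 0 i)
    (a' 0 i * b t 0 i + a t 0 i * b' 0 i).
  exact: is_derive_mulf (is_derive_coord i da) (is_derive_coord i db).
rewrite -big_split /=.
have := is_derive_sum (h := fun i s => a s 0 i * b s 0 i) h.
by congr is_derive; apply/funext => s; rewrite fct_sumE.
Qed.

Lemma is_derive_sumP (I : finType) (P : pred I) (V W : normedModType R)
    (h : I -> V -> W) (dh : I -> W) (t v : V) :
  (forall i, P i -> is_derive t v (h i) (dh i)) ->
  is_derive t v (fun s => \sum_(i | P i) h i s) (\sum_(i | P i) dh i).
Proof.
move=> H; suff : is_derive t v (\sum_(i | P i) h i) (\sum_(i | P i) dh i).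
  by congr is_derive; apply/funext => s; rewrite fct_sumE.
apply: (big_ind2 (fun f df => is_derive t v f df)) => //.
- exact: is_derive_cst.
- by move=> f1 f2 d1 d2 h1 h2; exact: is_deriveD.
Qed.

Lemma le_of_derive_le0 (f df : R -> R) (a s t : R) :
  {within `[a, +oo[, continuous f} ->
  (forall x : R, a < x -> is_derive x 1 f (df x)) ->
  (forall x, a < x -> df x <= 0) ->
  a <= s -> s <= t -> f t <= f s.
Proof.
move=> cf hd hle; apply: (ler0_derive1_nincry _ _ cf) => x; rewrite in_itv/= andbT => ax.
  by have [] := hd _ ax.
by rewrite derive1E; have [_ ->] := hd _ ax; exact: hle.
Qed.

Lemma lipschitz_of_derive (f df : R -> R) (L s t : R) :
  (forall x : R, 0 < x -> is_derive x 1 f (df x)) ->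
  (forall x, 0 < x -> `|df x| <= L) ->
  0 < s -> s <= t -> `|f t - f s| <= L * (t - s).
Proof.
move=> hd hL s0 st.
have hc : {within `[s, t], continuous f}.
  apply: derivable_within_continuous => x; rewrite in_itv /= => /andP[sx _].
  by have [] := hd x (lt_le_trans s0 sx).
have [|c cst ->] := @MVT_segment R f df s t st _ hc.
  by move=> x xst; apply: hd; apply: lt_trans s0 _; rewrite (itvP xst).
rewrite normrM (ger0_norm (_ : 0 <= t - s)) ?subr_ge0 // ler_wpM2r ?subr_ge0 //.
by apply: hL; apply: lt_le_trans s0 _; rewrite (itvP cst).
Qed.

(** [W] decreases and is bounded below, so late enough it is within any margin of its infimum. If
    [Q t] exceeded eps at a late time, the Lipschitz bound would keep [Q] above eps/2 for a time h,
    and [W] would drop below the infimum. The mean value theorem on [t, t + h] replaces integration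
    of [Q]. *)
Lemma barbalat (W dW Q : R -> R) (L : R) :
  {within `[(0 : R), +oo[, continuous W} ->
  (forall t : R, 0 < t -> is_derive t 1 W (dW t)) ->
  (forall t, 0 < t -> dW t <= - Q t) ->
  (forall t, 0 <= t -> 0 <= W t) -> (forall t, 0 < t -> 0 <= Q t) ->
  (forall s t, 0 < s -> s <= t -> `|Q t - Q s| <= L * (t - s)) ->
  Q t @[t --> +oo] --> (0 : R).
Proof.
move=> cW hW hQ W0 Q0 hL.
have Wmono s t : 0 <= s -> s <= t -> W t <= W s.
  apply: le_of_derive_le0 cW hW _ => x x0.
  by apply: le_trans (hQ x x0) _; rewrite oppr_le0 Q0.
apply/cvgrPdist_le => eps eps0.
pose L1 := `|L| + 1; have L10 : 0 < L1 by rewrite /L1 ltr_wpDl.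
pose h := eps / (2 * L1); have h0 : 0 < h by rewrite divr_gt0 // mulr_gt0.
(* Starting at time 1 makes [T] and all later times positive, where the hypotheses on [dW] and [Q]
   apply. *)
pose S := W @` [set t | 1 <= t].
have hS : has_inf S.
  split; first by exists (W 1); exists 1 => /=.
  by exists 0 => _ [t /= t1 <-]; apply: W0; lra.
have d0 : 0 < eps / 2 * h by rewrite mulr_gt0 // divr_gt0.
have [_ [T /= T1 <-] hT] := inf_adherent d0 hS.
near=> t.
have tT : T <= t by near: t; apply: nbhs_pinfty_ge; rewrite num_real.
have t0 : 0 < t by lra.
rewrite sub0r normrN ger0_norm ?Q0 // leNgt; apply/negP => hlt.
have cW' : {within `[t, t + h], continuous W}.
  apply: derivable_within_continuous => x; rewrite in_itv /= => /andP[sx _].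
  by have [] := hW x (lt_le_trans t0 sx).
have [||c cin hc] := @MVT R W dW t (t + h) _ _ cW'.
- by rewrite ltrDl.
- by move=> x /itvP xin; apply: hW; apply: lt_trans t0 _; rewrite xin.
have tc : t < c by rewrite (itvP cin).
have ct : c < t + h by rewrite (itvP cin).
have c0 : 0 < c by lra.
have := hL t c t0 (ltW tc); rewrite ler_norml => /andP[h1 _].
have h2 : L * (c - t) <= L1 * h.
  apply: (@le_trans _ _ (L1 * (c - t))).
    by apply: ler_wpM2r; [lra | rewrite /L1; have := ler_norm L; lra].
  by apply: ler_wpM2l; lra.
have h3 : L1 * h = eps / 2 by rewrite /h; field; rewrite gt_eqF.
have h4 : eps / 2 < Q c by lra.
have h5 : W (t + h) - W t <= - (eps / 2) * h.
  rewrite hc addrAC subrr add0r; apply: ler_wpM2r; first exact: ltW.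
  by have := hQ c c0; lra.
have h6 : inf S <= W (t + h).
  by apply: ge_inf; [case: hS | exists (t + h) => //=; lra].
have h7 : W t <= W T by apply: Wmono; lra.
lra.
Unshelve. all: by end_near. Qed.

Lemma gronwall_decay (E dE : R -> R) (c : R) :
  {within `[(0 : R), +oo[, continuous E} ->
  (forall t : R, 0 < t -> is_derive t 1 E (dE t)) ->
  (forall t, 0 < t -> dE t <= - c * E t) ->
  forall t, 0 <= t -> E t <= E 0 * expR (- c * t).
Proof.
move=> cE hE hle t t0.
pose F s := E s * expR (c * s).
have hx (x : R) : is_derive x (1 : R) (fun s : R => expR (c * s)) (c * expR (c * x)).
  have h1 := is_derive_mulf (is_derive_cst c x (1 : R)) (is_derive_id x (1 : R)).
  have h := is_derive1_comp (f := expR) (g := fun s => c * s) (is_derive_expR _) h1.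
  by move: h; rewrite mul0r add0r /cst mulr1 /GRing.scale /= mulrC.
suff : F t <= F 0.
  rewrite /F mulr0 expR0 mulr1 => h.
  rewrite -(ler_pM2r (expR_gt0 (c * t))) -mulrA -expRD mulNr addNr expR0 mulr1.
  exact: h.
apply: (@le_of_derive_le0 F (fun x => dE x * expR (c * x) + E x * (c * expR (c * x))) 0) => //.
- move=> x; apply: cvgM; first exact: cE.
  suff : {within `[(0 : R), +oo[, continuous (fun s : R => expR (c * s))} by apply.
  apply: continuous_subspaceT => y.
  by apply/differentiable_continuous/derivable1_diffP; have [] := hx y.
- by move=> x x0; exact: is_derive_mulf (hE x x0) (hx x).
- move=> x x0; have := hle x x0; rewrite -(ler_pM2l (expR_gt0 (c * x))); nra.
Qed.

End Curves.

(** * Symmetry of second directional derivatives *)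

Section SchwarzTheorem.
Context {R : realType} {V : normedModType R}.

Let is_derive_along (f : V -> R) u x a := differentiable f x /\ 'D_u f x = a.

Let is_derive_along_line f u z (t a : R) : is_derive_along f u (z + t *: u) a ->
  is_derive t 1 (fun s : R => f (z + s *: u)) a.
Proof. by move=> [df <-]; exact: is_derive_line. Qed.

(** The mean value theorem is applied along [u] to s |-> f(z + hv + su) - f(z + su), then along [v]
    to [fu]. The arbitrary neighbourhood [P] locates the intermediate point, so that continuity of
    [fuv] can be used later. *)
Lemma second_difference (f fu fuv : V -> R) (U : set V) (z u v : V) :
  open U -> U z ->
  (forall x, U x -> is_derive_along f u x (fu x)) ->
  (forall x, U x -> is_derive_along fu v x (fuv x)) ->
  forall P : set V, nbhs z P ->
  \forall h \near (0 : R)^'+, exists2 p, P p &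
    f (z + h *: u + h *: v) - f (z + h *: u) - f (z + h *: v) + f z =
    h ^+ 2 * fuv p.
Proof.
move=> oU Uz df ddf P Pz.
have : nbhs z (U `&` P) by apply: filterI => //; exact: open_nbhs_nbhs.
move=> /nbhs_ballP[r /= r0 hr].
(* [h * M] bounds all displacements s u + t v with s, t in [0, h]; the summand 1 keeps [M] positive
   when both directions vanish. *)
pose M := `|u| + `|v| + 1; have M0 : 0 < M by rewrite /M ltr_wpDl.
near=> h.
have h0 : 0 < h by near: h; exact: nbhs_right_gt.
have hM : h * M < r.
  rewrite -ltr_pdivlMr //; near: h; apply: nbhs_right_lt; exact: divr_gt0.
have inb s t : 0 <= s -> s <= h -> 0 <= t -> t <= h -> (U `&` P) (z + s *: u + t *: v).
  move=> s0 sh t0 th; apply: hr; rewrite -ball_normE /ball_ /=.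
  rewrite -addrA opprD addrA subrr sub0r normrN.
  apply: le_lt_trans (ler_normD _ _) _; rewrite !normrZ !ger0_norm //.
  apply: le_lt_trans hM; rewrite /M !mulrDr mulr1.
  have := ler_wpM2r (normr_ge0 u) sh; have := ler_wpM2r (normr_ge0 v) th; lra.
pose g (s : R) := f (z + h *: v + s *: u) - f (z + s *: u).
have hg (s : R) : 0 <= s -> s <= h -> is_derive s 1 g
    (fu (z + h *: v + s *: u) - fu (z + s *: u)).
  move=> s0 sh; apply: is_derive_subf; apply: is_derive_along_line; apply: df.
    by rewrite addrAC; apply: (inb s h _ _ _ _).1 => //; exact: ltW.
  by have := (inb s 0 s0 sh _ _).1; rewrite scale0r addr0; apply => //; exact: ltW.
have cg : {within `[0, h], continuous g}.
  apply: derivable_within_continuous => x; rewrite in_itv /= => /andP[x0 xh].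
  by have [] := hg x x0 xh.
have [s sin hs] := @MVT R g _ 0 h h0
  (fun x xin => hg x (ltW (proj1 (andP xin))) (ltW (proj2 (andP xin)))) cg.
move: sin; rewrite in_itv /= => /andP[/ltW s0 /ltW sh].
pose k (t : R) := fu (z + s *: u + t *: v).
have hk (t : R) : 0 <= t -> t <= h ->
    is_derive t 1 k (fuv (z + s *: u + t *: v)).
  by move=> t0 th; apply: is_derive_along_line; apply: ddf; exact: (inb s t _ _ _ _).1.
have ck : {within `[0, h], continuous k}.
  apply: derivable_within_continuous => x; rewrite in_itv /= => /andP[x0 xh].
  by have [] := hk x x0 xh.
have [t tin ht] := @MVT R k _ 0 h h0
  (fun x xin => hk x (ltW (proj1 (andP xin))) (ltW (proj2 (andP xin)))) ck.
move: tin; rewrite in_itv /= => /andP[/ltW t0 /ltW th].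
exists (z + s *: u + t *: v); first exact: (inb s t _ _ _ _).2.
move: hs ht; rewrite /g /k !scale0r !addr0 subr0 (addrAC z (h *: v)) => hs ht.
rewrite (addrAC z (h *: v)) in hs.
rewrite ht in hs; rewrite expr2 -mulrA mulrC [h * _]mulrC -hs; ring.
Unshelve. all: by end_near. Qed.

(** The second difference is symmetric in [u] and [v], so [F2 u v] and [F2 v u] take a common value
    at two points arbitrarily close to [z]; continuity finishes. *)
Lemma mixed_derivatives_eq (f : V -> R) (F1 : V -> V -> R) (F2 : V -> V -> V -> R)
    (U : set V) (z u v : V) :
  open U -> U z ->
  (forall w x, U x -> differentiable f x /\ 'D_w f x = F1 w x) ->
  (forall w w' x, U x -> differentiable (F1 w) x /\ 'D_w' (F1 w) x = F2 w w' x) ->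
  (forall w w', {for z, continuous (F2 w w')}) ->
  F2 u v z = F2 v u z.
Proof.
move=> oU Uz df ddf cf; apply/eqP; rewrite -subr_eq0 -normr_le0.
apply/ler_addgt0Pr => eps eps0; rewrite add0r.
have e2 : 0 < eps / 2 by rewrite divr_gt0.
have near_le w w' : nbhs z (fun p => `|F2 w w' z - F2 w w' p| <= eps / 2).
  by have /cvgrPdist_le := cf w w'; apply.
have h1 := second_difference oU Uz (df u) (ddf u v) (near_le u v).
have h2 := second_difference oU Uz (df v) (ddf v u) (near_le v u).
have [h [h0 [p hp ep] [q hq eq]]] : exists h : R, [/\ 0 < h,
    exists2 p, `|F2 u v z - F2 u v p| <= eps / 2 &
    f (z + h *: u + h *: v) - f (z + h *: u) - f (z + h *: v) + f z =
    h ^+ 2 * F2 u v p &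
    exists2 p, `|F2 v u z - F2 v u p| <= eps / 2 &
    f (z + h *: v + h *: u) - f (z + h *: v) - f (z + h *: u) + f z =
    h ^+ 2 * F2 v u p].
  apply: (@filter_ex _ (0 : R)^'+); near=> h; split.
  - by near: h; exact: nbhs_right_gt.
  - by near: h.
  - by near: h.
have pq : F2 u v p = F2 v u q.
  have hh : h ^+ 2 != 0 by rewrite expf_neq0 // gt_eqF.
  apply: (mulfI hh); rewrite -ep -eq (addrAC z (h *: u)); ring.
have -> : F2 u v z - F2 v u z = (F2 u v z - F2 u v p) - (F2 v u z - F2 v u q).
  by rewrite pq; ring.
by apply: le_trans (ler_normB _ _) _; rewrite (splitr eps) lerD.
Unshelve. all: by end_near. Qed.

Lemma derive_coord m (f : V -> 'rV[R]_m) (x v : V) i :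
  differentiable f x ->
  differentiable (fun y => f y 0 i) x /\ 'D_v (fun y => f y 0 i) x = 'D_v f x 0 i.
Proof.
move=> df; split.
  apply: (differentiable_comp (f := f) (g := fun M : 'rV_m => M 0 i)) => //.
  exact: differentiable_coord.
have h := is_derive_coord i (derivableP (@diff_derivable _ _ _ _ _ v df)).
by rewrite derive_val.
Qed.

Lemma smooth_derive_swap m (f : V -> 'rV[R]_m) (U : set V) (z u v : V) :
  open U -> U z -> smooth_on U f -> 'D_v ('D_u f) z = 'D_u ('D_v f) z.
Proof.
move=> oU Uz sf; have [d1 h1] := sf 2%N.
apply/rowP => i; apply: (@mixed_derivatives_eq (fun y => f y 0 i)
  (fun w y => 'D_w f y 0 i) (fun w w' y => 'D_w' ('D_w f) y 0 i) U z u v) => //.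
- by move=> w x Ux; exact: derive_coord (d1 x Ux).
- by move=> w w' x Ux; apply: derive_coord; have [/(_ x Ux)] := h1 w.
- move=> w w'; have [_ /(_ w' z Uz) cz] := h1 w.
  exact: (continuous_comp cz (@coord_continuous _ _ _ 0 i _)).
Qed.

End SchwarzTheorem.

(** * Uniformity from compactness, and a Poincare inequality on graphs *)

Section Compactness.
Context {R : realType} {T : topologicalType}.

(** [d] is the minimum of [f] on [K] minus [U], positive because the zeros lie in [U]. It turns
    smallness of a function into membership in a neighbourhood of its zeros, with no metric on
    [T]. *)
Lemma compact_sublevel (K U : set T) (f : T -> R) :
  compact K -> continuous f -> (forall x, K x -> 0 <= f x) -> open U ->
  (forall x, K x -> f x = 0 -> U x) ->
  exists2 d, 0 < d & forall x, K x -> f x < d -> U x.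
Proof.
move=> cK cf f0 oU hU.
have cKU : compact (K `&` ~` U) by apply: compact_closedI => //; exact: open_closedC.
have [KU0|KUn] := pselect ((K `&` ~` U) !=set0); last first.
  exists 1 => // x Kx _; apply: contrapT => nU; apply: KUn; by exists x.
have [c cin cmin] := compact_EVT_min KU0 cKU (continuous_subspaceT cf).
move: cin; rewrite inE => -[Kc nUc].
exists (f c).
  by rewrite lt_def f0 // andbT; apply/eqP => /(hU _ Kc).
move=> x Kx fx; apply: contrapT => nU.
by have := cmin x; rewrite inE leNgt fx => /(_ (conj Kx nU)).
Qed.

End Compactness.

Section Poincare.
Context {R : realType} {n N : nat} (e : rel 'I_N).

(** Each edge costs a factor 4: |u + v|^2 <= 2 |u|^2 + 2 |v|^2, where the first edge contributes at
    most S and S <= 4^p S. *)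
Lemma path_sqn_le (a : 'I_N -> 'rV[R]_n) p j : path e j p ->
  sqn (a j - a (last j p)) <=
  4 ^+ size p * \sum_k \sum_(i | e i k) sqn (a k - a i).
Proof.
set S := \sum_k _.
have S0 : 0 <= S by apply: sumr_ge0 => k _; apply: sumr_ge0 => i _; exact: sqn_ge0.
elim: p j => [|k p IH] j /=.
  by rewrite subrr sqn0 expr0 mul1r.
move=> /andP[ejk /IH h].
have hS : sqn (a k - a j) <= S.
  rewrite /S (bigD1 k) //= (bigD1 j) //= -addrA lerDl addr_ge0 //.
    by apply: sumr_ge0 => i _; exact: sqn_ge0.
  by apply: sumr_ge0 => i _; apply: sumr_ge0 => l _; exact: sqn_ge0.
have -> : a j - a (last k p) = (a j - a k) + (a k - a (last k p)) by rewrite addrA subrK.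
apply: le_trans (sqnD_le _ _) _; rewrite (sqnBC (a j)) exprS -mulrA.
have h1 : S <= 4 ^+ size p * S by apply: ler_peMl => //; apply: exprn_ege1; lra.
lra.
Qed.

Lemma connected_sqn_le : (forall j k, connect e j k) ->
  forall (a : 'I_N -> 'rV[R]_n) j k,
  sqn (a j - a k) <= 4 ^+ N * \sum_k \sum_(i | e i k) sqn (a k - a i).
Proof.
move=> conn a j k; have /connectP[p ep ->] := conn j k.
(* A path without repetition has fewer than N edges, so the constant depends on N alone. *)
have [p' ep' up' _] := shortenP ep.
apply: le_trans (path_sqn_le a ep') _; apply: ler_wpM2r.
  by apply: sumr_ge0 => i _; apply: sumr_ge0 => l _; exact: sqn_ge0.
apply: ler_weXn2l; first lra.
have := max_card (mem (j :: p')); rewrite (card_uniqP up') card_ord /=.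
exact: ltnW.
Qed.

End Poincare.

(** * Differentials: approximation criterion, components, vanishing products *)

Section Differentials.
Context {R : realType}.
Implicit Types V W : normedModType R.

Lemma diff_of_near V W (f : V -> W) (x : V) (l : {linear V -> W}) :
  continuous l ->
  (forall eps : R, 0 < eps ->
     \forall y \near x, `|f y - f x - l (y - x)| <= eps * `|y - x|) ->
  differentiable f x /\ 'd f x = l :> (V -> W).
Proof.
move=> cl h.
have H : f \o shift x = cst (f x) + l +o_ 0 id.
  apply/eqaddoE/eqaddoP => eps eps0.
  have /nbhs_ballP[r /= r0 hr] := h eps eps0.
  apply/nbhs_ballP; exists r => //= y; rewrite -ball_normE /= sub0r normrN => yr.
  have := hr (y + x); rewrite -ball_normE /= opprD addrCA subrr addr0 normrN.
  by move=> /(_ yr); rewrite addrK opprD addrA.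
have dE := diff_unique cl H.
by split => //; apply/diff_locallyP; rewrite dE.
Qed.

Lemma diff_near V W (f : V -> W) (x : V) : differentiable f x ->
  forall eps : R, 0 < eps ->
    \forall y \near x, `|f y - f x - 'd f x (y - x)| <= eps * `|y - x|.
Proof.
move=> /diff_locally /eqaddoP h eps eps0.
have /nbhs_ballP[r /= r0 hr] := h eps eps0.
apply/nbhs_ballP; exists r => //= y; rewrite -ball_normE /= => yr.
have := hr (y - x); rewrite -ball_normE /= sub0r normrN -normrN opprB => /(_ yr).
by rewrite !fctE /= subrK opprD addrA.
Qed.

Lemma diff_near_eq V W (f g : V -> W) (x : V) : differentiable f x ->
  (\forall y \near x, f y = g y) ->
  differentiable g x /\ 'd g x = 'd f x :> (V -> W).
Proof.
move=> df fg; apply: diff_of_near => [|eps eps0]; first exact: diff_continuous.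
have fgx : f x = g x by exact: (nbhs_singleton fg).
near=> y.
have <- : f y = g y by near: y.
by rewrite -fgx; near: y; exact: diff_near.
Unshelve. all: by end_near. Qed.

(** [w] is only assumed continuous: [b y] is of order |y - x| and [w y] tends to 0, so the product
    is o(|y - x|). This lifts [Ad] from continuity at the identity to differentiability there. *)
Lemma diffM_vanishing V (b w : V -> R) x :
  differentiable b x -> b x = 0 -> {for x, continuous w} -> w x = 0 ->
  differentiable (fun y => b y * w y) x /\
  'd (fun y => b y * w y) x = (fun=> 0) :> (V -> R).
Proof.
move=> db b0 cw w0.
have [] := @diff_of_near V R (fun y => b y * w y) x (\0 : {linear V -> R}).
- exact: cst_continuous.
- move=> eps eps0.
  have [k k0 hk] := linear_lipschitz (diff_continuous db).
  have k1 : 0 < k + 1 by rewrite addr_gt0.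
  near=> y.
  rewrite w0 mulr0 !subr0 normrM.
  (* [k] bounds the differential of [b]; the extra 1 bounds the remainder of the first-order
     expansion. *)
  have hb : `|b y| <= (k + 1) * `|y - x|.
    have h1 : `|b y - b x - 'd b x (y - x)| <= 1 * `|y - x|.
      by near: y; exact: diff_near.
    rewrite b0 subr0 in h1.
    have -> : b y = (b y - 'd b x (y - x)) + 'd b x (y - x) by rewrite subrK.
    apply: le_trans (ler_normD _ _) _.
    by rewrite mulrDl addrC lerD // hk.
  have hw : `|w y| <= eps / (k + 1).
    have : `|w x - w y| <= eps / (k + 1).
      near: y; move/cvgrPdist_le : cw; apply; exact: divr_gt0.
    by rewrite w0 sub0r normrN.
  apply: le_trans (ler_pM _ _ hb hw) _ => //.
  by rewrite le_eqVlt; apply/orP; left; apply/eqP; field; rewrite gt_eqF.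
- by move=> d1 d2; split.
Unshelve. all: by end_near. Qed.

Lemma rV_norm_le m (M : 'rV[R]_m) (c : R) :
  0 <= c -> (forall i, `|M 0 i| <= c) -> `|M| <= c.
Proof.
move=> c0 hM; rewrite /Num.Def.normr /= mx_normrE.
by apply: bigmax_le => // -[i j] _ /=; rewrite ord1.
Qed.

Lemma coord_norm_le m (M : 'rV[R]_m) i : `|M 0 i| <= `|M|.
Proof.
rewrite [leRHS]/Num.Def.normr /= mx_normrE.
exact: (le_bigmax _ (fun ij => `|M ij.1 ij.2|) (0, i)).
Qed.

Lemma diff_row V m (f : V -> 'rV[R]_m) (df : V -> 'rV[R]_m) x :
  (forall i, differentiable (fun y => f y 0 i) x /\
             'd (fun y => f y 0 i) x = (fun v => df v 0 i) :> (V -> R)) ->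
  differentiable f x /\ 'd f x = df :> (V -> 'rV[R]_m).
Proof.
move=> h.
have df_lin : linear df.
  move=> a u v; apply/rowP => i; have [_ hi] := h i.
  by rewrite !mxE -[df _ 0 i]/((fun v => df v 0 i) _) -[df u 0 i]/((fun v => df v 0 i) u)
    -[df v 0 i]/((fun v => df v 0 i) v) -hi linearP.
pose dfM := GRing.isLinear.Build _ _ _ _ _ df_lin.
pose dfL : {linear V -> 'rV[R]_m} := HB.pack df dfM.
apply: (@diff_of_near _ _ _ _ dfL).
  apply/linear_bounded_continuous/linear_boundedP.
  have hk i : exists2 k : R, 0 < k & forall v, `|df v 0 i| <= k * `|v|.
    have [di hi] := h i; have [k k0 hk] := linear_lipschitz (diff_continuous di).
    by exists k => // v; rewrite -[df v 0 i]/((fun v => df v 0 i) v) -hi.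
  pose k i := sval (cid2 (hk i)).
  have kP i : 0 < k i /\ forall v, `|df v 0 i| <= k i * `|v|.
    by rewrite /k; case: cid2.
  near=> c => v /=.
  have c0 : 0 <= c by near: c; apply: nbhs_pinfty_ge; rewrite num_real.
  apply: rV_norm_le => [|i]; first by rewrite mulr_ge0.
  apply: le_trans ((kP i).2 v) _; apply: ler_wpM2r => //.
  apply: (@le_trans _ _ (\sum_j k j)).
    by rewrite (bigD1 i) //= lerDl; apply: sumr_ge0 => j _; apply/ltW; exact: (kP j).1.
  by near: c; apply: nbhs_pinfty_ge; rewrite num_real.
move=> eps eps0; near=> y.
apply: rV_norm_le => [|i]; first by rewrite mulr_ge0 // ltW.
rewrite !mxE /=; move: i; near: y; apply: filter_forall => i.
have [di hi] := h i; have := diff_near di eps0.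
by rewrite hi.
Unshelve. all: by end_near. Qed.

Lemma linear_rV_continuous V m (l : {linear 'rV[R]_m -> V}) : continuous l.
Proof.
apply/linear_bounded_continuous/linear_boundedP.
near=> c => u /=.
have {1}-> : u = \sum_i u 0 i *: delta_mx 0 i by exact: row_sum_delta.
rewrite linear_sum; apply: le_trans (ler_norm_sum _ _ _) _.
apply: (@le_trans _ _ ((\sum_i `|l (delta_mx 0 i)|) * `|u|)).
  rewrite mulr_suml; apply: ler_sum => i _.
  by rewrite linearZZ normrZ mulrC ler_wpM2l // coord_norm_le.
apply: ler_wpM2r => //; near: c; apply: nbhs_pinfty_ge; exact: num_real.
Unshelve. all: by end_near. Qed.

End Differentials.

Lemma diff_idE (R : realType) (V : normedModType R) (x : V) :
  'd (fun y : V => y) x = id :> (V -> V).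
Proof. exact: diff_val. Qed.

Lemma diff_constE (R : realType) (V W : normedModType R) (a : W) (x : V) :
  'd (fun _ : V => a) x = (fun=> 0) :> (V -> W).
Proof. exact: diff_cst. Qed.

(** * Charts of the group; adjoint action and bracket in coordinates *)

Section ManifoldCurves.
Context {R : realType} {n : nat} {G : lieGroupType R n}.
Implicit Types (V : normedModType R) (p q r g h : G).

Definition cinv p : 'rV[R]_n -> G := chart_inv (atl p).

(** Continuity is a separate clause: chart maps are total with arbitrary values off their domains,
    so differentiability of the coordinates does not keep [c] inside the domain near [x]. Any chart
    around [c x] is allowed. [V] is R for motions and a coordinate space for maps read in a
    chart. *)
Definition vdiff V (c : V -> G) (x : V) q : Prop :=
  [/\ chart_dom (atl q) (c x), {for x, continuous c} &
      differentiable (fun y => atl q (c y)) x].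

Definition vder V q (c : V -> G) (x : V) : V -> 'rV[R]_n :=
  'd (fun y => atl q (c y)) x.

Lemma atl_dom p : chart_dom (atl p) p.
Proof. exact: chart_at_dom. Qed.

Lemma atl_cod p : chart_cod (atl p) (atl p p).
Proof. exact/chart_funS/atl_dom. Qed.

Lemma cinv_atl p : cinv p (atl p p) = p.
Proof. exact/chart_funK/atl_dom. Qed.

Lemma near_chart_dom (T : topologicalType) (c : T -> G) (x : T) q :
  {for x, continuous c} -> chart_dom (atl q) (c x) ->
  \forall y \near x, chart_dom (atl q) (c y).
Proof.
by move=> cc dx; apply: cc; apply: open_nbhs_nbhs; split=> //; exact: chart_dom_open.
Qed.

Lemma near_chart_cod q (a : 'rV[R]_n) : chart_cod (atl q) a ->
  \forall y \near a, chart_cod (atl q) y.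
Proof. by move=> qa; apply: open_nbhs_nbhs; split=> //; exact: chart_cod_open. Qed.

Lemma vdiff_cst V g q (x : V) : chart_dom (atl q) g -> vdiff (fun _ => g) x q.
Proof.
move=> dg; split; [exact: dg | exact: cst_continuous | exact: differentiable_cst].
Qed.

Lemma vder_cst V g q (x : V) : vder q (fun _ => g) x = fun _ => 0.
Proof. by rewrite /vder -[LHS]/('d (cst (atl q g)) x : V -> 'rV_n) diff_cst. Qed.

Lemma vdiff_cinv p (a : 'rV[R]_n) : chart_cod (atl p) a ->
  vdiff (cinv p) a p /\ vder p (cinv p) a = id.
Proof.
move=> pa; have [] := @diff_near_eq R _ _ (id : 'rV[R]_n -> 'rV[R]_n)
    (fun y => atl p (cinv p y)) a (ex_diff).
  near=> y; rewrite chart_invK //.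
  by near: y; exact: near_chart_cod.
move=> d1 d2; split; last by rewrite /vder d2 diff_val.
by split; [exact: chart_invS | exact: chart_inv_cont | exact: d1].
Unshelve. all: by end_near. Qed.

Lemma vdiff_comp V (c : V -> G) (f : G -> G) x p q :
  vdiff c x p -> vdiff (f \o cinv p) (atl p (c x)) q ->
  vdiff (f \o c) x q /\
  vder q (f \o c) x = vder q (f \o cinv p) (atl p (c x)) \o vder p c x.
Proof.
move=> [dc cc difc] [df cf diff].
have cK : \forall y \near x, c y = cinv p (atl p (c y)).
  near=> y; rewrite /cinv chart_funK //.
  by near: y; exact: near_chart_dom.
have H := diff_comp difc diff.
have [] := diff_near_eq (differentiable_comp difc diff) (g := fun y => atl q (f (c y))).
  by near=> y; rewrite /= -(near cK y).
move=> d1 d2; split; last exact: etrans d2 H.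
split; [by move: df; rewrite /= /cinv chart_funK | | exact: d1].
have cx : {for x, continuous (fun y => f (cinv p (atl p (c y))))}.
  apply: (continuous_comp (f := fun y => atl p (c y)) (g := f \o cinv p)); last exact: cf.
  exact: differentiable_continuous difc.
suff : (f (c y)) @[y --> x] --> f (c x) by [].
rewrite [in X in _ --> X](nbhs_singleton cK).
apply: cvg_trans cx; apply: near_eq_cvg; near=> y.
have cKy : c y = cinv p (atl p (c y)) by near: y; exact: cK.
exact: (congr1 f (esym cKy)).
Unshelve. all: by end_near. Qed.

Definition mulc p q r (z : 'rV[R]_n * 'rV[R]_n) : 'rV[R]_n :=
  atl r (cinv p z.1 * cinv q z.2)%g.

Definition mulc_dom p q r : set ('rV[R]_n * 'rV[R]_n) :=
  [set z | [/\ chart_cod (atl p) z.1, chart_cod (atl q) z.2 &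
               chart_dom (atl r) (cinv p z.1 * cinv q z.2)%g]].

Lemma mulc_smooth p q r : smooth_on (mulc_dom p q r) (mulc p q r).
Proof. exact: lie_mul_smooth. Qed.

Lemma mul_continuous (T : topologicalType) (a b : T -> G) x :
  {for x, continuous a} -> {for x, continuous b} ->
  {for x, continuous (fun y => a y * b y)%g}.
Proof.
move=> ca cb; apply: (@continuous_comp _ _ _ (fun y => (a y, b y)) (fun z : G * G => (z.1 * z.2)%g)).
  exact: cvg_pair.
exact: lie_mul_cont.
Qed.

Lemma mulc_dom_open p q r : open (mulc_dom p q r).
Proof.
rewrite openE => -[a b] /= [pa qb rab]; rewrite /interior.
have c1 : {for (a, b), continuous (fun z : 'rV[R]_n * 'rV[R]_n => cinv p z.1)}.
  by apply: (continuous_comp (f := fst) (g := cinv p)); [exact: cvg_fst | exact: chart_inv_cont].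
have c2 : {for (a, b), continuous (fun z : 'rV[R]_n * 'rV[R]_n => cinv q z.2)}.
  by apply: (continuous_comp (f := snd) (g := cinv q)); [exact: cvg_snd | exact: chart_inv_cont].
near=> z; split.
- near: z; exact: (@cvg_fst _ _ (nbhs a) (nbhs b) _ _ (near_chart_cod pa)).
- near: z; exact: (@cvg_snd _ _ (nbhs a) (nbhs b) _ _ (near_chart_cod qb)).
- near: z; apply: (near_chart_dom (c := fun z => cinv p z.1 * cinv q z.2)%g) rab.
  exact: mul_continuous.
Unshelve. all: by end_near. Qed.

Lemma smooth_on_differentiable (V W : normedModType R) (U : set V) (f : V -> W) x :
  smooth_on U f -> U x -> differentiable f x.
Proof. by move=> /(_ 1%N)[+ _] Ux; apply. Qed.

Lemma vdiff_mul V (c1 c2 : V -> G) x p q r :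
  vdiff c1 x p -> vdiff c2 x q -> chart_dom (atl r) (c1 x * c2 x)%g ->
  vdiff (fun y => c1 y * c2 y)%g x r /\
  forall v, vder r (fun y => c1 y * c2 y)%g x v =
    'd (mulc p q r) (atl p (c1 x), atl q (c2 x)) (vder p c1 x v, vder q c2 x v).
Proof.
move=> [d1 cc1 dif1] [d2 cc2 dif2] d12.
have dpair := differentiable_pair dif1 dif2.
have dm : differentiable (mulc p q r) (atl p (c1 x), atl q (c2 x)).
  apply: smooth_on_differentiable (@mulc_smooth p q r) _.
  by split; rewrite /= /cinv ?chart_funK //; exact: chart_funS.
have [] := diff_near_eq (differentiable_comp dpair dm) (g := fun y => atl r (c1 y * c2 y)%g).
  near=> y; rewrite /= /mulc /= /cinv !chart_funK //.
    by near: y; exact: near_chart_dom.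
  by near: y; exact: near_chart_dom.
move=> e1 e2; split.
  by split; [exact: d12 | exact: mul_continuous | exact: e1].
move=> v; apply: etrans (congr1 (@^~ v) e2) _.
apply: etrans (congr1 (@^~ v) (diff_comp dpair dm)) _.
exact: (congr1 ('d (mulc p q r) _) (congr1 (@^~ v) (diff_pair dif1 dif2))).
Unshelve. all: by end_near. Qed.

Lemma vdiff_mull V (c : V -> G) x g q r : vdiff c x q ->
  chart_dom (atl r) (g * c x)%g -> vdiff (fun y => g * c y)%g x r.
Proof. by move=> dc dr; have [] := vdiff_mul (vdiff_cst x (atl_dom g)) dc dr. Qed.

Lemma vdiff_mulr V (c : V -> G) x g q r : vdiff c x q ->
  chart_dom (atl r) (c x * g)%g -> vdiff (fun y => c y * g)%g x r.
Proof. by move=> dc dr; have [] := vdiff_mul dc (vdiff_cst x (atl_dom g)) dr. Qed.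

Lemma vder_linear V q (c : V -> G) x : linear (vder q c x).
Proof. by move=> a u v; rewrite /vder linearP. Qed.

Definition e0 : 'rV[R]_n := atl (1%g : G) 1%g.

Lemma cinv_e0 : cinv 1%g e0 = 1%g. Proof. exact: cinv_atl. Qed.

Lemma e0_cod : chart_cod (atl (1%g : G)) e0. Proof. exact: atl_cod. Qed.

Lemma vdiff_cinv1 : vdiff (cinv 1%g) e0 1%g.
Proof. exact: (vdiff_cinv e0_cod).1. Qed.

Definition conjc g (x : 'rV[R]_n) : G := (g * cinv 1%g x * g^-1)%g.

Lemma conjc_e0 g : conjc g e0 = 1%g.
Proof. by rewrite /conjc cinv_e0 mulg1 mulgV. Qed.

Lemma vdiff_Lcinv g r : chart_dom (atl r) g -> vdiff (fun x => g * cinv 1%g x)%g e0 r.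
Proof. by move=> dr; apply: vdiff_mull vdiff_cinv1 _; rewrite cinv_e0 mulg1. Qed.

Lemma vdiff_conjc g : vdiff (conjc g) e0 1%g.
Proof.
apply: vdiff_mulr (vdiff_Lcinv (atl_dom g)) _.
by rewrite cinv_e0 mulg1 mulgV; exact: atl_dom.
Qed.

Lemma vdiff_Rcinv g p r a : chart_cod (atl p) a -> chart_dom (atl r) (cinv p a * g)%g ->
  vdiff (fun x => cinv p x * g)%g a r.
Proof. by move=> pa dr; exact: vdiff_mulr (vdiff_cinv pa).1 dr. Qed.

(** [Ad] is defined by two tangent maps that meet in the chart at [g]. The chain rule removes that
    chart and leaves conjugation read in the chart at 1. *)
Lemma AdE g xi : Ad g xi = vder 1%g (conjc g) e0 xi.
Proof.
have h1 := vdiff_Lcinv (atl_dom g).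
have cg : (g * cinv 1%g e0)%g = g by rewrite cinv_e0 mulg1.
have h2 : vdiff (fun x => cinv g x * g^-1)%g (atl g g) 1%g.
  apply: vdiff_Rcinv; first exact: atl_cod.
  by rewrite cinv_atl mulgV; exact: atl_dom.
have := @vdiff_comp _ _ (fun y => (y * g^-1)%g) e0 g 1%g h1.
rewrite /= cg => /(_ h2)[_ ->] /=.
by rewrite /Ad /Rstar /Lstar /tangent_map mulgV mulg1.
Qed.

Lemma AdM g h xi : Ad (g * h)%g xi = Ad g (Ad h xi).
Proof.
have := @vdiff_comp _ (conjc h) (fun y => (g * y * g^-1)%g) e0 1%g 1%g (vdiff_conjc h).
rewrite conjc_e0 => /(_ (vdiff_conjc g))[_ E].
rewrite !AdE (_ : conjc (g * h)%g = (fun y => (g * y * g^-1)%g) \o conjc h).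
  by rewrite E.
by apply/funext => x; rewrite /conjc /= invgM !mulgA.
Qed.

Lemma Ad1 xi : Ad (1%g : G) xi = xi.
Proof.
rewrite AdE; have [_] := vdiff_cinv e0_cod.
rewrite (_ : conjc 1%g = cinv 1%g) => [->//|].
by apply/funext => x; rewrite /conjc mul1g invg1 mulg1.
Qed.

Lemma Ad_linear g : linear (Ad g).
Proof. by move=> a u v; rewrite !AdE vder_linear. Qed.

(* In the chart at 1, the differentials at 1 of left and right multiplication
   by the point of coordinates [x]. *)
Definition L2 (x z : 'rV[R]_n) : 'rV[R]_n := 'D_(0, z) (mulc (1%g : G) 1%g 1%g) (x, e0).
Definition R2 (x z : 'rV[R]_n) : 'rV[R]_n := 'D_(z, 0) (mulc (1%g : G) 1%g 1%g) (e0, x).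

Let U := mulc_dom (1%g : G) 1%g 1%g.

Lemma mulc_dom_l x : chart_cod (atl (1%g : G)) x -> U (x, e0).
Proof.
by move=> cx; split; [exact: cx | exact: e0_cod |
  rewrite /= cinv_e0 mulg1; exact: chart_invS].
Qed.

Lemma mulc_dom_r x : chart_cod (atl (1%g : G)) x -> U (e0, x).
Proof.
by move=> cx; split; [exact: e0_cod | exact: cx |
  rewrite /= cinv_e0 mul1g; exact: chart_invS].
Qed.

Lemma mulc_diff z : U z -> differentiable (mulc (1%g : G) 1%g 1%g) z.
Proof. exact: smooth_on_differentiable (@mulc_smooth _ _ _). Qed.

Lemma L2E x z : chart_cod (atl (1%g : G)) x ->
  L2 x z = vder 1%g (fun y => cinv 1%g x * cinv 1%g y)%g e0 z.
Proof.
move=> cx; have dx : chart_dom (atl (1%g : G)) (cinv 1%g x) by exact: chart_invS.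
have [|_ ->] := vdiff_mul (vdiff_cst e0 dx) vdiff_cinv1 (r := 1%g).
  by rewrite cinv_e0 mulg1.
rewrite vder_cst (vdiff_cinv e0_cod).2 cinv_e0 chart_invK //.
by rewrite /L2 deriveE //; exact/mulc_diff/mulc_dom_l.
Qed.

Lemma R2E x z : chart_cod (atl (1%g : G)) x ->
  R2 x z = vder 1%g (fun y => cinv 1%g y * cinv 1%g x)%g e0 z.
Proof.
move=> cx; have dx : chart_dom (atl (1%g : G)) (cinv 1%g x) by exact: chart_invS.
have [|_ ->] := vdiff_mul vdiff_cinv1 (vdiff_cst e0 dx) (r := 1%g).
  by rewrite cinv_e0 mul1g.
rewrite vder_cst (vdiff_cinv e0_cod).2 cinv_e0 chart_invK //.
by rewrite /R2 deriveE //; exact/mulc_diff/mulc_dom_r.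
Qed.

(** Differentiates h y = (h y h^-1) h at y = 1. [L2] and [R2] are derivatives of a smooth map, so
    this is an implicit equation from which regularity of [Ad] in the group variable is
    recovered. *)
Lemma L2_R2_Ad x z : chart_cod (atl (1%g : G)) x ->
  L2 x z = R2 x (Ad (cinv 1%g x) z).
Proof.
move=> cx; rewrite L2E // R2E // AdE; set h := cinv 1%g x.
have dh : chart_dom (atl (1%g : G)) (cinv 1%g e0 * h)%g.
  by rewrite cinv_e0 mul1g; exact: chart_invS.
have hR := vdiff_Rcinv e0_cod dh.
have := @vdiff_comp _ (conjc h) (fun y => y * h)%g e0 1%g 1%g (vdiff_conjc h).
rewrite conjc_e0 => /(_ hR)[_ E].
rewrite (_ : (fun y => h * cinv 1%g y)%g = (fun y => y * h)%g \o conjc h).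
  by rewrite E.
by apply/funext => y; rewrite /conjc /= mulgVK.
Qed.

Lemma left_fieldE (x z : 'rV[R]_n) : chart_cod (atl (1%g : G)) x ->
  left_field (G := G) z x = L2 x z.
Proof. by move=> cx; rewrite L2E. Qed.

Let m := mulc (1%g : G) 1%g 1%g.

Lemma L2_diff z : differentiable (fun x => L2 x z) e0 /\
  'd (fun x => L2 x z) e0 = (fun v => 'D_(v, 0) ('D_(0, z) m) (e0, e0)) :> ('rV[R]_n -> _).
Proof.
have Ue : U (e0, e0) by exact/mulc_dom_l/e0_cod.
have dg : differentiable ('D_(0, z) m) (e0, e0).
  by have [_ /(_ (0, z))[+ _]] := @mulc_smooth (1%g : G) 1%g 1%g 2%N; apply.
have dp : differentiable (fun x : 'rV[R]_n => (x, e0)) e0.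
  by apply: differentiable_pair; [exact: ex_diff | exact: differentiable_cst].
split; first exact: (differentiable_comp dp dg).
have -> : (fun x => L2 x z) = 'D_(0, z) m \o (fun x => (x, e0)) by [].
rewrite diff_comp //; apply/funext => v /=.
rewrite deriveE //; congr ('d _ _ _).
rewrite diff_pair; [|exact: ex_diff|exact: differentiable_cst].
by congr pair; [exact: (congr1 (@^~ v) (diff_idE e0)) |
  exact: (congr1 (@^~ v) (diff_constE _ e0))].
Qed.

Lemma R2_diff z : differentiable (fun x => R2 x z) e0 /\
  'd (fun x => R2 x z) e0 = (fun v => 'D_(0, v) ('D_(z, 0) m) (e0, e0)) :> ('rV[R]_n -> _).
Proof.
have Ue : U (e0, e0) by exact/mulc_dom_l/e0_cod.
have dg : differentiable ('D_(z, 0) m) (e0, e0).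
  by have [_ /(_ (z, 0))[+ _]] := @mulc_smooth (1%g : G) 1%g 1%g 2%N; apply.
have dp : differentiable (fun x : 'rV[R]_n => (e0, x)) e0.
  by apply: differentiable_pair; [exact: differentiable_cst | exact: ex_diff].
split; first exact: (differentiable_comp dp dg).
have -> : (fun x => R2 x z) = 'D_(z, 0) m \o (fun x => (e0, x)) by [].
rewrite diff_comp //; apply/funext => v /=.
rewrite deriveE //; congr ('d _ _ _).
rewrite diff_pair; [|exact: differentiable_cst|exact: ex_diff].
by congr pair; [exact: (congr1 (@^~ v) (diff_constE _ e0)) |
  exact: (congr1 (@^~ v) (diff_idE e0))].
Qed.

(** Both terms of the bracket are mixed second derivatives of the multiplication at (1, 1).
    Exchanging the order in the second one makes [xi] the direction of differentiation in both,
    which exhibits the bracket as the derivative of [L2] - [R2] at the identity. *)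
Lemma bracketE xi zeta : bracket (G := G) xi zeta =
  'd (fun x => L2 x zeta) e0 xi - 'd (fun x => R2 x zeta) e0 xi.
Proof.
pose B v w := 'D_(v, 0) ('D_(0, w) m) (e0, e0).
have h w v : 'd (left_field (G := G) w) e0 v = B v w.
  have H : 'd (left_field (G := G) w) e0 = 'd (fun x => L2 x w) e0 :> (_ -> _).
    apply: (diff_near_eq (L2_diff w).1 (g := left_field (G := G) w) _).2.
    near=> x; rewrite left_fieldE //; near: x; exact: near_chart_cod e0_cod.
  by apply: etrans (congr1 (@^~ v) H) _; exact: (congr1 (@^~ v) (L2_diff w).2).
have hL : 'd (fun x => L2 x zeta) e0 xi = B xi zeta by exact: (congr1 (@^~ xi) (L2_diff zeta).2).
have hR : 'd (fun x => R2 x zeta) e0 xi = B zeta xi.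
  apply: etrans (congr1 (@^~ xi) (R2_diff zeta).2) _.
  apply: (smooth_derive_swap _ _ (@mulc_dom_open _ _ _) _ (@mulc_smooth (1%g : G) 1%g 1%g)).
  exact/mulc_dom_l/e0_cod.
exact: (etrans (f_equal2 (fun a b => a - b) (h zeta xi) (h xi zeta))
  (esym (f_equal2 (fun a b => a - b) hL hR))).
Unshelve. all: by end_near. Qed.

End ManifoldCurves.

(** * Calculus of named differentials *)

Section HasDiff.
Context {R : realType}.
Implicit Types V W Z : normedModType R.

Definition has_diff V W (f : V -> W) (x : V) (df : V -> W) : Prop :=
  differentiable f x /\ 'd f x = df :> (V -> W).

Lemma has_diff_cst V W (a : W) (x : V) : has_diff (fun _ => a) x (fun=> 0).
Proof. by split; [exact: differentiable_cst | exact: diff_constE]. Qed.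

Lemma has_diffD V W (f g df dg : V -> W) x : has_diff f x df -> has_diff g x dg ->
  has_diff (fun y => f y + g y) x (fun v => df v + dg v).
Proof.
move=> [f1 f2] [g1 g2]; split; first exact: differentiableD f1 g1.
by apply: etrans (diffD f1 g1) _; rewrite f2 g2.
Qed.

Lemma has_diffB V W (f g df dg : V -> W) x : has_diff f x df -> has_diff g x dg ->
  has_diff (fun y => f y - g y) x (fun v => df v - dg v).
Proof.
move=> [f1 f2] [g1 g2]; split; first exact: differentiableB f1 g1.
by apply: etrans (diffB f1 g1) _; rewrite f2 g2.
Qed.

Lemma has_diff_sum V W (I : finType) (P : pred I) (f df : I -> V -> W) x :
  (forall i, P i -> has_diff (f i) x (df i)) ->
  has_diff (fun y => \sum_(i | P i) f i y) x (fun v => \sum_(i | P i) df i v).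
Proof.
move=> h; rewrite unlock; elim: (index_enum I) => [|i s IH] /=; first exact: has_diff_cst.
have [Pi|nPi] := boolP (P i); last exact: IH.
exact: has_diffD (h i Pi) IH.
Qed.

Lemma has_diff_comp V W Z (f : V -> W) (g : W -> Z) df dg x :
  has_diff f x df -> has_diff g (f x) dg ->
  has_diff (fun y => g (f y)) x (fun v => dg (df v)).
Proof.
move=> [f1 f2] [g1 g2]; split; first exact: differentiable_comp f1 g1.
by apply: etrans (diff_comp f1 g1) _; rewrite f2 g2.
Qed.

Lemma has_diff_near V W (f g : V -> W) df x : has_diff f x df ->
  (\forall y \near x, f y = g y) -> has_diff g x df.
Proof.
move=> [f1 f2] fg; have [g1 g2] := diff_near_eq f1 fg.
by split; [exact: g1 | exact: etrans g2 f2].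
Qed.

Lemma has_diff_unique V W (f df df' : V -> W) x :
  has_diff f x df -> has_diff f x df' -> df = df'.
Proof. by move=> [_ <-] [_ <-]. Qed.

Lemma has_diff_linear V m (l : {linear 'rV[R]_m -> V}) x : has_diff l x l.
Proof.
split; first exact/linear_differentiable/linear_rV_continuous.
exact/diff_lin/linear_rV_continuous.
Qed.

Lemma has_diff_continuous V W (f df : V -> W) x :
  has_diff f x df -> {for x, continuous f}.
Proof. by move=> [f1 _]; exact: differentiable_continuous f1. Qed.

Lemma has_diff_row V m (f df : V -> 'rV[R]_m) x :
  (forall i, has_diff (fun y => f y 0 i) x (fun v => df v 0 i)) -> has_diff f x df.
Proof. exact: diff_row. Qed.

Lemma has_diff_coord V m (f df : V -> 'rV[R]_m) x i :
  has_diff f x df -> has_diff (fun y => f y 0 i) x (fun v => df v 0 i).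
Proof.
move=> h.
have lin : linear (fun u : 'rV[R]_m => u 0 i) by move=> a u v; rewrite !mxE.
pose lM := GRing.isLinear.Build _ _ _ _ _ lin.
pose l : {linear 'rV[R]_m -> R} := HB.pack (fun u : 'rV[R]_m => u 0 i) lM.
exact: has_diff_comp h (has_diff_linear l (f x)).
Qed.

Lemma has_diff_derive V W (c : R -> V) (f df : V -> W) t v :
  has_diff f (c t) df -> is_derive t 1 c v ->
  is_derive t 1 (fun s => f (c s)) (df v).
Proof. by move=> [f1 <-] hc; exact: is_derive_comp_diff f1 hc. Qed.

End HasDiff.

Lemma linear_subE (R : realType) n (f : 'rV[R]_n -> 'rV[R]_n) u v :
  linear f -> f u - f v = f (u - v).
Proof. by move=> lf; rewrite addrC -scaleN1r -lf scaleN1r addrC. Qed.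

(** Separates the coefficients of id - f from the coordinates of [w]. For f = [R2 x] these
    coefficients are differentiable in x and vanish at the identity, as [diffM_vanishing]
    requires. *)
Lemma linear_residual (R : realType) n (f : 'rV[R]_n -> 'rV[R]_n) w i :
  linear f -> (w - f w) 0 i = \sum_j (delta_mx 0 j - f (delta_mx 0 j)) 0 i * w 0 j.
Proof.
move=> lf; pose lM := GRing.isLinear.Build _ _ _ _ _ lf.
pose l : {linear 'rV[R]_n -> 'rV[R]_n} := HB.pack f lM.
rewrite -[f]/(l : _ -> _) {1 2}(row_sum_delta w) linear_sum -sumrB summxE.
by apply: eq_bigr => j _; rewrite linearZZ -scalerBr [LHS]mxE mulrC.
Qed.

HB.instance Definition _ (R : realType) (n : nat) (G : lieGroupType R n) (g : G) :=
  GRing.isLinear.Build R 'rV[R]_n 'rV[R]_n _ (@Ad R n G g) (Ad_linear g).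

(** * Derivative of the adjoint action and the resulting Lie algebra identities *)

Section AdjointDerivative.
Context {R : realType} {n : nat} {G : lieGroupType R n}.
Hypothesis Ad_unitary : forall (g : G) (xi : 'rV[R]_n), enorm (Ad g xi) = enorm xi.
Implicit Types (V : normedModType R) (p q r g h : G) (u v w x y z xi : 'rV[R]_n).

Local Notation "[ u , v ]" := (bracket (G := G) u v) : ring_scope.
Local Notation e0 := (e0 (G := G)).

Lemma sqn_Ad g xi : sqn (Ad g xi) = sqn xi.
Proof. by rewrite -!enorm_sqr Ad_unitary. Qed.

Lemma dotv_Ad g u v : dotv (Ad g u) (Ad g v) = dotv u v.
Proof.
have := sqn_Ad g (u + v); rewrite linearD !sqnD !sqn_Ad; lra.
Qed.

Lemma R2_linear x : chart_cod (atl (1%g : G)) x -> linear (R2 (G := G) x).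
Proof. by move=> cx a u v; rewrite !R2E // vder_linear. Qed.

Lemma L2_e0 z : L2 (G := G) e0 z = z.
Proof.
rewrite L2E; last exact: e0_cod.
rewrite cinv_e0 (_ : (fun y => _) = cinv 1%g); first by rewrite (vdiff_cinv e0_cod).2.
by apply/funext => y; rewrite mul1g.
Qed.

Lemma R2_e0 z : R2 (G := G) e0 z = z.
Proof.
rewrite R2E; last exact: e0_cod.
rewrite cinv_e0 (_ : (fun y => _) = cinv 1%g); first by rewrite (vdiff_cinv e0_cod).2.
by apply/funext => y; rewrite mulg1.
Qed.

Lemma near_eps V (f : V -> R) (a : V) (eps : R) :
  {for a, continuous f} -> f a = 0 -> 0 < eps ->
  \forall s \near a, `|f s| <= eps.
Proof.
move=> cf f0 e; have /cvgrPdist_le/(_ _ e) : f s @[s --> a] --> f a by exact: cf.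
by apply: filterS => s; rewrite f0 sub0r normrN.
Qed.

Lemma continuous_at_zero V (f : V -> R) (a : V) : f a = 0 ->
  (forall eps : R, 0 < eps -> \forall s \near a, `|f s| <= eps) ->
  {for a, continuous f}.
Proof.
move=> f0 h; suff : f s @[s --> a] --> f a by [].
rewrite f0; apply/cvgrPdist_le => eps eps0.
by apply: filterS (h eps eps0) => s; rewrite sub0r normrN.
Qed.

(* [L2 x z = R2 x (Ad x z)] gives [w = D + b w] for [w x = Ad x z - z], where [b]
   vanishes at 1. As [Ad] is isometric, [w] is bounded, so it tends to 0; then
   [b w] has zero differential and [w] inherits that of [D]. *)
Lemma Ad_cinv_diff z : has_diff (fun x => Ad (cinv (1%g : G) x) z) e0 (fun v => [v, z]).
Proof.
pose A x := Ad (cinv (1%g : G) x) z.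
pose w x := A x - z.
pose D x := L2 (G := G) x z - R2 (G := G) x z.
pose b i j x := (delta_mx 0 j - R2 (G := G) x (delta_mx 0 j)) 0 i.
have hD : has_diff D e0 (fun v => [v, z]).
  have := has_diffB (L2_diff (G := G) z) (R2_diff (G := G) z).
  congr has_diff; apply/funext => v; rewrite bracketE.
  apply: esym; exact: (f_equal2 (fun a b => a - b)
    (congr1 (@^~ v) (L2_diff (G := G) z).2) (congr1 (@^~ v) (R2_diff (G := G) z).2)).
have D0 : D e0 = 0 by rewrite /D L2_e0 R2_e0 subrr.
have bd i j : differentiable (b i j) e0.
  exact: (has_diff_coord i (has_diffB (has_diff_cst _ _) (R2_diff (delta_mx 0 j)))).1.
have b0 i j : b i j e0 = 0 by rewrite /b R2_e0 subrr mxE.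
have wE x i : chart_cod (atl (1%g : G)) x ->
    w x 0 i = D x 0 i + \sum_j b i j x * w x 0 j.
  move=> cx; rewrite /D L2_R2_Ad //.
  have lR := R2_linear cx.
  rewrite (linear_subE _ _ lR) -/(A x) -/(w x) -(linear_residual (w x) i lR).
  by rewrite [(w x - _) 0 i]mxE [(- R2 x (w x)) 0 i]mxE addrC subrK.
(* Only boundedness matters here, and |r| <= r^2 + 1 avoids a square root. *)
have wM x i : `|w x 0 i| <= 4 * sqn z + 1.
  have h : w x 0 i ^+ 2 <= 4 * sqn z.
    apply: le_trans (sqr_coord_le _ _) _; apply: le_trans (sqnB_le _ _) _.
    by rewrite sqn_Ad; lra.
  rewrite ler_norml; have := sqn_ge0 z; nra.
have w0 i : w e0 0 i = 0 by rewrite /w /A cinv_e0 Ad1 subrr mxE.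
have M0 : 0 < 4 * sqn z + 1 by have := sqn_ge0 z; lra.
have cw i : {for e0, continuous (fun x => w x 0 i)}.
  apply: continuous_at_zero => [|eps eps0]; first exact: w0.
  pose eps' := eps / (1 + n%:R * (4 * sqn z + 1)).
  have den0 : 0 < 1 + n%:R * (4 * sqn z + 1).
    by rewrite ltr_wpDr // mulr_ge0 // ltW.
  have eps'0 : 0 < eps' by exact: divr_gt0.
  near=> x; rewrite wE; last by near: x; exact: near_chart_cod e0_cod.
  apply: le_trans (ler_normD _ _) _.
  have h1 : `|D x 0 i| <= eps'.
    near: x; apply: (near_eps (f := fun x => D x 0 i)) eps'0; last by rewrite D0 mxE.
    exact: has_diff_continuous (has_diff_coord i hD).
  have h2 : `|\sum_j b i j x * w x 0 j| <= \sum_(j < n) eps' * (4 * sqn z + 1).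
    apply: le_trans (ler_norm_sum _ _ _) _; apply: ler_sum => j _.
    rewrite normrM; apply: ler_pM; [exact: normr_ge0 | exact: normr_ge0 | | exact: wM].
    move: j; near: x; apply: filter_forall => j.
    exact: near_eps (differentiable_continuous (bd i j)) (b0 i j) eps'0.
  apply: le_trans (lerD h1 h2) _.
  rewrite sumr_const card_ord -mulr_natl /eps' le_eqVlt; apply/orP; left.
  by apply/eqP; field; rewrite gt_eqF.
apply: has_diff_row => i.
have hb j : has_diff (fun x => b i j x * w x 0 j) e0 (fun=> 0).
  exact: diffM_vanishing (bd i j) (b0 i j) (cw j) (w0 j).
have := has_diffD (has_diff_cst (z 0 i) e0)
  (has_diffD (has_diff_coord i hD) (has_diff_sum (fun j (_ : true) => hb j))).
have -> : (fun v : 'rV[R]_n => 0 + ([v, z] 0 i + \sum_(j : 'I_n) (0 : R))) = (fun v => [v, z] 0 i).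
  by apply/funext => v; rewrite add0r big1 // addr0.
move=> H; apply: has_diff_near H _; near=> x.
rewrite -wE; last by near: x; exact: near_chart_cod e0_cod.
have -> : w x 0 i = A x 0 i - z 0 i by rewrite [LHS]mxE [(- z) 0 i]mxE.
by rewrite addrCA subrr addr0.
Unshelve. all: by end_near. Qed.

(** Left translation moves the question to the identity, where [Ad_cinv_diff] applies: Ad_{c s} =
    Ad_{c a} Ad_{(c a)^-1 c s}. *)
Lemma Ad_vdiff V (c : V -> G) (a : V) q eta : vdiff c a q ->
  has_diff (fun s => Ad (c s) eta) a
    (fun b : V => Ad (c a) [vder 1%g (fun s => (c a)^-1 * c s)%g a b, eta]).
Proof.
move=> hc; pose c' s := ((c a)^-1 * c s)%g.
have ca : c' a = 1%g by rewrite /c' mulVg.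
have hc' : vdiff c' a 1%g by apply: vdiff_mull hc _; rewrite mulVg; exact: atl_dom.
have h1 : has_diff (fun s => atl (1%g : G) (c' s)) a (vder 1%g c' a).
  by split; [case: hc' | ].
have h2 : has_diff (fun x => Ad (cinv (1%g : G) x) eta) (atl 1%g (c' a)) (fun v => [v, eta]).
  by rewrite ca; exact: Ad_cinv_diff.
have h3 := has_diff_comp h1 h2.
have h4 := has_diff_comp h3 (has_diff_linear (Ad (c a)) _).
apply: has_diff_near h4 _; near=> s.
apply: etrans (esym (AdM _ _ _)) _; rewrite /cinv chart_funK; first by rewrite /c' mulVKg.
by near: s; apply: near_chart_dom; [case: hc' | case: hc'].
Unshelve. all: by end_near. Qed.

Lemma Ad_continuous eta : continuous (fun g : G => Ad g eta).
Proof.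
move=> p; have h := Ad_vdiff eta (vdiff_cinv (atl_cod p)).1.
have hc : {for p, continuous (fun g => Ad (cinv p (atl p g)) eta)}.
  apply: (continuous_comp (f := fun g => atl p g) (g := fun a => Ad (cinv p a) eta)).
    exact: chart_fun_cont (atl_dom p).
  exact: has_diff_continuous h.
suff : Ad g eta @[g --> p] --> Ad p eta by [].
have cvp : Ad (cinv p (atl p g)) eta @[g --> p] --> Ad p eta.
  have E : Ad (cinv p (atl p p)) eta = Ad p eta by rewrite cinv_atl.
  by rewrite -E; exact: hc.
apply: cvg_trans cvp; apply: near_eq_cvg; near=> g.
congr (Ad _ eta); apply: chart_funK; near: g.
by apply: open_nbhs_nbhs; split; [exact: chart_dom_open | exact: atl_dom].
Unshelve. all: by end_near. Qed.

Lemma bracketC u v : [u, v] = - [v, u].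
Proof. by rewrite /bracket opprB. Qed.

(** In [x, u] the first argument is the direction in which Ad u is differentiated, so linearity
    there is that of a differential; antisymmetry transfers it to the second argument. *)
Lemma bracket_linear u : linear (bracket (G := G) u).
Proof.
move=> a v w; rewrite !(bracketC u).
have [_ hd] := Ad_cinv_diff u.
have hE x : [x, u] = 'd (fun x => Ad (cinv (1%g : G) x) u) e0 x by exact: (esym (congr1 (@^~ x) hd)).
by rewrite !hE linearP /= opprD scalerN.
Qed.

(** A straight line in the chart stands in for the one-parameter subgroup of [x], since only the
    velocity at 0 matters. *)
Lemma Ad_line x eta :
  is_derive (0 : R) 1 (fun s : R => Ad (cinv (1%g : G) (e0 + s *: x)) eta) [x, eta].
Proof.
have hc : is_derive (0 : R) (1 : R) (fun s : R => e0 + s *: x) x.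
  by have := is_derive_addf (is_derive_cst e0 (0 : R) (1 : R)) (is_derive_scalel x 0);
    rewrite add0r.
have h := Ad_cinv_diff eta; rewrite -[e0]addr0 -(scale0r x) in h.
exact: (has_diff_derive (c := fun s : R => e0 + s *: x) h hc).
Qed.

Lemma is_derive_unique (V : normedModType R) (f : R -> V) (t : R) (a b : V) :
  is_derive t 1 f a -> is_derive t 1 f b -> a = b.
Proof. by move=> [_ <-] [_ <-]. Qed.

Lemma cinv_line0 x : cinv (1%g : G) (e0 + 0 *: x) = 1%g.
Proof. by rewrite scale0r addr0 cinv_e0. Qed.

Lemma dotv_bracketl x u v : dotv [x, u] v = - dotv u [x, v].
Proof.
have h := is_derive_dotv (Ad_line x u) (Ad_line x v).
rewrite !cinv_line0 !Ad1 in h.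
have h0 : is_derive (0 : R) (1 : R) (fun s : R => dotv (Ad (cinv (1%g : G) (e0 + s *: x)) u)
    (Ad (cinv (1%g : G) (e0 + s *: x)) v)) 0.
  rewrite (_ : (fun s => _) = cst (dotv u v)); first exact: is_derive_cst.
  by apply/funext => s; rewrite dotv_Ad.
by have /eqP := is_derive_unique h h0; rewrite addr_eq0 => /eqP.
Qed.

Lemma dotv_bracketr x u v : dotv u [x, v] = - dotv [x, u] v.
Proof. by rewrite dotv_bracketl opprK. Qed.

(** Both sides differentiate Ad_{h y h^-1} Ad_h eta = Ad_h Ad_y eta at y = 1 in the direction
    [x]. *)
Lemma Ad_bracket h x eta : Ad h [x, eta] = [Ad h x, Ad h eta].
Proof.
have h1 := Ad_vdiff (Ad h eta) (vdiff_conjc h).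
have h2 := has_diff_comp (Ad_cinv_diff eta) (has_diff_linear (Ad h) _).
have E : (fun y => Ad (conjc h y) (Ad h eta)) = (fun y => Ad h (Ad (cinv (1%g : G) y) eta)).
  by apply/funext => y; rewrite -!AdM /conjc mulgVK.
rewrite E in h1.
have := congr1 (@^~ x) (has_diff_unique h1 h2) => /= <-.
rewrite (_ : (fun s => (conjc h e0)^-1 * conjc h s)%g = conjc h).
  by rewrite conjc_e0 Ad1 -(AdE h x).
by apply/funext => y; rewrite conjc_e0 invg1 mul1g.
Qed.

Lemma is_derive_bracket (c : R -> 'rV[R]_n) (t : R) c' u :
  is_derive t 1 c c' -> is_derive t 1 (fun s => [u, c s]) [u, c'].
Proof.
move=> hc; pose lM := GRing.isLinear.Build _ _ _ _ _ (bracket_linear u).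
pose l : {linear 'rV[R]_n -> 'rV[R]_n} := HB.pack (bracket (G := G) u) lM.
exact: has_diff_derive (has_diff_linear l (c t)) hc.
Qed.

(** The Jacobi identity tested against [c], obtained by differentiating (Ad b) . [c, Ad a] = (Ad
    [a, b]) . c along [x]. Pairing with [c] leaves only the second slot of a bracket moving, where
    the bracket is already known to be linear. *)
Lemma dotv_bracket_bracket x a b c :
  dotv [x, b] [c, a] + dotv b [c, [x, a]] = dotv [x, [a, b]] c.
Proof.
have h1 := is_derive_dotv (Ad_line x b) (is_derive_bracket c (Ad_line x a)).
have h2 := is_derive_dotv (Ad_line x [a, b]) (is_derive_cst c (0 : R) (1 : R)).
rewrite !cinv_line0 !Ad1 in h1 h2; rewrite dotv0r addr0 in h2.
have E : (fun s : R => dotv (Ad (cinv (1%g : G) (e0 + s *: x)) b)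
    [c, Ad (cinv (1%g : G) (e0 + s *: x)) a]) =
    (fun s : R => dotv (Ad (cinv (1%g : G) (e0 + s *: x)) [a, b]) c).
  by apply/funext => s; rewrite Ad_bracket bracketC dotvNr dotv_bracketr opprK.
by rewrite E in h1; exact: is_derive_unique h1 h2.
Qed.

Definition central u := forall v, [v, u] = 0.

(** Local by nature, since other components of [G] may move central elements. Along the segment from
    the identity in the chart, the derivative of Ad u is Ad [v, u] = 0. One neighbourhood serves all
    [u]. *)
Lemma near_Ad_central : \forall h \near (1%g : G), forall u, central u -> Ad h u = u.
Proof.
have /nbhs_ballP[r /= r0 hr] := near_chart_cod (e0_cod (G := G)).
have hb x u : ball e0 r x -> central u -> Ad (cinv (1%g : G) x) u = u.
  move=> bx cu; apply/rowP => i.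
  pose f (s : R) := Ad (cinv (1%g : G) (e0 + s *: (x - e0))) u 0 i.
  have fd (s : R) : 0 <= s -> s <= 1 -> is_derive s 1 f 0.
    move=> s0 s1.
    have cs : chart_cod (atl (1%g : G)) (e0 + s *: (x - e0)).
      apply: hr; move: bx; rewrite -!ball_normE /= => bx.
      rewrite opprD addrA subrr sub0r normrN normrZ ger0_norm //.
      apply: le_lt_trans bx; rewrite -normrN opprB; apply: ler_piMl => //.
    have H := Ad_vdiff u (vdiff_cinv cs).1.
    have hc : is_derive (s : R) (1 : R) (fun s : R => e0 + s *: (x - e0)) (x - e0).
      by have := is_derive_addf (is_derive_cst e0 s (1 : R)) (is_derive_scalel (x - e0) s);
        rewrite add0r.
    have := is_derive_coord i (has_diff_derive (c := fun s : R => e0 + s *: (x - e0)) H hc).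
    by rewrite cu linear0 mxE.
  have cf : {within `[0, 1], continuous f}.
    apply: derivable_within_continuous => y; rewrite in_itv /= => /andP[y0 y1].
    by have [] := fd y y0 y1.
  have [|y _] := @MVT R f (fun=> 0) 0 1 ltr01 _ cf.
    by move=> y; rewrite in_itv /= => /andP[/ltW y0 /ltW y1]; exact: fd.
  rewrite mul0r /f scale1r scale0r addr0 cinv_e0 Ad1 [e0 + _]addrC subrK => /eqP.
  by rewrite subr_eq0 => /eqP.
have ca : {for (1%g : G), continuous (atl (1%g : G))} by exact: chart_fun_cont (atl_dom _).
near=> h => u cu.
have -> : h = cinv 1%g (atl (1%g : G) h).
  rewrite /cinv chart_funK //; near: h.
  by apply: open_nbhs_nbhs; split; [exact: chart_dom_open | exact: atl_dom].
apply: hb cu; near: h; apply: ca; exact: nbhsx_ballx.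
Unshelve. all: by end_near. Qed.

End AdjointDerivative.

(** * Lie algebras with an invariant scalar product *)

Section OrthogonalLieAlgebra.
Context {R : realType} {n : nat}.
Implicit Types u v w x y z a b c : 'rV[R]_n.

Variable br : 'rV[R]_n -> 'rV[R]_n -> 'rV[R]_n.
Hypothesis brC : forall u v, br u v = - br v u.
Hypothesis br_lin : forall u, linear (br u).
Hypothesis br_skew : forall x u v, dotv (br x u) v = - dotv u (br x v).
Hypothesis br_br : forall x a b c,
  dotv (br x b) (br c a) + dotv b (br c (br x a)) = dotv (br x (br a b)) c.

Lemma br_jacobi x a b : br x (br a b) = br (br x a) b + br a (br x b).
Proof.
apply/eqP; rewrite -subr_eq0; apply/eqP; apply: dotv_eq0 => c.
rewrite dotvC dotvBl dotvDl (br_skew (br x a)) (br_skew a (br x b)).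
rewrite (brC (br x a) c) (brC a c) !dotvNr !opprK -br_br; ring.
Qed.

Definition adm x : 'M[R]_n := \matrix_i br x (delta_mx 0 i).

Lemma mul_adm u x : u *m adm x = br x u.
Proof.
pose lM := GRing.isLinear.Build _ _ _ _ _ (br_lin x).
pose l : {linear 'rV[R]_n -> 'rV[R]_n} := HB.pack (br x) lM.
rewrite -[br x u]/(l u) {2}(row_sum_delta u) linear_sum mulmx_sum_row.
by apply: eq_bigr => i _; rewrite linearZ rowK.
Qed.

Lemma mx_eqP (A B : 'M[R]_n) : (forall u : 'rV_n, u *m A = u *m B) -> A = B.
Proof. by move=> h; apply/row_matrixP => i; rewrite !rowE. Qed.

Lemma dotv_deltar (A : 'M[R]_n) i j : dotv (delta_mx 0 i *m A) (delta_mx 0 j) = A i j.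
Proof.
rewrite /dotv (bigD1 j) //= big1 => [|k kj]; rewrite -rowE !mxE.
  by rewrite !eqxx mulr1 addr0.
by rewrite (negPf kj) andbF mulr0.
Qed.

Lemma adm_skew x : (adm x)^T = - adm x.
Proof.
apply/matrixP => i j.
have := br_skew x (delta_mx 0 j) (delta_mx 0 i).
by rewrite -!mul_adm (dotvC (delta_mx 0 j)) !dotv_deltar !mxE.
Qed.

Lemma adm_linear : linear adm.
Proof.
move=> a u v; apply: mx_eqP => w.
by rewrite mulmxDr -scalemxAr !mul_adm !(brC _ w) br_lin opprD scalerN.
Qed.

HB.instance Definition _ := GRing.isLinear.Build R 'rV[R]_n 'M[R]_n _ adm adm_linear.

Lemma admD x y : adm (x + y) = adm x + adm y.
Proof. exact: linearD. Qed.

(** The Jacobi identity. Row vectors are acted on from the right, so products of matrices compose in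
    reverse order and the commutator has the opposite sign from the usual one. *)
Lemma adm_br z a : adm (br z a) = adm a *m adm z - adm z *m adm a.
Proof.
apply: mx_eqP => u; rewrite mulmxBr !mulmxA !mul_adm.
by rewrite (br_jacobi z a u) addrK.
Qed.

Lemma fsq_adm_le : exists2 K : R, 0 <= K & forall x, fsq (adm x) <= K * sqn x.
Proof.
have lin : linear (fun x => mxvec (adm x)) by move=> a u v; rewrite !linearP.
pose lM := GRing.isLinear.Build _ _ _ _ _ lin.
pose l : {linear 'rV[R]_n -> 'rV[R]_(n * n)} := HB.pack (fun x => mxvec (adm x)) lM.
exact: (linear_sqn_bounded l).
Qed.

Lemma sqn_br_le : exists2 K : R, 0 <= K & forall x y, sqn (br x y) <= K * sqn x * sqn y.
Proof.
have [K K0 hK] := fsq_adm_le; exists K => // x y.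
rewrite -mul_adm; apply: le_trans (sqn_mulmx _ _) _.
by rewrite mulrC; apply: ler_wpM2r; [exact: sqn_ge0 | exact: hK].
Qed.

(** The kernel of ad is the centre. If c = c0 + c1 with c0 central, orthogonality gives |c|^2 = c .
    c1, hence |c| <= |c1|, and [split_kermx] bounds c1 by ad c. *)
Lemma adm_lower_bound : exists2 K : R, 0 <= K & forall c,
  (forall y, (forall v, br v y = 0) -> dotv c y = 0) -> sqn c <= K * fsq (adm c).
Proof.
have lin : linear (fun x => mxvec (adm x)) by move=> a u v; rewrite !linearP.
pose lM := GRing.isLinear.Build _ _ _ _ _ lin.
pose l : {linear 'rV[R]_n -> 'rV[R]_(n * n)} := HB.pack (fun x => mxvec (adm x)) lM.
have ME u : u *m lin1_mx l = mxvec (adm u) by rewrite mul_rV_lin1.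
have [K K0 hK] := split_kermx (lin1_mx l).
exists K => // c hc; have [c0 [c1 [hc01 h0 h1]]] := hK c.
have c0c : dotv c c0 = 0.
  apply: hc => v; rewrite brC -mul_adm.
  have -> : adm c0 = 0 by apply: (can_inj mxvecK); rewrite -ME h0 linear0.
  by rewrite mulmx0 oppr0.
have E : sqn c = dotv c c1 by rewrite /sqn {2}hc01 dotvDr c0c add0r.
have : sqn c <= sqn c1 by have := dotv_le c c1; rewrite -E; lra.
by move=> h; apply: le_trans h _; rewrite ME in h1.
Qed.

Definition automorphism (h : 'rV[R]_n -> 'rV[R]_n) :=
  [/\ linear h, forall x y, dotv (h x) (h y) = dotv x y &
      forall x y, h (br x y) = br (h x) (h y)].

(* [split_skew] resolves [h a - a] as [c + [z, a]] with [c] commuting with [a];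
   applied to [h], [commuting_conjugation_bound] makes [ad c], hence [c] up to
   the center, quadratically small. *)
Lemma orbit_tangent a : exists2 K : R, 0 <= K & forall h,
  automorphism h ->
  (forall y, (forall v, br v y = 0) -> dotv (h a) y = dotv a y) ->
  exists z, sqn (h a - a - br z a) <= K * sqn (h a - a) ^+ 2.
Proof.
have [K1 K10 hK1] := commuting_conjugation_bound (adm_skew a).
have [K2 K20 hK2] := fsq_adm_le.
have [K3 K30 hK3] := adm_lower_bound.
exists (K3 * (K1 * K2 ^+ 2)); first by rewrite !mulr_ge0 // exprn_ge0.
move=> h [hlin hiso haut] hcen.
set w := h a - a.
have [c [v [hw hc]]] := split_skew w (adm_skew a).
exists (- v).
have ztE : br (- v) a = v *m adm a.
  by rewrite brC -!mul_adm mulNmx opprK.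
have cE : w - br (- v) a = c by rewrite ztE hw addrK.
rewrite cE.
have ca : br a c = 0 by rewrite -mul_adm.
pose lM := GRing.isLinear.Build _ _ _ _ _ hlin.
pose l : {linear 'rV[R]_n -> 'rV[R]_n} := HB.pack h lM.
pose H := lin1_mx l.
have HE u : u *m H = h u by rewrite mul_rV_lin1.
have HH : H *m H^T = 1%:M.
  apply/matrixP => i j.
  have := hiso (delta_mx 0 i) (delta_mx 0 j).
  rewrite -!HE !dotv_mulmx trmx_mul !trmx_delta mulmxA -(mulmxA _ H).
  by rewrite -rowE -!colE !mxE => ->; rewrite eqxx /= eq_sym.
have HH' : H^T *m H = 1%:M by exact: mulmx1C.
have XH : adm a *m H = H *m adm (h a).
  by apply: mx_eqP => u; rewrite !mulmxA !(mul_adm, HE) haut.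
have EE : adm w = H^T *m adm a *m H - adm a.
  by rewrite -mulmxA XH mulmxA HH' mul1mx linearB.
have CX : adm c *m adm a = adm a *m adm c.
  apply/eqP; rewrite -subr_eq0 -adm_br ca; apply/eqP; exact: linear0.
(* The part [z, a] of [w] does not contribute, because [adm c] commutes with [adm a]; what remains
   is the trace of the square of a skew matrix. *)
have trE : \tr (adm c *m adm w) = - fsq (adm c).
  have -> : w = c + br (- v) a by rewrite -cE subrK.
  rewrite admD mulmxDr mxtraceD adm_br mulmxBr linearB /= !mulmxA CX.
  rewrite [X in _ + (_ - X)]mxtrace_mulC !mulmxA subrr addr0.
  by rewrite /fsq fip_trace adm_skew mulmxN linearN /= opprK.
have := hK1 H (adm c) (adm w) HH' CX EE.
rewrite trE sqrrN => hb.
(* [hb] reads |ad c|^4 <= K1 |ad c|^2 |ad w|^4; one factor |ad c|^2 is divided out unless it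
   vanishes. *)
have hfc : fsq (adm c) <= K1 * fsq (adm w) ^+ 2.
  have [|f0] := leP (fsq (adm c)) 0.
    by move=> /le_trans; apply; rewrite mulr_ge0 // exprn_ge0 // fsq_ge0.
  by rewrite -(ler_pM2l f0) -expr2 mulrCA mulrA.
(* [c] is orthogonal to the centre: [w] is so by [hcen], and every bracket is so by invariance. *)
have hcc : sqn c <= K3 * fsq (adm c).
  apply: hK3 => y hy.
  rewrite -cE dotvBl (brC _ a) dotvNl br_skew hy dotv0r oppr0 oppr0 subr0.
  by rewrite dotvBl hcen // subrr.
apply: le_trans hcc _; rewrite -mulrA; apply: ler_wpM2l => //.
apply: le_trans hfc _; rewrite -mulrA; apply: ler_wpM2l => //.
rewrite -exprMn; apply: lerXn2r; rewrite ?nnegrE ?fsq_ge0 // ?hK2 //.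
by rewrite mulr_ge0 // sqn_ge0.
Qed.

End OrthogonalLieAlgebra.

(** * Sums over the edges of an undirected graph *)

Section EdgeSums.
Context {R : realType} {n N : nat} (e : rel 'I_N).
Hypothesis e_sym : symmetric e.
Implicit Types a d : 'I_N -> 'rV[R]_n.

Definition lap a k : 'rV[R]_n := \sum_(j | e j k) (a k - a j).

Lemma edge_sum_antisym (F : 'I_N -> 'I_N -> R) : (forall j k, F j k = - F k j) ->
  \sum_k \sum_(j | e j k) F k j = 0.
Proof.
move=> Fa; set S := \sum_k _.
have : S = - S.
  rewrite {1}/S (exchange_big_dep xpredT) //= -sumrN; apply: eq_bigr => j _.
  rewrite -sumrN; apply: eq_big => k; first by rewrite e_sym.
  by rewrite Fa.
by move=> h; lra.
Qed.

Lemma edge_sum_by_parts a d :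
  \sum_k \sum_(j | e j k) dotv (a k - a j) (d k - d j) = 2 * \sum_k dotv (lap a k) (d k).
Proof.
have -> : 2 * \sum_k dotv (lap a k) (d k) =
    \sum_k \sum_(j | e j k) 2 * dotv (a k - a j) (d k).
  rewrite mulr_sumr; apply: eq_bigr => k _.
  by rewrite dotv_suml mulr_sumr.
apply/eqP; rewrite -subr_eq0 -sumrB; apply/eqP.
under eq_bigr do rewrite -sumrB.
apply: (edge_sum_antisym (F := fun k j => dotv (a k - a j) (d k - d j) - 2 * dotv (a k - a j) (d k))).
move=> j k /=; rewrite -(opprB (a j)) !dotvNl !dotvBr; ring.
Qed.

Lemma lap_sum0 a : \sum_k lap a k = 0.
Proof.
apply: dotv_eq0 => v; rewrite dotv_sumr.
under eq_bigr do rewrite dotv_sumr.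
apply: (edge_sum_antisym (F := fun k j => dotv v (a k - a j))) => j k.
by rewrite -dotvNr opprB.
Qed.

Definition disagr a : R := 2^-1 * \sum_k \sum_(j | e j k) sqn (a k - a j).

Lemma disagr_ge0 a : 0 <= disagr a.
Proof.
rewrite mulr_ge0 //; apply: sumr_ge0 => k _; apply: sumr_ge0 => j _; exact: sqn_ge0.
Qed.

Lemma disagr_lap a : disagr a = \sum_k dotv (lap a k) (a k).
Proof. by rewrite /disagr edge_sum_by_parts mulrA mulVf ?mul1r. Qed.

Lemma disagr_sum a : \sum_k \sum_(j | e j k) sqn (a k - a j) = 2 * disagr a.
Proof. by rewrite /disagr mulrA mulfV ?mul1r. Qed.

Lemma sum_ge_term (I : finType) (P : pred I) (F : I -> R) i :
  (forall j, 0 <= F j) -> P i -> F i <= \sum_(j | P j) F j.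
Proof.
by move=> F0 Pi; rewrite (bigD1 i) //= lerDl; apply: sumr_ge0.
Qed.

Lemma sum_le_const (I : finType) (P : pred I) (F : I -> R) c :
  0 <= c -> (forall j, P j -> F j <= c) -> \sum_(j | P j) F j <= #|I|%:R * c.
Proof.
move=> c0 Fc; apply: le_trans (ler_sum _ Fc) _.
by rewrite sumr_const -[leLHS]mulr_natl ler_wpM2r // ler_nat max_card.
Qed.

Lemma sqn_lap_le a k : sqn (lap a k) <= N%:R * (2 * disagr a).
Proof.
apply: le_trans (sqn_sum_le _ _) _; rewrite card_ord ler_wpM2l //.
rewrite -disagr_sum; apply: (sum_ge_term (F := fun k => \sum_(j | e j k) sqn (a k - a j))) => // j.
by apply: sumr_ge0 => i _; exact: sqn_ge0.
Qed.

Hypothesis e_conn : forall j k, connect e j k.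

Lemma sqn_diff_le a j k : sqn (a j - a k) <= 4 ^+ N * (2 * disagr a).
Proof. by rewrite -disagr_sum; exact: connected_sqn_le. Qed.

Lemma sqn_diff_mean_le (N0 : (0 < N)%N) a k :
  sqn (a k - N%:R^-1 *: \sum_j a j) <= 4 ^+ N * (2 * disagr a).
Proof.
have NR : (N%:R : R) != 0 by rewrite pnatr_eq0 -lt0n.
have -> : a k - N%:R^-1 *: \sum_j a j = N%:R^-1 *: \sum_j (a k - a j).
  rewrite sumrB sumr_const card_ord scalerBr -[a k *+ N]scaler_nat.
  by rewrite scalerA mulVf // scale1r.
rewrite sqnZ; set T := 4 ^+ N * _.
have h : sqn (\sum_j (a k - a j)) <= N%:R * (N%:R * T).
  apply: le_trans (sqn_sum_le _ _) _; rewrite card_ord ler_wpM2l //.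
  have T0 : 0 <= T.
    by apply: mulr_ge0; [exact: exprn_ge0 | apply: mulr_ge0 => //; exact: disagr_ge0].
  have := @sum_le_const 'I_N xpredT (fun j => sqn (a k - a j)) T T0.
  by rewrite card_ord; apply => j _; exact: sqn_diff_le.
have h2 : 0 <= (N%:R : R)^-1 ^+ 2 by rewrite exprn_ge0 // invr_ge0.
apply: le_trans (ler_wpM2l h2 h) _.
rewrite le_eqVlt; apply/orP; left; apply/eqP; field; exact: NR.
Qed.

End EdgeSums.

(** * Controller, dissipation and isolation of coordination in an abstract frame *)

Section Controller.
Context {R : realType} {n N : nat} (e : rel 'I_N).
Hypothesis e_sym : symmetric e.
Implicit Types u v w x y z b c : 'rV[R]_n.

Variable br : 'rV[R]_n -> 'rV[R]_n -> 'rV[R]_n.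
Hypothesis brC : forall u v, br u v = - br v u.
Hypothesis br_lin : forall u, linear (br u).
Hypothesis br_skew : forall x u v, dotv (br x u) v = - dotv u (br x v).

Let brDr u v w : br u (v + w) = br u v + br u w.
Proof. by have := br_lin u 1 v w; rewrite !scale1r. Qed.

Let brDl u v w : br (u + v) w = br u w + br v w.
Proof. by rewrite !(brC _ w) brDr opprD. Qed.

Let brNl u v : br (- u) v = - br u v.
Proof.
apply/eqP; rewrite -addr_eq0 -brDl addNr; apply/eqP.
by rewrite brC; have := br_lin v (-1) 0 0; rewrite scaler0 addr0 scaleN1r addNr => ->; rewrite oppr0.
Qed.

Let brBl u v w : br (u - v) w = br u w - br v w.
Proof. by rewrite brDl brNl. Qed.

Let brBr u v w : br u (v - w) = br u v - br u w.
Proof. by rewrite !(brC u) brBl opprD. Qed.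

Lemma is_derive_br (u v : R -> 'rV[R]_n) (t : R) (u' v' : 'rV[R]_n) :
  is_derive t 1 u u' -> is_derive t 1 v v' ->
  is_derive t 1 (fun s => br (u s) (v s)) (br u' (v t) + br (u t) v').
Proof.
move=> hu hv; apply: is_derive_row => j.
have lin i : linear (fun w => br w (delta_mx 0 i)).
  by move=> c x y; rewrite !(brC _ (delta_mx 0 i)) br_lin opprD scalerN.
pose lM i := GRing.isLinear.Build _ _ _ _ _ (lin i).
pose l i : {linear 'rV[R]_n -> 'rV[R]_n} := HB.pack (fun w => br w (delta_mx 0 i)) (lM i).
have E x y : br x y 0 j = \sum_i y 0 i * (l i x) 0 j.
  pose kM := GRing.isLinear.Build _ _ _ _ _ (br_lin x).
  pose k : {linear 'rV[R]_n -> 'rV[R]_n} := HB.pack (br x) kM.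
  rewrite -[br x y]/(k y) {1}(row_sum_delta y) linear_sum summxE.
  by apply: eq_bigr => i _; rewrite linearZ mxE.
have hl i : is_derive t 1 (fun s => l i (u s) 0 j) (l i u' 0 j).
  exact: is_derive_coord (has_diff_derive (has_diff_linear (l i) (u t)) hu).
have := is_derive_sumP (fun i (_ : true) => is_derive_mulf (is_derive_coord i hv) (hl i)).
have -> : (fun s => \sum_(i : 'I_n) v s 0 i * l i (u s) 0 j) = (fun s => br (u s) (v s) 0 j).
  by apply/funext => s; rewrite E.
by rewrite big_split /= -!E addrC mxE.
Qed.

(* [A k] stands for Ad_{g_k} and [B k j] for Ad_{g_k^-1 g_j}. *)
Record frame (A : 'I_N -> {linear 'rV[R]_n -> 'rV[R]_n})
    (B : 'I_N -> 'I_N -> {linear 'rV[R]_n -> 'rV[R]_n}) : Prop := Frame {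
  frame_dot : forall k u v, dotv (A k u) (A k v) = dotv u v;
  frame_br : forall k u v, A k (br u v) = br (A k u) (A k v);
  frame_AB : forall k j u, A k (B k j u) = A j u
}.

Definition rel_sum (B : 'I_N -> 'I_N -> {linear 'rV[R]_n -> 'rV[R]_n})
  (eta : 'I_N -> 'rV[R]_n) k : 'rV[R]_n := \sum_(j | e j k) (eta k - B k j (eta j)).

Definition ctl B eta k : 'rV[R]_n := eta k + br (rel_sum B eta k) (eta k).

Definition dissip (a : 'I_N -> 'rV[R]_n) : R := \sum_k sqn (br (lap e a k) (a k)).

Lemma dissip_ge0 a : 0 <= dissip a.
Proof. by apply: sumr_ge0 => k _; exact: sqn_ge0. Qed.

Lemma frame_sqnB A B k j u : frame A B -> sqn (B k j u) = sqn u.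
Proof. by move=> AB; rewrite /sqn -(frame_dot AB k) !(frame_AB AB) (frame_dot AB). Qed.

Lemma frame_lap A B b k : frame A B ->
  A k (rel_sum B (fun=> b) k) = lap e (fun k => A k b) k.
Proof.
move=> AB; rewrite linear_sum; apply: eq_bigr => j _.
by rewrite linearB /= (frame_AB AB).
Qed.

Lemma frame_dissip A B b : frame A B ->
  dissip (fun k => A k b) = \sum_k sqn (br (rel_sum B (fun=> b) k) b).
Proof.
move=> AB; apply: eq_bigr => k _.
by rewrite -(frame_lap _ _ AB) -(frame_br AB) /sqn (frame_dot AB).
Qed.

(** The gradient of the potential in body coordinates: if agent k moves with left velocity [x], then
    Ad_{g_k} b moves with velocity [A k (br x b)]. Decrease along solutions, criticality of the
    zeros of Q and their isolation all rest on this identity. *)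
Lemma dotv_lap_br A B b x k : frame A B ->
  dotv (lap e (fun k => A k b) k) (A k (br x b)) =
  - dotv x (br (rel_sum B (fun=> b) k) b).
Proof.
move=> AB; rewrite -(frame_lap _ _ AB) (frame_dot AB).
set sg := rel_sum _ _ _; have := br_skew b sg x.
by rewrite (brC b sg) dotvNl (dotvC _ x) (brC x) dotvNr => ->.
Qed.

Lemma frame_dissip_eq0 A B b k : frame A B ->
  dissip (fun k => A k b) = 0 -> br (rel_sum B (fun=> b) k) b = 0.
Proof.
move=> AB h; apply/eqP; rewrite -sqn_eq0 eq_le sqn_ge0 andbT -h (frame_dissip _ AB).
by apply: (sum_ge_term (F := fun k => sqn (br (rel_sum B (fun=> b) k) b))) => // j; exact: sqn_ge0.
Qed.

(** The sum is the first variation of the potential under left velocities [y k]. After summation by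
    parts each term contains the bracket that vanishes with the dissipation. *)
Lemma stationary A B b (y : 'I_N -> 'rV[R]_n) : frame A B ->
  dissip (fun k => A k b) = 0 ->
  \sum_k \sum_(j | e j k)
    dotv (A k b - A j b) (A k (br (y k) b) - A j (br (y j) b)) = 0.
Proof.
move=> AB h.
rewrite (edge_sum_by_parts e_sym (fun k => A k b) (fun k => A k (br (y k) b))).
rewrite big1 ?mulr0 // => k _.
by rewrite (dotv_lap_br _ _ _ AB) (frame_dissip_eq0 k AB h) dotv0r oppr0.
Qed.

Lemma sqn_rel_sum_le A B eta (c : R) k : frame A B -> 0 <= c ->
  (forall j, sqn (eta j) <= c) -> sqn (rel_sum B eta k) <= N%:R * (N%:R * (4 * c)).
Proof.
move=> AB c0 hc; apply: le_trans (sqn_sum_le _ _) _.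
rewrite card_ord ler_wpM2l //.
have := @sum_le_const R 'I_N (fun j => e j k) (fun j => sqn (eta k - B k j (eta j))) (4 * c).
rewrite card_ord; apply; first by rewrite mulr_ge0.
move=> j _; apply: le_trans (sqnB_le _ _) _; rewrite (frame_sqnB _ _ _ AB).
by have := hc j; have := hc k; lra.
Qed.

Lemma ctl_bound (Bd : R) : 0 <= Bd -> exists2 C : R, 0 <= C & forall A B eta, frame A B ->
  (forall k, sqn (eta k) <= Bd) -> forall k, sqn (ctl B eta k) <= C.
Proof.
move=> Bd0; have [K K0 hK] := sqn_br_le brC br_lin.
exists (2 * Bd + 2 * (K * (N%:R * (N%:R * (4 * Bd))) * Bd)).
  by rewrite addr_ge0 // !mulr_ge0.
move=> A B eta AB heta k; apply: le_trans (sqnD_le _ _) _.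
apply: lerD; first by rewrite ler_wpM2l.
rewrite ler_wpM2l //; apply: le_trans (hK _ _) _; apply: ler_pM => //.
- by rewrite mulr_ge0 ?sqn_ge0.
- exact: sqn_ge0.
- by rewrite ler_wpM2l //; exact: sqn_rel_sum_le AB _ _.
Qed.

(** The error made by replacing every [eta j] by [b] in the controller. *)
Definition resid B b eta k : 'rV[R]_n :=
  ctl B eta k - b - br (rel_sum B (fun=> b) k) b.

Lemma resid_bound (Bd : R) : 0 <= Bd -> exists2 C : R, 0 <= C & forall A B b eta,
  frame A B -> sqn b <= Bd -> (forall k, sqn (eta k) <= Bd) ->
  forall k, sqn (resid B b eta k) <= C * \sum_j sqn (eta j - b).
Proof.
move=> Bd0; have [K K0 hK] := sqn_br_le brC br_lin.
pose M := N%:R * (N%:R * 4) : R.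
have M0 : 0 <= M by rewrite !mulr_ge0.
exists (2 + 4 * (K * M * Bd) + 4 * (K * (M * Bd))); first by rewrite !addr_ge0 // !mulr_ge0.
move=> A B b eta AB hb heta k.
set E := \sum_j _.
have hE j : sqn (eta j - b) <= E.
  by apply: (sum_ge_term (F := fun j => sqn (eta j - b))) => // i; exact: sqn_ge0.
have E0 : 0 <= E by apply: sumr_ge0 => j _; exact: sqn_ge0.
pose dl j := eta j - b.
have hrel : rel_sum B eta k = rel_sum B dl k + rel_sum B (fun=> b) k.
  rewrite /rel_sum -big_split /=; apply: eq_bigr => j _.
  by rewrite /dl linearB /=; apply/rowP => i; rewrite !mxE; ring.
(* Bilinearity leaves exactly one factor of order [dl] in each bracket; the other factor is bounded
   in terms of [Bd]. *)
have -> : resid B b eta k = dl k + (br (rel_sum B dl k) (eta k) + br (rel_sum B (fun=> b) k) (dl k)).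
  rewrite /resid /ctl hrel brDl /dl brBr.
  by apply/rowP => i; rewrite !mxE; ring.
have -> : (2 + 4 * (K * M * Bd) + 4 * (K * (M * Bd))) * E =
    2 * E + 4 * (K * (M * E) * Bd + K * (M * Bd) * E) by ring.
apply: le_trans (sqnD_le _ _) _; apply: lerD; first by rewrite ler_wpM2l ?hE.
have h4 : 2 * sqn (br (rel_sum B dl k) (eta k) + br (rel_sum B (fun=> b) k) (dl k)) <=
    4 * (sqn (br (rel_sum B dl k) (eta k)) + sqn (br (rel_sum B (fun=> b) k) (dl k))).
  by have := sqnD_le (br (rel_sum B dl k) (eta k)) (br (rel_sum B (fun=> b) k) (dl k)); lra.
apply: le_trans h4 _; rewrite ler_wpM2l //; apply: lerD.
  apply: le_trans (hK _ _) _; apply: ler_pM; [|exact: sqn_ge0| |exact: heta].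
    by rewrite mulr_ge0 ?sqn_ge0.
  by rewrite ler_wpM2l //; have := sqn_rel_sum_le k AB E0 hE; rewrite /M -!mulrA.
apply: le_trans (hK _ _) _; apply: ler_pM; [|exact: sqn_ge0| |exact: hE].
  by rewrite mulr_ge0 ?sqn_ge0.
by rewrite ler_wpM2l //; have := sqn_rel_sum_le k AB Bd0 (fun=> hb); rewrite /M -!mulrA.
Qed.

Lemma disagr_rate_le (Bd : R) : 0 <= Bd -> exists2 C : R, 0 <= C & forall A B b eta,
  frame A B -> sqn b <= Bd -> (forall k, sqn (eta k) <= Bd) ->
  2 * \sum_k dotv (lap e (fun k => A k b) k) (A k (br (ctl B eta k) b)) <=
  - dissip (fun k => A k b) + C * \sum_j sqn (eta j - b).
Proof.
move=> /resid_bound[C C0 hC]; exists (N%:R * C); first by rewrite mulr_ge0.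
move=> A B b eta AB hb heta.
rewrite (frame_dissip _ AB) -sumrN mulr_sumr.
set E := \sum_j sqn _.
have E0 : 0 <= E by apply: sumr_ge0 => j _; exact: sqn_ge0.
have h := @sum_le_const R 'I_N xpredT (fun k => sqn (resid B b eta k)) (C * E) (mulr_ge0 C0 E0)
  (fun k _ => hC A B b eta AB hb heta k).
rewrite card_ord mulrA in h; apply: le_trans (lerD (lexx _) h).
rewrite -big_split /=; apply: ler_sum => k _.
rewrite (dotv_lap_br _ _ _ AB); set p := br _ b; set r := resid _ _ _ _.
(* The drift [b] is orthogonal to [p], so agent k contributes -2 |p|^2 - 2 r . p. Half of the first
   term absorbs the cross term, which leaves -|p|^2 + |r|^2. *)
have -> : ctl B eta k = b + p + r.
  by rewrite /r /resid -/p; apply/rowP => i; rewrite !mxE; ring.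
have bp : dotv b p = 0.
  by have := br_skew (rel_sum B (fun=> b) k) b b; rewrite -/p dotvC; lra.
rewrite (dotvDl (b + p)) (dotvDl b) bp; have := dotv_le (- r) p; rewrite dotvNl sqnN -[dotv p p]/(sqn p).
by move: (sqn p) (sqn r) (dotv r p) => x y z; lra.
Qed.

Lemma ctl_sub_le (Bd : R) : 0 <= Bd -> exists2 C : R, 0 <= C & forall A B b eta,
  frame A B -> sqn b <= Bd -> (forall k, sqn (eta k) <= Bd) ->
  forall k, sqn (ctl B eta k - b) <=
    2 * dissip (fun k => A k b) + C * \sum_j sqn (eta j - b).
Proof.
move=> /resid_bound[C C0 hC]; exists (2 * C); first by rewrite mulr_ge0.
move=> A B b eta AB hb heta k.
have -> : ctl B eta k - b = br (rel_sum B (fun=> b) k) b + resid B b eta k.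
  by rewrite /resid; apply/rowP => i; rewrite !mxE; ring.
apply: le_trans (sqnD_le _ _) _; rewrite -mulrA lerD // ler_wpM2l //; last exact: hC AB _ _ _.
rewrite (frame_dissip _ AB).
by apply: (sum_ge_term (F := fun k => sqn (br (rel_sum B (fun=> b) k) b))) => // j; exact: sqn_ge0.
Qed.

Hypothesis e_conn : forall j k, connect e j k.

Lemma isolated_coordination (k0 : 'I_N) (d K : R) : 0 < d -> 0 <= K ->
  exists2 d0 : R, 0 < d0 & forall A B b, frame A B ->
  (forall k j, sqn (B k j b - b) < d ->
     exists z, sqn (B k j b - b - br z b) <= K * sqn (B k j b - b) ^+ 2) ->
  dissip (fun k => A k b) = 0 -> disagr e (fun k => A k b) < d0 ->
  disagr e (fun k => A k b) = 0.
Proof.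
move=> d_gt0 K0.
pose c1 : R := 4 ^+ N * 2.
have c10 : 0 < c1 by rewrite mulr_gt0 // exprn_gt0.
pose C : R := N%:R * (N%:R * (N%:R * 2 * (K * c1 ^+ 2))).
have C0 : 0 <= C by rewrite /C !mulr_ge0 // exprn_ge0 // ltW.
(* The first bound brings every B_{k,k0} b within [d] of b, so that [horb] applies; the second makes
   C V < 1, which contradicts V^2 <= C V^3 unless V = 0. *)
exists (Num.min (d / c1) (C + 1)^-1).
  by rewrite lt_min divr_gt0 //= invr_gt0 ltr_wpDl.
move=> A B b AB horb hQ; rewrite lt_min => /andP[hd1 hd2].
set a := fun k => A k b; set V := disagr e a.
have V0 : 0 <= V by exact: disagr_ge0.
rewrite -/a -/V in hd1 hd2.
have hp k : br (rel_sum B (fun=> b) k) b = 0.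
  exact: frame_dissip_eq0 AB hQ.
have hdist k : sqn (B k k0 b - b) <= c1 * V.
  have -> : sqn (B k k0 b - b) = sqn (a k0 - a k).
    by rewrite /sqn -(frame_dot AB k) linearB /= (frame_AB AB).
  by rewrite /c1 -mulrA; exact: sqn_diff_le.
have hterm k : dotv (lap e a k) (a k - a k0) ^+ 2 <= N%:R * 2 * (K * c1 ^+ 2) * V ^+ 3.
  have [|z hz] := horb k k0.
    by apply: le_lt_trans (hdist k) _; rewrite mulrC -ltr_pdivlMr.
  set r := _ - br z b in hz.
  have -> : dotv (lap e a k) (a k - a k0) = - dotv (rel_sum B (fun=> b) k) r.
    have -> : a k - a k0 = - A k (B k k0 b - b) by rewrite linearB /= (frame_AB AB) opprB.
    have -> : B k k0 b - b = r + br z b by rewrite subrK.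
    rewrite linearD opprD dotvDr !dotvNr (dotv_lap_br _ _ _ AB) hp dotv0r !oppr0 addr0.
    by rewrite -(frame_lap _ _ AB) (frame_dot AB).
  rewrite sqrrN; apply: le_trans (dotv_CS _ _) _.
  have -> : sqn (rel_sum B (fun=> b) k) = sqn (lap e a k).
    by rewrite -(frame_lap _ _ AB) /sqn (frame_dot AB).
  have -> : N%:R * 2 * (K * c1 ^+ 2) * V ^+ 3 = (N%:R * (2 * V)) * (K * (c1 * V) ^+ 2) by ring.
  apply: ler_pM; rewrite ?sqn_ge0 ?sqn_lap_le //.
  apply: le_trans hz _; rewrite ler_wpM2l //.
  by apply: lerXn2r; rewrite ?nnegrE ?sqn_ge0 // mulr_ge0 // ltW.
(* Subtracting the reference [a k0] costs nothing, as the Laplacians sum to 0. *)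
have hV : V = \sum_k dotv (lap e a k) (a k - a k0).
  under eq_bigr do rewrite dotvBr; rewrite sumrB -disagr_lap //.
  by rewrite -dotv_suml lap_sum0 // dotv0l subr0.
have hV2 : V ^+ 2 <= C * V ^+ 3.
  rewrite {1}hV.
  (* Scalars are viewed as vectors of length 1, so that [sqn_sum_le] bounds the square of their
     sum. *)
  pose w k : 'rV[R]_1 := (dotv (lap e a k) (a k - a k0))%:M.
  have sqw (x : R) : sqn (x%:M : 'rV[R]_1) = x ^+ 2.
    by rewrite /sqn /dotv big_ord_recl big_ord0 addr0 mxE eqxx expr2.
  rewrite -sqw -[_%:M]/(scalar_mx _) raddf_sum /=.
  apply: le_trans (sqn_sum_le _ _) _; rewrite card_ord.
  set D := N%:R * 2 * (K * c1 ^+ 2) * V ^+ 3 in hterm.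
  have D0 : 0 <= D.
    apply: mulr_ge0; last exact: exprn_ge0.
    by rewrite !mulr_ge0 // exprn_ge0 // ltW.
  have h := @sum_le_const R 'I_N xpredT (fun k => sqn (w k)) D D0.
  rewrite card_ord in h; have -> : C * V ^+ 3 = N%:R * (N%:R * D) by rewrite /C /D; ring.
  by rewrite ler_wpM2l //; apply: h => k _; rewrite sqw; exact: hterm.
apply/eqP; apply: contraT => Vn0.
have Vp : 0 < V by rewrite lt_def Vn0.
have : 1 <= C * V.
  rewrite -(ler_pM2l (_ : 0 < V ^+ 2)) ?exprn_gt0 // mulr1.
  by apply: le_trans hV2 _; rewrite le_eqVlt; apply/orP; left; apply/eqP; ring.
have : (C + 1) * V < 1 by rewrite mulrC -ltr_pdivlMr ?mul1r // ltr_wpDl.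
by rewrite mulrDl mul1r; lra.
Qed.

End Controller.

(** * Continuity of functions on a topological space, and two derivative lemmas *)

Section Continuity.
Context {R : realType} {T : topologicalType}.

Lemma continuous_bigsum (V : normedModType R) (I : finType) (P : pred I) (f : I -> T -> V) :
  (forall i, P i -> continuous (f i)) -> continuous (fun s => \sum_(i | P i) f i s).
Proof.
move=> h; rewrite unlock; elim: (index_enum I) => [|i s IH] /=; first exact: cst_continuous.
case: (boolP (P i)) => [Pi|_]; last exact: IH.
by move=> x; apply: continuousD; [exact: h | exact: IH].
Qed.

Lemma continuous_row m (f : T -> 'rV[R]_m) :
  (forall i, continuous (fun s => f s 0 i)) -> continuous f.
Proof.
move=> h x; apply/cvgrPdist_le => eps eps0; near=> s.
apply: rV_norm_le => [|i]; first exact: ltW.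
rewrite !mxE; move: i; near: s; apply: filter_forall => i.
by have /cvgrPdist_le := h i x; exact.
Unshelve. all: by end_near. Qed.

Lemma continuous_coord m (f : T -> 'rV[R]_m) i :
  continuous f -> continuous (fun s => f s 0 i).
Proof.
move=> h x; exact: (continuous_comp (h x) (@coord_continuous _ _ _ 0 i _)).
Qed.

Lemma continuous_mulf (f g : T -> R) :
  continuous f -> continuous g -> continuous (fun s => f s * g s).
Proof. by move=> cf cg x; exact: continuousM (cf x) (cg x). Qed.

Lemma continuous_addf (V : normedModType R) (f g : T -> V) :
  continuous f -> continuous g -> continuous (fun s => f s + g s).
Proof. by move=> cf cg x; exact: continuousD (cf x) (cg x). Qed.

Lemma continuous_scalef (V : normedModType R) (k : R) (f : T -> V) :
  continuous f -> continuous (fun s => k *: f s).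
Proof. by move=> cf x; apply: cvgZl_tmp; exact: cf. Qed.

Lemma continuous_subf (V : normedModType R) (f g : T -> V) :
  continuous f -> continuous g -> continuous (fun s => f s - g s).
Proof. by move=> cf cg x; exact: continuousB (cf x) (cg x). Qed.

Lemma continuous_dotv m (u v : T -> 'rV[R]_m) :
  continuous u -> continuous v -> continuous (fun s => dotv (u s) (v s)).
Proof.
move=> cu cv; apply: (@continuous_bigsum R _ xpredT (fun i s => u s 0 i * v s 0 i)) => i _.
by apply: continuous_mulf; exact: continuous_coord.
Qed.

Lemma continuous_br m (br : 'rV[R]_m -> 'rV[R]_m -> 'rV[R]_m) (u v : T -> 'rV[R]_m) :
  (forall x y, br x y = - br y x) -> (forall x, linear (br x)) ->
  continuous u -> continuous v -> continuous (fun s => br (u s) (v s)).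
Proof.
move=> brC br_lin cu cv; apply: continuous_row => j.
have lin i : linear (fun w => br w (delta_mx 0 i)).
  by move=> c x y; rewrite !(brC _ (delta_mx 0 i)) br_lin opprD scalerN.
pose lM i := GRing.isLinear.Build _ _ _ _ _ (lin i).
pose l i : {linear 'rV[R]_m -> 'rV[R]_m} := HB.pack (fun w => br w (delta_mx 0 i)) (lM i).
have -> : (fun s => br (u s) (v s) 0 j) = (fun s => \sum_i v s 0 i * (l i (u s)) 0 j).
  apply/funext => s; pose kM := GRing.isLinear.Build _ _ _ _ _ (br_lin (u s)).
  pose k : {linear 'rV[R]_m -> 'rV[R]_m} := HB.pack (br (u s)) kM.
  rewrite -[br (u s) (v s)]/(k (v s)) {1}(row_sum_delta (v s)) linear_sum summxE.
  by apply: eq_bigr => i _; rewrite linearZ mxE.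
apply: (@continuous_bigsum R _ xpredT (fun i s => v s 0 i * l i (u s) 0 j)) => i _.
apply: continuous_mulf; first exact: continuous_coord.
apply: continuous_coord => x.
apply: (continuous_comp (f := u) (g := l i)); first exact: cu.
exact: linear_rV_continuous.
Qed.

Lemma lap_continuous n N (e : rel 'I_N) (a : 'I_N -> T -> 'rV[R]_n) k :
  (forall k, continuous (a k)) -> continuous (fun s => lap e (fun k => a k s) k).
Proof.
move=> ca; apply: (@continuous_bigsum _ _ (fun j => e j k) (fun j s => a k s - a j s)) => j _.
exact: continuous_subf.
Qed.

Lemma sqn_lap_bound n N (e : rel 'I_N) (a : 'I_N -> 'rV[R]_n) (c : R) k :
  0 <= c -> (forall j, sqn (a j) <= c) -> sqn (lap e a k) <= N%:R * (N%:R * (4 * c)).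
Proof.
move=> c0 hc; apply: le_trans (sqn_sum_le _ _) _; rewrite card_ord ler_wpM2l //.
have := @sum_le_const R 'I_N (fun j => e j k) (fun j => sqn (a k - a j)) (4 * c).
rewrite card_ord; apply; first by rewrite mulr_ge0.
move=> j _; apply: le_trans (sqnB_le _ _) _.
by have := hc j; have := hc k; lra.
Qed.

Lemma const_of_derive0 (f : R -> R) :
  {within `[(0 : R), +oo[, continuous f} ->
  (forall t : R, 0 < t -> is_derive t 1 f 0) -> forall t, 0 <= t -> f t = f 0.
Proof.
move=> cf df t t0; apply/eqP; rewrite eq_le; apply/andP; split.
  by apply: (@le_of_derive_le0 R f (fun=> 0) 0 0 t).
rewrite -lerN2; apply: (@le_of_derive_le0 R (fun r => - f r) (fun=> 0) 0 0 t) => //.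
  by move=> r; apply: continuousN; exact: cf.
move=> r r0; have := is_derive_subf (is_derive_cst (0 : R) r (1 : R)) (df r r0).
rewrite subr0; congr is_derive; apply/funext => y; exact: sub0r.
Qed.

Lemma is_derive_sqn m (u : R -> 'rV[R]_m) (t : R) (u' : 'rV[R]_m) :
  is_derive t 1 u u' -> is_derive t 1 (fun r => sqn (u r)) (2 * dotv (u t) u').
Proof.
move=> h; have := is_derive_dotv h h.
by rewrite (dotvC u') (_ : 2 * _ = dotv (u t) u' + dotv (u t) u') //; ring.
Qed.

End Continuity.

(** * Trajectories: Lyapunov function and convergence *)

Section Dynamics.
Context {R : realType} {n N : nat} {G : topologicalType}.
Variable e : rel 'I_N.
Hypotheses (e_sym : symmetric e) (e_conn : forall j k, connect e j k) (Npos : (0 < N)%N).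
Implicit Types (b u v : 'rV[R]_n).

Variable br : 'rV[R]_n -> 'rV[R]_n -> 'rV[R]_n.
Hypothesis brC : forall u v, br u v = - br v u.
Hypothesis br_lin : forall u, linear (br u).
Hypothesis br_skew : forall x u v, dotv (br x u) v = - dotv u (br x v).

(* [Adr g h] stands for Ad_{g^-1 h}. *)
Variables (Ad : G -> {linear 'rV[R]_n -> 'rV[R]_n})
          (Adr : G -> G -> {linear 'rV[R]_n -> 'rV[R]_n}).
Hypothesis Ad_dot : forall g u v, dotv (Ad g u) (Ad g v) = dotv u v.
Hypothesis Ad_br : forall g u v, Ad g (br u v) = br (Ad g u) (Ad g v).
Hypothesis Ad_Adr : forall g h u, Ad g (Adr g h u) = Ad h u.
Hypothesis Ad_cont : forall b, continuous (fun g => Ad g b).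
Hypothesis Gcompact : compact [set: G].

Local Notation conf := {ptws 'I_N -> G}.
Local Notation vels := {ptws 'I_N -> 'rV[R]_n}.
Local Notation X := (conf * vels)%type.
Implicit Types (g : conf) (eta : vels) (s : X) (x : R -> X).

Let A g k := Ad (g k).
Let B g k j := Adr (g k) (g j).

Lemma config_frame g : frame br (A g) (B g).
Proof. by split=> *; [exact: Ad_dot | exact: Ad_br | exact: Ad_Adr]. Qed.

Definition adj b g k : 'rV[R]_n := Ad (g k) b.
Definition pot b g : R := disagr e (adj b g).
Definition diss b g : R := dissip e br (adj b g).
Definition spread b eta : R := \sum_k sqn (eta k - b).
Definition mean eta : 'rV[R]_n := N%:R^-1 *: \sum_k eta k.
Definition vel s k : 'rV[R]_n := ctl e br (B s.1) s.2 k.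

(** The motion on the group enters only through the derivatives of Ad_{g_k} b, required for every
    fixed [b]. Hence [G] can be a bare topological space in this section. *)
Definition trajectory x : Prop :=
  [/\ {within `[(0 : R), +oo[, continuous x},
      forall (t : R) k b, 0 < t ->
        is_derive t 1 (fun r => adj b (x r).1 k) (Ad ((x t).1 k) (br (vel (x t) k) b)) &
      forall (t : R) k, 0 < t ->
        is_derive t 1 (fun r => (x r).2 k) (\sum_(j | e j k) ((x t).2 j - (x t).2 k))].

Lemma pot_ge0 b g : 0 <= pot b g. Proof. exact: disagr_ge0. Qed.
Lemma diss_ge0 b g : 0 <= diss b g. Proof. exact: dissip_ge0. Qed.
Lemma spread_ge0 b eta : 0 <= spread b eta.
Proof. by apply: sumr_ge0 => k _; exact: sqn_ge0. Qed.

Lemma sqn_le_spread b eta k : sqn (eta k - b) <= spread b eta.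
Proof.
by apply: (sum_ge_term (F := fun k => sqn (eta k - b))) => // j; exact: sqn_ge0.
Qed.

Lemma adj_continuous b k : continuous (fun g : conf => adj b g k).
Proof.
move=> g; apply: (continuous_comp (f := fun g : conf => g k) (g := fun h => Ad h b)).
  exact: (@proj_continuous _ (fun=> G) k).
exact: Ad_cont.
Qed.

Lemma pot_continuous b : continuous (pot b).
Proof.
apply: continuous_mulf; first exact: cst_continuous.
apply: (@continuous_bigsum R _ _ _ xpredT
  (fun k g => \sum_(j | e j k) sqn (adj b g k - adj b g j))) => k _.
apply: (@continuous_bigsum R _ _ _ (fun j => e j k)
  (fun j g => sqn (adj b g k - adj b g j))) => j _.
by apply: continuous_dotv; apply: continuous_subf; exact: adj_continuous.
Qed.

Lemma diss_continuous b : continuous (diss b).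
Proof.
apply: (@continuous_bigsum R _ _ _ xpredT
  (fun k g => sqn (br (lap e (adj b g) k) (adj b g k)))) => k _.
have c : continuous (fun g => br (lap e (adj b g) k) (adj b g k)).
  apply: continuous_br => //; last exact: adj_continuous.
  by apply: (lap_continuous (a := fun k g => adj b g k)) => i; exact: adj_continuous.
exact: continuous_dotv.
Qed.

Lemma eta_continuous k : continuous (fun eta : vels => eta k).
Proof. exact: (@proj_continuous _ (fun=> 'rV[R]_n) k). Qed.

Lemma spread_continuous b : continuous (spread b).
Proof.
apply: (@continuous_bigsum R _ _ _ xpredT (fun k (eta : vels) => sqn (eta k - b))) => k _.
have c : continuous (fun eta : vels => eta k - b).
  by apply: continuous_subf; [exact: eta_continuous | exact: cst_continuous].
exact: continuous_dotv.
Qed.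

Lemma conf_compact : compact [set: conf].
Proof.
have := @tychonoff 'I_N (fun=> G) (fun=> setT) (fun=> Gcompact).
by congr compact; apply/seteqP; split.
Qed.

Lemma vels_compact (M : R) :
  compact [set eta : vels | forall k, forall i, eta k 0 i \in `[- M, M]].
Proof.
apply: (@tychonoff 'I_N (fun=> 'rV[R]_n) (fun=> [set v | forall i, v 0 i \in `[- M, M]])) => _.
exact: (@rV_compact R n (fun=> [set` `[- M, M]]) (fun=> @segment_compact _ _ _)).
Qed.

(** The space of the eta_k is not compact, but spread < 1 confines them to the box of half-width
    [M], where [compact_sublevel] applies. It serves with f = [pot] and no constraint for stability,
    and with f = [diss] and a sublevel set of [pot] for attraction. *)
Lemma coordination_nbhd b (f : conf -> R) (C : set conf) (U : set X) :
  continuous f -> (forall g, 0 <= f g) -> closed C -> open U ->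
  (forall s, spread b s.2 = 0 -> f s.1 = 0 -> C s.1 -> U s) ->
  exists2 d : R, 0 < d & forall s, C s.1 -> spread b s.2 + f s.1 < d -> U s.
Proof.
move=> cf f0 cC oU hU.
pose M := \sum_i `|b 0 i| + 1.
pose K := (C `*` [set eta : vels | forall k, forall i, eta k 0 i \in `[- M, M]]) : set X.
have cK : compact K.
  apply: compact_setX; last exact: vels_compact.
  by rewrite -[C]setTI; exact: compact_closedI conf_compact cC.
have [||||d d0 hd] := @compact_sublevel R X K U (fun s => spread b s.2 + f s.1) cK.
- apply: continuous_addf.
    by move=> s; apply: (continuous_comp (f := snd) (g := spread b)); [exact: cvg_snd | exact: spread_continuous].
  by move=> s; apply: (continuous_comp (f := fst) (g := f)); [exact: cvg_fst | exact: cf].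
- by move=> s _; rewrite addr_ge0 ?spread_ge0.
- exact: oU.
- move=> s [Cs _] /eqP; rewrite paddr_eq0 ?spread_ge0 // => /andP[/eqP h1 /eqP h2].
  exact: hU.
exists (Num.min d 1); first by rewrite lt_min d0 ltr01.
move=> s Cs; rewrite lt_min => /andP[sd s1]; apply: hd sd; split=> //= k i.
have h1 : sqn (s.2 k - b) < 1.
  by apply: le_lt_trans (sqn_le_spread _ _ _) _; have := f0 s.1; lra.
have h2 : (s.2 k 0 i - b 0 i) ^+ 2 < 1.
  by apply: le_lt_trans h1; have := sqr_coord_le (s.2 k - b) i; rewrite !mxE.
have h3 : `|s.2 k 0 i - b 0 i| <= 1.
  by rewrite -(ler_pXn2r (n := 2)) ?nnegrE // real_normK ?num_real // expr1n ltW.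
have h4 : `|b 0 i| <= \sum_i `|b 0 i|.
  by apply: (sum_ge_term (F := fun i => `|b 0 i|)).
rewrite in_itv /= -ler_norml /M.
have -> : s.2 k 0 i = b 0 i + (s.2 k 0 i - b 0 i) by rewrite addrC subrK.
by apply: le_trans (ler_normD _ _) _; exact: lerD.
Qed.

Lemma within_comp (T : topologicalType) (F : X -> T) x : continuous F ->
  {within `[(0 : R), +oo[, continuous x} ->
  {within `[(0 : R), +oo[, continuous (fun t => F (x t))}.
Proof. by move=> cF cx t; exact: (continuous_comp (cx t) (cF _)). Qed.

Lemma conf_comp_continuous (T : topologicalType) (f : conf -> T) :
  continuous f -> continuous (fun s : X => f s.1).
Proof.
move=> cf s; apply: (continuous_comp (f := fst) (g := f)); [exact: cvg_fst | exact: cf].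
Qed.

Lemma vels_comp_continuous (T : topologicalType) (f : vels -> T) :
  continuous f -> continuous (fun s : X => f s.2).
Proof.
move=> cf s; apply: (continuous_comp (f := snd) (g := f)); [exact: cvg_snd | exact: cf].
Qed.

Section Trajectory.
Variable x : R -> X.
Hypothesis hx : trajectory x.

Let cx : {within `[(0 : R), +oo[, continuous x}. Proof. by case: hx. Qed.

Let deta (t : R) k : 0 < t -> is_derive t 1 (fun r => (x r).2 k) (- lap e (x t).2 k).
Proof.
case: hx => _ _ /[apply] h; rewrite (_ : - _ = \sum_(j | e j k) ((x t).2 j - (x t).2 k)).
  exact: h.
by rewrite -sumrN; apply: eq_bigr => j _; rewrite opprB.
Qed.

Lemma mean_const t : 0 <= t -> mean (x t).2 = mean (x 0).2.
Proof.
move=> t0; apply/rowP => i.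
apply: (@const_of_derive0 R (fun r => mean (x r).2 0 i)) t0.
  apply: (within_comp (F := fun s : X => mean s.2 0 i)) cx.
  apply: (vels_comp_continuous (f := fun eta => mean eta 0 i)).
  apply: continuous_coord; apply: continuous_scalef.
  exact: (@continuous_bigsum R _ _ _ xpredT (fun k (eta : vels) => eta k) (fun k _ => @eta_continuous k)).
move=> r r0.
have h := is_derive_scalef (N%:R^-1) (is_derive_sumP (fun k (_ : true) => deta k r0)).
rewrite sumrN lap_sum0 // oppr0 scaler0 in h.
by have := is_derive_coord i h; rewrite mxE.
Qed.

Lemma spread_derive b (t : R) : 0 < t ->
  is_derive t 1 (fun r => spread b (x r).2) (- (2 * disagr e (x t).2)).
Proof.
move=> t0.
have hk k (_ : true) : is_derive t 1 (fun r => sqn ((x r).2 k - b))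
    (2 * - dotv (lap e (x t).2 k) ((x t).2 k - b)).
  have := is_derive_sqn (is_derive_subf (deta k t0) (is_derive_cst b t (1 : R))).
  by rewrite subr0 dotvNr dotvC.
have := is_derive_sumP hk.
suff -> : \sum_k 2 * - dotv (lap e (x t).2 k) ((x t).2 k - b) = - (2 * disagr e (x t).2) by [].
rewrite -mulr_sumr sumrN mulrN -edge_sum_by_parts // -disagr_sum; congr (- _).
apply: eq_bigr => k _; apply: eq_bigr => j _; congr dotv.
by apply/rowP => i; rewrite !mxE; ring.
Qed.

Let b := mean (x 0).2.
(** A Poincare constant of the graph: N terms, each bounded through paths with fewer than N edges.
    Its inverse is the decay rate of [spread]. *)
Definition conn_const : R := N%:R * 4 ^+ N.

Lemma conn_const_gt0 : 0 < conn_const.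
Proof. by rewrite mulr_gt0 ?ltr0n // exprn_gt0. Qed.

Lemma spread_le_disagr t : 0 <= t ->
  spread b (x t).2 <= conn_const * (2 * disagr e (x t).2).
Proof.
move=> t0; rewrite /b -(mean_const t0) /conn_const -mulrA.
have T0 : 0 <= 4 ^+ N * (2 * disagr e (x t).2).
  by apply: mulr_ge0; [exact: exprn_ge0 | apply: mulr_ge0 => //; exact: disagr_ge0].
have := @sum_le_const R 'I_N xpredT (fun k => sqn ((x t).2 k - mean (x t).2)) _ T0.
by rewrite card_ord; apply => k _; exact: sqn_diff_mean_le.
Qed.

Let cspread b' : {within `[(0 : R), +oo[, continuous (fun t => spread b' (x t).2)}.
Proof.
apply: (within_comp (F := fun s : X => spread b' s.2)) cx.
by apply: (vels_comp_continuous (f := spread b')); exact: spread_continuous.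
Qed.

Lemma spread_decay t : 0 <= t ->
  spread b (x t).2 <= spread b (x 0).2 * expR (- conn_const^-1 * t).
Proof.
have H := @gronwall_decay R (fun r => spread b (x r).2)
  (fun r => - (2 * disagr e (x r).2)) conn_const^-1 (@cspread b) (@spread_derive b).
apply: H => r r0.
rewrite mulNr lerN2 mulrC ler_pdivrMr ?conn_const_gt0 // mulrC.
exact/spread_le_disagr/ltW.
Qed.

Lemma spread_le0 t : 0 <= t -> spread b (x t).2 <= spread b (x 0).2.
Proof.
move=> t0; apply: le_trans (spread_decay t0) _; apply: ler_piMr; first exact: spread_ge0.
by rewrite -expR0 ler_expR mulNr oppr_le0 mulr_ge0 // invr_ge0 ltW // conn_const_gt0.
Qed.

Lemma spread_cvg0 : spread b (x t).2 @[t --> +oo] --> (0 : R).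
Proof.
have c0 := conn_const_gt0.
have S0 := spread_ge0 b (x 0).2.
apply/cvgrPdist_le => eps eps0; near=> t.
have t0 : 0 < t by near: t; exact: nbhs_pinfty_gt.
rewrite sub0r normrN ger0_norm ?spread_ge0 //.
apply: le_trans (spread_decay (ltW t0)) _.
have h1 : conn_const^-1 * t <= expR (conn_const^-1 * t).
  by apply: le_trans (expR_ge1Dx _); rewrite lerDr.
have p1 : 0 < conn_const^-1 * t by rewrite mulr_gt0 // invr_gt0.
rewrite mulNr expRN.
rewrite ler_pdivrMr ?expR_gt0 //; apply: le_trans (ler_wpM2l (ltW eps0) h1).
rewrite mulrA -ler_pdivrMl; last by rewrite mulr_gt0 ?invr_gt0.
by near: t; apply: nbhs_pinfty_ge; rewrite num_real.
Unshelve. all: by end_near. Qed.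

Lemma eta_bound t k : 0 <= t -> sqn ((x t).2 k) <= 2 * sqn b + 2 * spread b (x 0).2.
Proof.
move=> t0; have -> : (x t).2 k = b + ((x t).2 k - b) by rewrite addrC subrK.
apply: le_trans (sqnD_le _ _) _; rewrite lerD // ler_wpM2l //.
exact: le_trans (sqn_le_spread _ _ _) (spread_le0 t0).
Qed.

Let adj' c t k := Ad ((x t).1 k) (br (vel (x t) k) c).

Let dadj c (t : R) k : 0 < t -> is_derive t 1 (fun r => adj c (x r).1 k) (adj' c t k).
Proof. by case: hx => _ h _ t0; exact: h. Qed.

Lemma pot_derive c (t : R) : 0 < t ->
  is_derive t 1 (fun r => pot c (x r).1)
    (2 * \sum_k dotv (lap e (adj c (x t).1) k) (adj' c t k)).
Proof.
move=> t0; rewrite -edge_sum_by_parts //.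
have h := is_derive_sumP (fun k (_ : true) => is_derive_sumP (fun j (_ : e j k) =>
  is_derive_sqn (is_derive_subf (dadj c k t0) (dadj c j t0)))).
have := is_derive_mulf (is_derive_cst (2^-1 : R) t (1 : R)) h.
rewrite mul0r add0r mulr_sumr.
set D := (\sum_k _); set D' := (\sum_k _).
suff -> : D = D' by [].
apply: eq_bigr => k _; rewrite mulr_sumr; apply: eq_bigr => j _.
by rewrite mulrA mulVf ?mul1r.
Qed.

Lemma diss_derive c (t : R) : 0 < t ->
  is_derive t 1 (fun r => diss c (x r).1)
    (\sum_k 2 * dotv (br (lap e (adj c (x t).1) k) (adj c (x t).1 k))
      (br (lap e (adj' c t) k) (adj c (x t).1 k) + br (lap e (adj c (x t).1) k) (adj' c t k))).
Proof.
move=> t0.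
have hl k : is_derive t 1 (fun r => lap e (adj c (x r).1) k) (lap e (adj' c t) k).
  apply: (is_derive_sumP (h := fun j r => adj c (x r).1 k - adj c (x r).1 j)) => j _.
  by apply: is_derive_subf; exact: dadj.
apply: (is_derive_sumP (h := fun k r =>
  sqn (br (lap e (adj c (x r).1) k) (adj c (x r).1 k)))) => k _.
by apply: is_derive_sqn; apply: is_derive_br => //; exact: dadj.
Qed.

(** The regularity that Barbalat's lemma asks for: the Ad_{g_k} c have constant norm, and bounded
    controls bound their velocities. *)
Lemma diss_lipschitz (Bd : R) c : 0 <= Bd -> sqn c <= Bd ->
  (forall t k, 0 <= t -> sqn ((x t).2 k) <= Bd) ->
  exists L : R, forall r t : R, 0 < r -> r <= t ->
    `|diss c (x t).1 - diss c (x r).1| <= L * (t - r).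
Proof.
move=> Bd0 hc heta.
have [C C0 hC] := ctl_bound e brC br_lin Bd0.
have [K K0 hK] := sqn_br_le brC br_lin.
(* [M] bounds the squared velocities of the Ad_{g_k} c, and [P y] the squared Laplacian of a family
   whose squared norms are at most [y]. [L1] bounds |u|^2 + |v|^2, hence 2 |u . v|. *)
pose M := K * C * Bd.
have M0 : 0 <= M by rewrite !mulr_ge0.
pose P (y : R) := N%:R * (N%:R * (4 * y)).
have P0 y : 0 <= y -> 0 <= P y by move=> y0; rewrite !mulr_ge0.
pose L1 := K * P Bd * Bd + 2 * (K * P M * Bd) + 2 * (K * P Bd * M).
have L10 : 0 <= L1 by rewrite /L1 !addr_ge0 // !mulr_ge0 // P0.
exists (N%:R * L1); move=> r t.
apply: (lipschitz_of_derive (@diss_derive c)) => s s0.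
apply: le_trans (ler_norm_sum _ _ _) _.
have := @sum_le_const R 'I_N xpredT _ L1 L10; rewrite card_ord; apply => k _.
have ha j : sqn (adj c (x s).1 j) <= Bd by rewrite /sqn Ad_dot.
have ha' j : sqn (adj' c s j) <= M.
  rewrite /sqn Ad_dot; apply: le_trans (hK _ _) _.
  apply: ler_pM => //; rewrite ?mulr_ge0 ?sqn_ge0 // ler_wpM2l //.
  apply: (hC (A (x s).1) (B (x s).1) (x s).2 (config_frame _)) => j'.
  exact/heta/ltW.
have hbr u v (p q : R) : sqn u <= p -> sqn v <= q -> sqn (br u v) <= K * p * q.
  move=> hu hv; apply: le_trans (hK _ _) _.
  by apply: ler_pM => //; rewrite ?mulr_ge0 ?sqn_ge0 // ler_wpM2l.
set u := br _ _; set v := _ + _.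
have hu : sqn u <= K * P Bd * Bd by apply: hbr => //; exact: sqn_lap_bound.
have hv : sqn v <= 2 * (K * P M * Bd) + 2 * (K * P Bd * M).
  apply: le_trans (sqnD_le _ _) _; apply: lerD; rewrite ler_wpM2l //.
    by apply: hbr => //; exact: sqn_lap_bound.
  by apply: hbr => //; exact: sqn_lap_bound.
have h1 := dotv_le u v; have h2 := dotv_le (- u) v.
rewrite dotvNl sqnN in h2; rewrite ler_norml /L1; apply/andP; split; lra.
Qed.

End Trajectory.

(** [kap] is fixed before the trajectory, because the stability estimate needs one constant for all
    small perturbations, whose means differ. *)
Lemma lyapunov (Bd : R) : 0 <= Bd -> exists2 kap : R, 0 <= kap & forall x, trajectory x ->
  let b := mean (x 0).2 in
  sqn b <= Bd -> (forall t k, 0 <= t -> sqn ((x t).2 k) <= Bd) ->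
  (forall t, 0 <= t -> pot b (x t).1 + kap * spread b (x t).2 <=
                       pot b (x 0).1 + kap * spread b (x 0).2) /\
  diss b (x t).1 @[t --> +oo] --> (0 : R).
Proof.
move=> Bd0; have [C C0 hC] := disagr_rate_le e brC br_lin br_skew Bd0.
have c0 := conn_const_gt0.
(* The perturbation is at most C times the spread, the spread is at most [conn_const] times its own
   rate of decrease, and so this weight compensates it. *)
exists (C * conn_const); first by rewrite mulr_ge0 // ltW.
move=> x hx b hb heta; set kap := C * conn_const.
pose W t := pot b (x t).1 + kap * spread b (x t).2.
pose W' t := 2 * \sum_k dotv (lap e (adj b (x t).1) k) (Ad ((x t).1 k) (br (vel (x t) k) b)) +
  (0 * spread b (x t).2 + kap * (- (2 * disagr e (x t).2))).
have cx : {within `[(0 : R), +oo[, continuous x} by case: hx.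
have cW : {within `[(0 : R), +oo[, continuous W}.
  apply: (within_comp (F := fun s : X => pot b s.1 + kap * spread b s.2)) cx.
  apply: continuous_addf; first exact: conf_comp_continuous (@pot_continuous b).
  apply: continuous_mulf; first exact: cst_continuous.
  exact: vels_comp_continuous (@spread_continuous b).
have dW (t : R) : 0 < t -> is_derive t 1 W (W' t).
  move=> t0; apply: is_derive_addf; first exact: (pot_derive hx b t0).
  exact: is_derive_mulf (is_derive_cst _ _ _) (spread_derive hx b t0).
have hW t : 0 < t -> W' t <= - diss b (x t).1.
  move=> t0; have h1 := hC (A (x t).1) (B (x t).1) b (x t).2 (config_frame _) hb
    (fun k => heta t k (ltW t0)).
  rewrite /W' mul0r add0r; apply: le_trans (lerD h1 (lexx _)) _.
  rewrite -addrA gerDl mulrN subr_le0 /kap -mulrA ler_wpM2l //.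
  exact: spread_le_disagr hx _ (ltW t0).
split.
  move=> t t0; apply: (@le_of_derive_le0 R W W' 0 0 t cW dW) => // r r0.
  by apply: le_trans (hW r r0) _; rewrite oppr_le0 diss_ge0.
have [L hL] := diss_lipschitz hx Bd0 hb heta.
apply: (barbalat cW dW hW) hL => t t0.
  by rewrite addr_ge0 ?pot_ge0 // mulr_ge0 ?spread_ge0 // mulr_ge0 // ltW.
exact: diss_ge0.
Qed.

Let bound0 x : 0 <= 2 * sqn (mean (x 0).2) + 2 * spread (mean (x 0).2) (x 0).2.
Proof. by rewrite addr_ge0 // mulr_ge0 // ?sqn_ge0 // spread_ge0. Qed.

Lemma diss_cvg0 x : trajectory x -> diss (mean (x 0).2) (x t).1 @[t --> +oo] --> (0 : R).
Proof.
move=> hx; have [kap _ hk] := lyapunov (bound0 x).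
apply: (hk x hx _ _).2 => [|t k t0]; last exact: eta_bound.
have := sqn_ge0 (mean (x 0).2); have := spread_ge0 (mean (x 0).2) (x 0).2; lra.
Qed.

Lemma vel_diff_cvg0 x j k : trajectory x ->
  vel (x t) j - vel (x t) k @[t --> +oo] --> (0 : 'rV[R]_n).
Proof.
move=> hx; set b := mean (x 0).2.
have [C C0 hC] := ctl_sub_le e brC br_lin (bound0 x).
have hb : sqn b <= 2 * sqn b + 2 * spread b (x 0).2.
  have := sqn_ge0 b; have := spread_ge0 b (x 0).2; lra.
pose f t : R := 2 * diss b (x t).1 + C * spread b (x t).2.
have f0 : f t @[t --> +oo] --> (0 : R).
  rewrite -[0](_ : 2 * 0 + C * 0 = 0 :> R); last by rewrite !mulr0 addr0.
  apply: cvgD; apply: cvgM; [exact: cvg_cst | exact: diss_cvg0 | exact: cvg_cst |].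
  exact: spread_cvg0.
have hv t i : 0 <= t -> sqn (vel (x t) i - b) <= f t.
  move=> t0; apply: (hC (A (x t).1) (B (x t).1) b (x t).2 (config_frame _) hb).
  by move=> i'; exact: eta_bound.
apply/cvgrPdist_le => eps eps0.
(* The squared difference of two velocities is at most 2 f + 2 f. *)
have eps4 : 0 < eps ^+ 2 / 4 by rewrite divr_gt0 // exprn_gt0.
near=> t; rewrite sub0r normrN; apply: rV_norm_le => [|i]; first exact: ltW.
have t0 : 0 <= t by near: t; apply: nbhs_pinfty_ge; rewrite num_real.
have ft : `|0 - f t| <= eps ^+ 2 / 4.
  by near: t; move/cvgrPdist_le : f0; apply.
rewrite sub0r normrN in ft.
rewrite -(ler_pXn2r (n := 2)) ?nnegrE ?(ltW eps0) // real_normK ?num_real //.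
apply: le_trans (sqr_coord_le _ _) _.
have -> : vel (x t) j - vel (x t) k = (vel (x t) j - b) - (vel (x t) k - b).
  by apply/rowP => l; rewrite !mxE; ring.
apply: le_trans (sqnB_le _ _) _.
have := hv t j t0; have := hv t k t0; have := ler_norm (f t); lra.
Unshelve. all: by end_near. Qed.

Lemma conf_converges x (U : set conf) : trajectory x -> open U ->
  (forall g, diss (mean (x 0).2) g = 0 -> U g) -> \forall t \near +oo, U (x t).1.
Proof.
move=> hx oU hU; set b := mean (x 0).2 in hU.
have [d d0 hd] := compact_sublevel conf_compact (@diss_continuous b)
  (fun g _ => diss_ge0 b g) oU (fun g _ => hU g).
have := diss_cvg0 hx; move=> /cvgrPdist_lt/(_ _ d0); apply: filterS => t.
rewrite sub0r normrN ger0_norm ?diss_ge0 // => h.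
exact: hd.
Qed.

(** A zero of [diss] need not be coordinated. Only the zeros in the region [C], in which the
    trajectory stays, have to lie in [U]; closedness of [C] preserves compactness. *)
Lemma state_converges x b (C : set conf) (U : set X) : trajectory x ->
  mean (x 0).2 = b -> closed C -> open U ->
  (forall t, 0 <= t -> C (x t).1) ->
  (forall s, spread b s.2 = 0 -> diss b s.1 = 0 -> C s.1 -> U s) ->
  \forall t \near +oo, U (x t).
Proof.
move=> hx hb cC oU hC hU.
have [d d0 hd] := coordination_nbhd (@diss_continuous b) (diss_ge0 b) cC oU hU.
have h1 := diss_cvg0 hx; have h2 := spread_cvg0 hx; rewrite hb in h1 h2.
have h : spread b (x t).2 + diss b (x t).1 @[t --> +oo] --> (0 : R).
  by rewrite -[0](addr0 (0 : R)); exact: cvgD.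
move/cvgrPdist_lt/(_ _ d0) : h => h; near=> t; apply: hd.
  by apply: hC; near: t; apply: nbhs_pinfty_ge; rewrite num_real.
have : `|0 - (spread b (x t).2 + diss b (x t).1)| < d by near: t.
by rewrite sub0r normrN ger0_norm // addr_ge0 ?spread_ge0 ?diss_ge0.
Unshelve. all: by end_near. Qed.

(* The estimate compares potentials for [b] and for the conserved mean of the
   trajectory, which differs from [b] by at most the initial spread. *)
Lemma stability_estimate b : exists2 C : R, 0 < C & forall x, trajectory x ->
  spread b (x 0).2 + pot b (x 0).1 < 1 ->
  forall t, 0 <= t -> spread b (x t).2 + pot b (x t).1 <=
                      C * (spread b (x 0).2 + pot b (x 0).1).
Proof.
have NR : 1 <= (N%:R : R) by rewrite ler1n.
(* Room for 2 |b'|^2 plus twice the initial spread about b', where b' is the perturbed mean: |b'|^2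
   <= 2 |b|^2 + 2, and that spread is at most 2 + 2 N. *)
pose Bd := 4 * sqn b + 8 + 8 * N%:R : R.
have Bd0 : 0 <= Bd by rewrite /Bd; have := sqn_ge0 b; lra.
have [kap kap0 hk] := lyapunov Bd0.
(* 100 generously exceeds the sums of the numerical coefficients collected in [s1], after all powers
   of m are raised to m^2. *)
pose m : R := N%:R; pose CC : R := 100 * m ^+ 2 * (1 + kap).
have m1 : 1 <= m by [].
have CC0 : 0 < CC by rewrite /CC !mulr_gt0 // ?exprn_gt0 //; lra.
have spread_shift (b1 b2 : 'rV[R]_n) (eta : vels) :
    spread b1 eta <= 2 * spread b2 eta + 2 * m * sqn (b2 - b1).
  apply: (@le_trans _ _ (\sum_k (2 * sqn (eta k - b2) + 2 * sqn (b2 - b1)))).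
    apply: ler_sum => k _.
    have -> : eta k - b1 = (eta k - b2) + (b2 - b1) by rewrite addrA subrK.
    exact: sqnD_le.
  rewrite big_split /= -mulr_sumr sumr_const card_ord -[X in _ + X]mulr_natl /m.
  by rewrite le_eqVlt; apply/orP; left; apply/eqP; rewrite /spread; ring.
have pot_shift (b1 b2 : 'rV[R]_n) (g : conf) :
    pot b1 g <= 2 * pot b2 g + 4 * m ^+ 2 * sqn (b2 - b1).
  have hterm k j : sqn (adj b1 g k - adj b1 g j) <=
      2 * sqn (adj b2 g k - adj b2 g j) + 8 * sqn (b2 - b1).
    have -> : adj b1 g k - adj b1 g j =
      (adj b2 g k - adj b2 g j) - (Ad (g k) (b2 - b1) - Ad (g j) (b2 - b1)).
      by rewrite /adj !linearB /=; apply/rowP => i; rewrite !mxE; ring.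
    apply: le_trans (sqnB_le _ _) _.
    have h1 := sqnB_le (Ad (g k) (b2 - b1)) (Ad (g j) (b2 - b1)).
    rewrite /sqn !Ad_dot -!/(sqn _) in h1; rewrite -/(sqn _) in h1.
    lra.
  have S0 := sqn_ge0 (b2 - b1).
  have h8 : 0 <= 8 * sqn (b2 - b1) by rewrite mulr_ge0.
  rewrite /pot /disagr.
  have hk1 k : \sum_(j | e j k) sqn (adj b1 g k - adj b1 g j) <=
     2 * (\sum_(j | e j k) sqn (adj b2 g k - adj b2 g j)) + m * (8 * sqn (b2 - b1)).
    apply: le_trans (ler_sum _ (fun j _ => hterm k j)) _.
    rewrite big_split /= -mulr_sumr; apply: lerD => //.
    have := @sum_le_const R 'I_N (fun j => e j k) (fun=> 8 * sqn (b2 - b1)) _ h8 (fun _ _ => lexx _).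
    by rewrite card_ord.
  have h2 : \sum_k \sum_(j | e j k) sqn (adj b1 g k - adj b1 g j) <= \sum_(k < N)
     (2 * (\sum_(j | e j k) sqn (adj b2 g k - adj b2 g j)) + m * (8 * sqn (b2 - b1))).
    by apply: ler_sum => k _; exact: hk1.
  rewrite big_split /= -mulr_sumr sumr_const card_ord -[X in _ + X]mulr_natl -/m in h2.
  have h3 := ler_wpM2l (_ : 0 <= (2^-1 : R)) h2.
  apply: le_trans (h3 _) _; first by rewrite invr_ge0.
  by rewrite le_eqVlt; apply/orP; left; apply/eqP; field.
exists CC => // x hx h1 t t0.
set b' := mean (x 0).2.
set E0 := spread b (x 0).2 in h1 *; set V0 := pot b (x 0).1 in h1 *.
have E00 : 0 <= E0 by exact: spread_ge0.
have V00 : 0 <= V0 by exact: pot_ge0.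
have q_le : sqn (b - b') <= E0.
  have -> : b - b' = - (N%:R^-1 *: \sum_k ((x 0).2 k - b)).
    rewrite sumrB sumr_const card_ord -[b *+ N]scaler_nat scalerBr scalerA mulVf.
      by rewrite scale1r opprB.
    by rewrite pnatr_eq0 -lt0n.
  rewrite sqnN sqnZ.
  have h2 := sqn_sum_le xpredT (fun k => (x 0).2 k - b); rewrite card_ord -/m in h2.
  have m2 : 0 <= m^-1 ^+ 2 by rewrite exprn_ge0 // invr_ge0; lra.
  apply: le_trans (ler_wpM2l m2 h2) _; rewrite -/E0 /E0 -/(spread b (x 0).2).
  have -> : m^-1 ^+ 2 * (m * spread b (x 0).2) = m^-1 * spread b (x 0).2.
    by field; rewrite gt_eqF //; lra.
  by apply: ler_piMl; [exact: spread_ge0 | rewrite invf_le1 //; lra].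
have q0 := sqn_ge0 (b - b').
have qs : sqn (b' - b) = sqn (b - b') by exact: sqnBC.
have hb' : sqn b' <= 2 * sqn b + 2.
  have -> : b' = b - (b - b') by rewrite opprB addrC subrK.
  by apply: le_trans (sqnB_le _ _) _; lra.
have hE0' := spread_shift b' b (x 0).2.
have hV0' := pot_shift b' b (x 0).1.
rewrite -/E0 in hE0'; rewrite -/V0 in hV0'.
have sb := sqn_ge0 b.
have mq : m * sqn (b - b') <= m * E0 by rewrite ler_wpM2l //; lra.
have mE : m * E0 <= m by rewrite ler_piMr //; lra.
have hbB : sqn b' <= Bd by rewrite /Bd -/m; lra.
have hetaB r k : 0 <= r -> sqn ((x r).2 k) <= Bd.
  move=> r0; apply: le_trans (eta_bound hx k r0) _; rewrite -/b' /Bd -/m.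
  rewrite -mulrA in hE0'; lra.
have [hW _] := hk x hx hbB hetaB.
have := hW t t0; rewrite -/b' => {}hW.
have hEt := spread_shift b b' (x t).2.
have hVt := pot_shift b b' (x t).1.
have hEd := spread_le0 hx t0; rewrite -/b' in hEd.
have Et0 := spread_ge0 b' (x t).2.
have kE : kap * spread b' (x 0).2 <= kap * (2 * E0 + 2 * m * E0).
  rewrite ler_wpM2l //; apply: le_trans hE0' _; rewrite -!mulrA; lra.
have kEt : 0 <= kap * spread b' (x t).2 by rewrite mulr_ge0.
have m2q : m ^+ 2 * sqn (b - b') <= m ^+ 2 * E0 by rewrite ler_wpM2l // exprn_ge0 //; lra.
rewrite qs in hEt hVt.
have mm : m <= m ^+ 2 by rewrite expr2 ler_peMl //; lra.
have m2 : 1 <= m ^+ 2 by lra.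
have s1 : spread b (x t).2 + pot b (x t).1 <=
    4 * E0 + 4 * (m * E0) + 2 * (m * E0) + 2 * (2 * V0 + 4 * (m ^+ 2 * E0) + kap * (2 * E0 + 2 * m * E0))
    + 4 * (m ^+ 2 * E0).
  rewrite -!mulrA in hEt hVt hE0' hV0'; rewrite -!mulrA.
  rewrite -!mulrA in kE.
  lra.
apply: le_trans s1 _.
have e1 : E0 <= m ^+ 2 * E0 by rewrite ler_peMl.
have e2 : m * E0 <= m ^+ 2 * E0 by rewrite ler_wpM2r.
have e3 : V0 <= m ^+ 2 * V0 by rewrite ler_peMl.
have e4 : kap * E0 <= kap * (m ^+ 2 * E0) by rewrite ler_wpM2l.
have e5 : kap * (m * E0) <= kap * (m ^+ 2 * E0) by rewrite ler_wpM2l.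
have mm0 : 0 <= m ^+ 2 by lra.
have e6 : 0 <= kap * (m ^+ 2 * V0) := mulr_ge0 kap0 (mulr_ge0 mm0 V00).
have e7 : 0 <= kap * (m ^+ 2 * E0) := mulr_ge0 kap0 (mulr_ge0 mm0 E00).
have -> : CC * (E0 + V0) = 100 * (m ^+ 2 * E0) + 100 * (m ^+ 2 * V0)
   + 100 * (kap * (m ^+ 2 * E0)) + 100 * (kap * (m ^+ 2 * V0)) by rewrite /CC; ring.
have -> : kap * (2 * E0 + 2 * m * E0) = 2 * (kap * E0) + 2 * (kap * (m * E0)) by ring.
have e8 : 0 <= m ^+ 2 * E0 := mulr_ge0 mm0 E00.
lra.
Qed.

End Dynamics.

(** * Differentials of products and of matrix rows *)

Section Products.
Context {R : realType}.

Lemma has_diff_mul (V : normedModType R) (f g df dg : V -> R) (x : V) :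
  has_diff f x df -> has_diff g x dg ->
  has_diff (fun y => f y * g y) x (fun v => df v * g x + f x * dg v).
Proof.
move=> [f1 f2] [g1 g2]; split; first exact: differentiableM f1 g1.
apply/funext => v; apply: (etrans (congr1 (@^~ v) (diffM f1 g1))).
apply: (etrans (f_equal2 (fun p q => f x * p + g x * q)
  (congr1 (@^~ v) g2) (congr1 (@^~ v) f2))).
by rewrite addrC (mulrC (g x)).
Qed.

Lemma has_diff_dotv (V : normedModType R) n (u v du dv : V -> 'rV[R]_n) (x : V) :
  has_diff u x du -> has_diff v x dv ->
  has_diff (fun y => dotv (u y) (v y)) x (fun h => dotv (du h) (v x) + dotv (u x) (dv h)).
Proof.
move=> hu hv.
have := has_diff_sum (fun i (_ : true) =>
  has_diff_mul (has_diff_coord i hu) (has_diff_coord i hv)).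
by congr has_diff; apply/funext => h; rewrite big_split.
Qed.

Lemma has_diff_rowk m n (k : 'I_m) (x : 'M[R]_(m, n)) : has_diff (row k) x (row k).
Proof.
apply: has_diff_row => i.
have lin : linear (fun y : 'M[R]_(m, n) => y k i) by move=> a u v; rewrite !mxE.
pose lM := GRing.isLinear.Build _ _ _ _ _ lin.
pose l : {linear 'M[R]_(m, n) -> R} := HB.pack (fun y : 'M[R]_(m, n) => y k i) lM.
have cl : continuous l by exact: coord_continuous.
have h : has_diff l x l by split; [exact: linear_differentiable | exact: diff_lin].
have E : (fun y : 'M[R]_(m, n) => row k y 0 i) = l by apply/funext => y; rewrite mxE.
rewrite E; exact: h.
Qed.

End Products.

(** * The closed loop on the Lie group *)

Section LieCoordination.
Context {R : realType} {n : nat} {G : lieGroupType R n}.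
Hypothesis Gcompact : compact [set: G].
Hypothesis Ad_unitary : forall (g : G) (xi : 'rV[R]_n), enorm (Ad g xi) = enorm xi.
Implicit Types (b u v xi eta : 'rV[R]_n).

Local Notation br := (bracket (G := G)).
Local Notation AdL := (fun g : G => Ad g : {linear 'rV[R]_n -> 'rV[R]_n}).
Local Notation AdR := (fun g h : G => Ad (g^-1 * h)%g : {linear 'rV[R]_n -> 'rV[R]_n}).

Lemma Ad_AdR (g h : G) u : AdL g (AdR g h u) = AdL h u.
Proof. by apply: etrans (esym (AdM _ _ _)) _; rewrite mulVKg. Qed.

Lemma Lstar_vder (p : G) xi :
  Lstar p 1%g xi = vder p (fun x => (p * cinv 1%g x)%g) (e0 (G := G)) xi.
Proof. by rewrite /Lstar /tangent_map mulg1. Qed.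

(** By [Ad_vdiff] it suffices that s |-> p^-1 c(s) has velocity [xi] at the identity. It does,
    because p^-1 (p y) = y makes the differential of left translation by p^-1 undo [Lstar]. *)
Lemma Ad_velocity (c : R -> G) (t : R) xi eta :
  has_velocity c t (Lstar (c t) 1%g xi) ->
  is_derive t 1 (fun s => Ad (c s) eta) (Ad (c t) (br xi eta)).
Proof.
move=> [cc [dc dE]]; set p := c t in dE *.
have difc : differentiable (fun s => atl p (c s)) t by apply/derivable1_diffP.
have hc : vdiff c t p by split; [exact: atl_dom | exact: cc | exact: difc].
have pp : chart_dom (atl (1%g : G)) (p^-1 * cinv p (atl p p))%g.
  by rewrite cinv_atl mulVg; exact: atl_dom.
have hf : vdiff ((fun y => p^-1 * y)%g \o cinv p) (atl p p) 1%g.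
  exact: vdiff_mull (vdiff_cinv (atl_cod p)).1 pp.
have [_ E1] := vdiff_comp (f := fun y => (p^-1 * y)%g) hc hf.
have hL := vdiff_Lcinv (atl_dom p).
have cp : (p * cinv 1%g (e0 (G := G)))%g = p by rewrite cinv_e0 mulg1.
have hf' : vdiff ((fun y => p^-1 * y)%g \o cinv p) (atl p (p * cinv 1%g (e0 (G := G)))%g) 1%g.
  by rewrite cp.
have [_ E2] := vdiff_comp (f := fun y => (p^-1 * y)%g) hL hf'.
have E3 : (fun y => (p^-1 * y)%g) \o (fun x => (p * cinv 1%g x)%g) = cinv (1%g : G).
  by apply/funext => x /=; rewrite mulKg.
rewrite E3 (vdiff_cinv (e0_cod (G := G))).2 cp in E2.
have EL := Lstar_vder p xi.
have Ev : vder 1%g (fun s => (p^-1 * c s)%g) t 1 = xi.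
  apply: etrans (congr1 (@^~ (1 : R)) E1) _ => /=.
  have -> : vder p c t 1 = vder p (fun x => (p * cinv 1%g x)%g) (e0 (G := G)) xi.
    exact: etrans (esym (deriveE (1 : R) difc)) (etrans dE EL).
  exact: (esym (congr1 (@^~ xi) E2)).
have H := Ad_vdiff Ad_unitary eta hc.
have := has_diff_derive (c := fun s : R => s) H (is_derive_id t (1 : R)).
by rewrite -/p Ev.
Qed.

(** [orbit_tangent] requires Ad_h b and b to pair equally with central elements. If h = h1 h0 with
    h0 fixing b and h1 near 1, then Ad_h b = Ad_{h1} b and Ad_{h1} fixes the centre, so isometry
    gives this. Such h form the open set [U], and compactness of [G] gives the threshold [d] that
    forces h into it. *)
Lemma orbit_tangent_Ad b : exists d K : R, [/\ 0 < d, 0 <= K &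
  forall h : G, sqn (Ad h b - b) < d ->
    exists z, sqn (Ad h b - b - br z b) <= K * sqn (Ad h b - b) ^+ 2].
Proof.
have brC := @bracketC R n G.
have br_lin := bracket_linear Ad_unitary.
have br_skew := dotv_bracketl Ad_unitary.
have br_br := dotv_bracket_bracket Ad_unitary.
have [K K0 hK] := orbit_tangent brC br_lin br_skew br_br b.
have hn : nbhs (1%g : G) (fun h => forall y, (forall v, br v y = 0) -> Ad h y = y).
  exact: near_Ad_central Ad_unitary.
move: hn; rewrite nbhsE => -[W [oW W1] hW].
pose U := [set h : G | exists2 h0, Ad h0 b = b & W (h * h0^-1)%g].
have oU : open U.
  have -> : U = \bigcup_(h0 in [set h0 : G | Ad h0 b = b]) ((fun h => h * h0^-1)%g @^-1` W).
    by apply/seteqP; split=> h [h0 ? ?]; exists h0.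
  apply: bigcup_open => h0 _; apply: open_comp => // h _.
  apply: (mul_continuous (a := fun h : G => h) (b := fun _ : G => h0^-1%g)).
    exact: cvg_id.
  exact: cst_continuous.
have cf : continuous (fun h : G => sqn (Ad h b - b)).
  have c : continuous (fun h : G => Ad h b - b).
    by apply: continuous_subf; [exact: Ad_continuous | exact: cst_continuous].
  exact: continuous_dotv.
have fU h : setT h -> sqn (Ad h b - b) = 0 -> U h.
  move=> _ /eqP; rewrite sqn_eq0 subr_eq0 => /eqP hb.
  by exists h => //; rewrite mulgV.
have [d d0 hd] := compact_sublevel Gcompact cf (fun h _ => sqn_ge0 _) oU fU.
exists d, K; split=> // h hbd.
have [h0 hb Wh] := hd h I hbd.
apply: (hK (Ad h)).
  by split; [exact: Ad_linear | exact: dotv_Ad | exact: Ad_bracket].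
move=> y hy.
have -> : h = ((h * h0^-1) * h0)%g by rewrite mulgVK.
rewrite AdM hb; set h1 := (h * h0^-1)%g in Wh *.
by rewrite -{1}(hW h1 Wh y hy) dotv_Ad.
Qed.

Section Network.
Variables (N : nat) (e : rel 'I_N).
Hypotheses (Npos : (0 < N)%N) (e_sym : symmetric e) (e_conn : forall j k, connect e j k).
Variable angle : 'rV[R]_n -> 'rV[R]_n -> 'rV[R]_n.
Hypothesis angleP : forall xi1 xi2 xi3 : 'rV[R]_n,
  dotv xi1 (angle xi2 xi3) + dotv (br xi1 xi2) xi3 = 0.

Lemma angleE u v : angle u v = br v u.
Proof.
apply/eqP; rewrite -subr_eq0; apply/eqP; apply: dotv_eq0 => w.
have h1 := angleP w u v.
have h2 := dotv_bracketl Ad_unitary u w v.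
have h3 : dotv (br w u) v = - dotv (br u w) v by rewrite (bracketC w u) dotvNl.
have h4 : dotv w (br v u) = - dotv w (br u v) by rewrite (bracketC v u) dotvNr.
rewrite dotvBr h4; lra.
Qed.

Lemma xil_vel (s : state G N) k : xil e angle s k = vel e br AdR s k.
Proof. by rewrite /xil /qctrl angleE. Qed.

Lemma Vtl_pot b (g : {ptws 'I_N -> G}) : Vtl e b g = pot e AdL b g.
Proof.
congr (_ * _); apply: eq_bigr => k _; apply: eq_bigr => j _.
exact: enorm_sqr.
Qed.

Lemma closed_loop_trajectory (x : R -> state G N) :
  closed_loop e angle x -> trajectory e br AdL AdR x.
Proof.
move=> [cx hg heta]; split; [exact: cx | | exact: heta].
move=> t k b t0; rewrite -xil_vel.
exact: Ad_velocity (hg t k t0).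
Qed.

Lemma critical_of_dissipation_free b (g : {ptws 'I_N -> G}) :
  diss e br AdL b g = 0 -> critical_set (Vtl e b) g.
Proof.
move=> hdiss.
have fr := config_frame (br := br) (Ad := AdL) (Adr := AdR)
  (dotv_Ad Ad_unitary) (Ad_bracket Ad_unitary) Ad_AdR g.
pose x0 : 'M[R]_(N, n) := \matrix_(k < N) atl (g k) (g k).
have rx0 k : row k x0 = atl (g k) (g k) by exact: rowK.
pose a k (x : 'M[R]_(N, n)) := Ad (cinv (g k) (row k x)) b.
(* The left velocity of agent k under the coordinate variation [row k v], the direction to be fed to
   [stationary]. *)
pose y k (v : 'M[R]_(N, n)) :=
  vder 1%g (fun s => (g k)^-1 * cinv (g k) s)%g (atl (g k) (g k)) (row k v).
have ha k : has_diff (a k) x0 (fun v : 'M[R]_(N, n) => Ad (g k) (br (y k v) b)).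
  have h := Ad_vdiff Ad_unitary b (vdiff_cinv (atl_cod (g k))).1.
  rewrite cinv_atl -rx0 in h.
  have := has_diff_comp (has_diff_rowk k x0) h.
  by rewrite rx0.
have a0 k : a k x0 = Ad (g k) b by rewrite /a rx0 cinv_atl.
pose F x := 2^-1 * \sum_k \sum_(j | e j k) sqn (a k x - a j x).
have hF : has_diff F x0 (fun=> 0).
  have hkj k j := has_diff_dotv (has_diffB (ha k) (ha j)) (has_diffB (ha k) (ha j)).
  have hs := has_diff_sum (fun k (_ : true) => has_diff_sum (fun j (_ : e j k) => hkj k j)).
  have := has_diff_mul (has_diff_cst (2^-1 : R) x0) hs.
  congr has_diff; apply/funext => v; rewrite mul0r add0r.
  have S := stationary e_sym (@bracketC R n G) (dotv_bracketl Ad_unitary) (y ^~ v) fr hdiss.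
  apply: (@etrans _ _ (2^-1 * (2 * 0))); last by rewrite !mulr0.
  rewrite -[in RHS]S; congr (_ * _); rewrite mulr_sumr; apply: eq_bigr => k _.
  rewrite mulr_sumr; apply: eq_bigr => j _.
  by rewrite !a0 dotvC; ring.
have FE : (fun x : 'M[R]_(N, n) => Vtl e b (fun k => chart_inv (atl (g k)) (row k x))) = F.
  apply/funext => x; exact: Vtl_pot.
rewrite /critical_set /= FE; split; first exact: hF.1.
by move=> v; exact: (congr1 (@^~ v) hF.2).
Qed.

End Network.
End LieCoordination.

Theorem theorem2 (R : realType) (n : nat) (G : lieGroupType R n)
    (Gcompact : compact [set: G])
    (Ad_unitary : forall (g : G) (xi : 'rV[R]_n), enorm (Ad g xi) = enorm xi)
    (angle : 'rV[R]_n -> 'rV[R]_n -> 'rV[R]_n)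
    (angleP : forall xi1 xi2 xi3 : 'rV[R]_n,
       dotv xi1 (angle xi2 xi3) + dotv (bracket (G := G) xi1 xi2) xi3 = 0)
    (N : nat) (Npos : (0 < N)%N)
    (e : rel 'I_N) (e_undirected : symmetric e)
    (e_connected : forall j k : 'I_N, connect e j k) :
  [/\ (* (i) *)
      forall x : R -> state G N, closed_loop e angle x ->
        exists C lambda : R, 0 < lambda /\
          forall (k : 'I_N) (t : R), 0 <= t ->
            enorm ((x t).2 k - mean_eta (x 0)) <= C * expR (- lambda * t),
      (* (ii) *)
      forall x : R -> state G N, closed_loop e angle x ->
        converges_to_set (fun t => (x t).1)
          (critical_set (Vtl e (mean_eta (x 0)))) /\
        (forall j k : 'I_N,
           xil e angle (x t) j - xil e angle (x t) k @[t --> +oo] --> (0 : 'rV[R]_n)) &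
      (* (iii) *)
      forall etabar : 'rV[R]_n,
        asymptotically_stable (closed_loop e angle)
          [set s : state G N | mean_eta s = etabar]
          (total_coordination e etabar)].
Proof.
pose AdL := fun g : G => Ad g : {linear 'rV[R]_n -> 'rV[R]_n}.
pose AdR := fun g h : G => Ad (g^-1 * h)%g : {linear 'rV[R]_n -> 'rV[R]_n}.
have brC := @bracketC R n G.
have br_lin := bracket_linear Ad_unitary.
have br_skew := dotv_bracketl Ad_unitary.
have Adot := dotv_Ad Ad_unitary.
have Abr := Ad_bracket Ad_unitary.
have AAR : forall g h u, AdL g (AdR g h u) = AdL h u by exact: Ad_AdR.
have Acont : forall b, continuous (fun g => AdL g b) by exact: Ad_continuous Ad_unitary.
have traj := closed_loop_trajectory (e := e) Ad_unitary angleP.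
pose k0 := Ordinal Npos.
split.
- move=> x hx.
  have c0 := conn_const_gt0 (R := R) Npos.
  set c := @conn_const R N in c0 *.
  set S := spread (mean (x 0).2) (x 0).2.
  (* [spread] is a sum of squared norms, so its rate is halved for the norm itself. *)
  exists (Num.sqrt S), (c^-1 / 2); split; first by rewrite divr_gt0 // invr_gt0.
  move=> k t t0.
  have h := spread_decay e_undirected e_connected Npos (traj x hx) t0.
  have p0 : 0 <= Num.sqrt S * expR (- (c^-1 / 2) * t) := mulr_ge0 (sqrtr_ge0 _) (expR_ge0 _).
  rewrite -(ler_pXn2r (n := 2)) ?nnegrE ?sqrtr_ge0 //.
  rewrite enorm_sqr exprMn sqr_sqrtr ?spread_ge0 // [expR _ ^+ 2]expr2 -expRD.
  have -> : - (c^-1 / 2) * t + - (c^-1 / 2) * t = - c^-1 * t by field; rewrite gt_eqF.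
  exact: le_trans (sqn_le_spread (mean (x 0).2) (x t).2 k) h.
- move=> x hx; split.
  + move=> U oU hU.
    apply: (conf_converges e_undirected e_connected Npos brC br_lin br_skew Adot Abr AAR
      Acont Gcompact (traj x hx) oU) => g hg.
    apply: hU.
    exact: (critical_of_dissipation_free Ad_unitary e_undirected hg).
  + move=> j k.
    have := vel_diff_cvg0 e_undirected e_connected Npos brC br_lin br_skew Adot Abr AAR
      Acont j k (traj x hx).
    apply: cvg_trans; apply: near_eq_cvg; near=> t.
    have E := xil_vel Ad_unitary e angleP (x t).
    exact: esym (f_equal2 (fun u v => u - v) (E j) (E k)).
- move=> b.
  have [C C0 hC] := stability_estimate e_undirected e_connected Npos brC br_lin br_skew
    Adot Abr AAR Acont b.
  have cpot : continuous (pot e AdL b) by exact: pot_continuous Acont b.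
  have totE (s : state G N) : spread b s.2 = 0 -> pot e AdL b s.1 = 0 ->
      total_coordination e b s.
    move=> h1 h2; split; last by rewrite Vtl_pot.
    move=> k; apply/eqP; rewrite -subr_eq0 -sqn_eq0 eq_le sqn_ge0 andbT -h1.
    exact: sqn_le_spread.
  pose f (s : state G N) : R := spread b s.2 + pot e AdL b s.1.
  have cf : continuous f.
    apply: continuous_addf.
      by apply: vels_comp_continuous; exact: spread_continuous.
    exact: conf_comp_continuous cpot.
  have nbhd d : 0 < d -> exists W : set (state G N),
      [/\ open W, total_coordination e b `<=` W & forall s, W s -> f s < d].
    move=> d0; exists (f @^-1` [set r | r < d]); split.
    + by apply: open_comp; [move=> s _; exact: cf | exact: open_lt].
    + move=> s [h1 h2] /=; rewrite /f -Vtl_pot h2 addr0 /spread big1 // => k _.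
      by rewrite h1 subrr sqn0.
    + by [].
  split.
  + move=> U oU hU.
    have [d d0 hd] := coordination_nbhd Gcompact cpot (fun g => pot_ge0 e AdL b g)
      closedT oU (fun s h1 h2 _ => hU s (totE s h1 h2)).
    have m0 : 0 < Num.min 1 (d / C) by rewrite lt_min ltr01 divr_gt0.
    have [W [oW tW hW]] := nbhd _ m0.
    exists W; split=> // x hx Wx t t0.
    have := hW _ Wx; rewrite lt_min => /andP[h1 h2].
    apply: hd => //; apply: le_lt_trans (hC x (traj x hx) h1 t t0) _.
    by rewrite mulrC -ltr_pdivlMr.
  + have [d [K [d0 K0 horb]]] := orbit_tangent_Ad Gcompact Ad_unitary b.
    have [d1 d10 hd1] := isolated_coordination e_undirected brC br_skew e_connected k0 d0 K0.
    (* The bound 1 is the smallness required by [hC]. Half of [d1] is used because the region [D]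
       must be closed, hence given by a weak inequality, while [hd1] asks for a strict one. *)
    have m0 : 0 < Num.min 1 (d1 / 2 / C) by rewrite lt_min ltr01 !divr_gt0.
    have [W [oW tW hW]] := nbhd _ m0.
    exists W; split=> // x hx Mx Wx U oU hU.
    have := hW _ Wx; rewrite lt_min => /andP[h1 h2].
    pose D := [set g : {ptws 'I_N -> G} | pot e AdL b g <= d1 / 2].
    have cD : closed D.
      apply: (@preimage_closed _ _ (pot e AdL b) [set r | r <= d1 / 2]); last exact: closed_le.
      by move=> g _; exact: cpot.
    apply: (state_converges e_undirected e_connected Npos brC br_lin br_skew Adot Abr AAR
      Acont Gcompact (traj x hx) Mx cD oU).
      move=> t t0.
      have h4 : C * f (x 0) <= d1 / 2 by rewrite mulrC -ler_pdivlMr // ltW.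
      have drop_spread (p q r : R) : 0 <= p -> p + q <= r -> q <= r by lra.
      exact: (drop_spread _ _ _ (spread_ge0 b (x t).2) (le_trans (hC x (traj x hx) h1 t t0) h4)).
    move=> s h3 h4 h5; apply: hU; apply: totE => //.
    have fr := config_frame (Ad := AdL) (Adr := AdR) Adot Abr AAR s.1.
    apply: (hd1 _ _ b fr _ h4).
      by move=> k j; exact: horb.
    by rewrite /D /= in h5; apply: le_lt_trans h5 _; rewrite ltr_pdivrMr // mulr_natr mulr2n ltrDl.
Unshelve. all: by end_near. Qed.
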